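(* Let $\hat\omega\in\Omega$ and let $\mathfrak m(\hat\omega)=(m_{\sigma\nu}(\hat\omega))_{\sigma,\nu\in\mathcal C}$ be the matrix defined in the context. Then $$\mathrm{Res}_{\hat\omega}U(k,\cdot)=\mathcal E(k,\hat\omega)\,\mathfrak m(\hat\omega),\qquad k=0,1,2,\ldots.$$ The diagonal elements $m_{\nu\nu}(\hat\omega)$, $\nu\in\mathcal C$, satisfy $$\|\phi^\nu(\hat\omega)\|^2=-\frac{b_\nu\big(1-\theta_\nu(\hat\omega)^{-2}\big)}{b\big(1-\overline{\hat\omega}^{\,-2}\big)}\,\theta_\nu(\hat\omega)\,m_{\nu\nu}(\hat\omega),$$ where $\phi^\nu=\phi^\nu(\alpha,\hat\omega)$, $\alpha\in\mathcal A$, is the eigenvector of $\mathcal L$ (described in the context) corresponding to the eigenvalue $\lambda(\hat\omega)=a-b(\hat\omega+\hat\omega^{-1})$ and such that $$\phi^\nu(\sigma(k),\hat\omega)=e_\sigma(k,\theta_\sigma(\hat\omega))\,m_{\sigma\nu}(\hat\omega),\qquad\sigma\in\mathcal C,\ k\ge0,$$ and $\|\cdot\|$ is the norm of $l^2(\mathcal A)$.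
   Context: **System.** $\mathcal A$ is a countable set (''particles'') and $\mathcal L=(L(\alpha,\beta))_{\alpha,\beta\in\mathcal A}$ is a real symmetric matrix with finitely many non-zero entries in each row, such that $\mathcal L>0$ as an operator in $l^2(\mathcal A)$. Particles $\alpha,\beta$ interact if $L(\alpha,\beta)\ne0$. A channel is a sequence $\sigma=\{\sigma(k)\}_{k\ge0}$ of particles such that for $k>0$ the particle $\sigma(k)$ interacts, apart from possibly itself (external field), only with $\sigma(k-1)$ and $\sigma(k+1)$, while $\sigma(0)$ interacts with $\sigma(1)$ and some other particles not in $\sigma$. The set $\mathcal C$ of all channels is finite, the attachment points $\sigma(0)$ are pairwise distinct, $\mathcal A_0=\bigcup_{\sigma\in\mathcal C}\{\sigma(k):k\ge1\}$, and $\mathcal A_1=\mathcal A\setminus\mathcal A_0$ is finite. Put $\mathfrak b_\sigma(k-1)=-L(\sigma(k-1),\sigma(k))$, $\mathfrak a_\sigma(k)=L(\sigma(k),\sigma(k))$, $k\ge1$; it is assumed that $\mathfrak b_\sigma(k)>0$. There are $a_\sigma\in\mathbb R$, $b_\sigma>0$ and $\epsilon>0$ with $\sum_{k\ge1}(1+\epsilon)^k\{|\mathfrak a_\sigma(k)-a_\sigma|+|\mathfrak b_\sigma(k)-b_\sigma|\}<\infty$ for every $\sigma\in\mathcal C$. The set $\bigcup_\sigma(a_\sigma-2b_\sigma,a_\sigma+2b_\sigma)$ is connected, and $a,b$ are such that $\bigcup_\sigma[a_\sigma-2b_\sigma,a_\sigma+2b_\sigma]=[a-2b,a+2b]$. **Spectral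 variables.** $\mathbb D$ is the unit disk, $\mathbb T$ the unit circle, $W(\omega)=a-b(\omega+\omega^{-1})$, $W_\sigma(\theta)=a_\sigma-b_\sigma(\theta+\theta^{-1})$ on $\mathbb D$, $\lambda(\omega)=W(\omega)$, $\theta_\sigma(\omega)=W_\sigma^{-1}\circ W(\omega)\in\mathbb D$ for $\omega\in\mathbb D$, extended to $\overline{\mathbb D}$. **Jost solutions.** For each $\sigma$, $e_\sigma(k,\theta)$, $k\ge0$, is the solution of $-\mathfrak b_\sigma(k-1)e_\sigma(k-1,\theta)+\mathfrak a_\sigma(k)e_\sigma(k,\theta)-\mathfrak b_\sigma(k)e_\sigma(k+1,\theta)=W_\sigma(\theta)e_\sigma(k,\theta)$, $k\ge1$, with $e_\sigma(k,\theta)=\theta^k(1+o(1))$ as $k\to\infty$, holomorphic in $\theta$ in a neighbourhood of $\overline{\mathbb D}$. **Matrix $U$.** $\mathcal L_1=(L(\alpha,\beta))_{\alpha,\beta\in\mathcal A_1}$, $(\mathcal L_1-\lambda I)^{-1}=(r(\alpha,\beta;\lambda))_{\alpha,\beta\in\mathcal A_1}$, $\mathcal R(\lambda)=(r(\sigma(0),\nu(0);\lambda))_{\sigma,\nu\in\mathcal C}$. Put $B=\mathrm{diag}\{b_\sigma\}$, $B(0)=\mathrm{diag}\{\mathfrak b_\sigma(0)\}$, $\mathcal E(k,\omega)=\mathrm{diag}\{e_\sigma(k,\theta_\sigma(\omega))\}$, $D(\omega)=\mathrm{diag}\{\theta_\sigma(\omega)^{-1}-\theta_\sigma(\omega)\}$,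 $P(k,\omega)=\mathrm{diag}\{p_\sigma(k,\omega)\}$, where $p_\sigma$ solves $-\mathfrak b_\sigma(k-1)p_\sigma(k-1)+\mathfrak a_\sigma(k)p_\sigma(k)-\mathfrak b_\sigma(k)p_\sigma(k+1)=\lambda(\omega)p_\sigma(k)$, $k\ge1$, $p_\sigma(0)=1$, $p_\sigma(1)=0$. Let $T(\omega)=\mathcal E(0,\omega)-\mathcal R(\lambda(\omega))B(0)\mathcal E(1,\omega)$, $T(\omega)^{-1}=(\tau_{\sigma\nu}(\omega))$, and $$U(k,\omega)=[-P(k,\omega)+\mathcal E(k,\omega)T(\omega)^{-1}]BB(0)^{-1}D(\omega)\mathcal E(1,\omega)^{-1}.$$ $\Omega\subset\overline{\mathbb D}\setminus\{0\}$ is the finite set of non-zero poles (all simple) of $U(k,\cdot)$, $k\ge0$, in $\overline{\mathbb D}$; $\mathrm{Res}_{\hat\omega}U(k,\cdot)=\lim_{\omega\to\hat\omega}(\omega-\hat\omega)U(k,\omega)$. **Matrix $\mathfrak m(\hat\omega)$.** Let $h_{\sigma\nu}(\hat\omega)$ be the limit as $\omega\to\hat\omega$ of $$h_{\sigma\nu}(\omega)=-\frac{b_\nu}{\mathfrak b_\nu(0)}\frac{\theta_\nu(\hat\omega)-\theta_\nu(\hat\omega)^{-1}}{e_\nu(1,\theta_\nu(\omega))}(\omega-\hat\omega)\tau_{\sigma\nu}(\omega).$$ If $\sigma\ne\nu$, or if $e_\nu(1,\theta_\nu(\hat\omega))\ne0$, then $m_{\sigma\nu}(\hat\omega)=h_{\sigma\nu}(\hat\omega)$.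 If $e_\nu(1,\theta_\nu(\hat\omega))=0$, then $$m_{\nu\nu}(\hat\omega)=\frac{b_\nu}{\mathfrak b_\nu(0)}\frac{\theta_\nu(\hat\omega)-\theta_\nu(\hat\omega)^{-1}}{e_\nu(0)\dot e_\nu(1)-e_\nu(1)\dot e_\nu(0)}+h_{\nu\nu}(\hat\omega),$$ where $e_\nu(k)=e_\nu(k,\theta_\nu(\hat\omega))$ and $\dot e_\nu(k)$ is the derivative of $e_\nu(k,\theta_\nu(\omega))$ in $\omega$ at $\hat\omega$. **Eigenvector $\phi^\nu$.** Let $A(\omega)=\mathrm{diag}\left\{\frac{\theta_\nu(\hat\omega)-\theta_\nu(\hat\omega)^{-1}}{\theta_\nu(\omega)-\theta_\nu(\omega)^{-1}}(\omega-\hat\omega)\right\}_{\nu\in\mathcal C}$. For $\omega\neq\hat\omega$ near $\hat\omega$, $(\phi^\nu(\sigma(k),\omega))_{\sigma\in\mathcal C}$ is the $\nu$-th column of $U(k,\omega)A(\omega)$, extended to $\mathcal A_1$ by $\phi^\nu(\alpha,\omega)=\sum_{\gamma\in\mathcal C}r(\alpha,\gamma(0);\lambda(\omega))\mathfrak b_\gamma(0)\phi^\nu(\gamma(1),\omega)$; $\phi^\nu(\cdot,\hat\omega)$ is the solution of $\mathcal L\phi=\lambda(\hat\omega)\phi$ obtained in the limit $\omega\to\hat\omega$.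
   Formalization: The part on φ^ν and its norm assumes ω̂ ≠ ±1, where the formula divides by 1−ω̂̄^{-2}=0; the residue identity excludes only ω̂ = ±1 with some e_ν(1,θ_ν(ω̂))=0 and θ_ν(ω̂)²≠1, where m_νν(ω̂) has denominator 0. *)

(* Defs.v *)
From HB Require Import structures.
From mathcomp Require Import all_boot all_order all_algebra.
From mathcomp Require Import complex.
From mathcomp Require Import all_classical all_reals all_analysis.

Set Implicit Arguments.
Unset Strict Implicit.
Unset Printing Implicit Defensive.

Import Order.TTheory GRing.Theory Num.Theory.
Import numFieldNormedType.Exports.

Local Open Scope classical_set_scope.
Local Open Scope ring_scope.
Local Open Scope complex_scope.

(* R[i] with the topology of its modulus: the library provides it only on
   the copy R[i]^o. *)
HB.instance Definition _ (R : realType) := NormedModule.copy R[i] (R[i])^o.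

Section ComplexPlane.
Variable R : realType.

Definition open_disk : set R[i] := [set z | `|z| < 1].
Definition closed_disk : set R[i] := [set z | `|z| <= 1].

(* z -> w, z <> w, z in the open unit disk. The point w may lie on the unit
   circle; for w in the open disk this is the punctured neighbourhood filter. *)
Definition disk_nbhs (w : R[i]) : set_system R[i] := within open_disk w^'.

(* lim (z - w) f(z); junk unless the limit exists *)
Definition Res (w : R[i]) (f : R[i] -> R[i]) : R[i] :=
  lim ((z - w) * f z @[z --> disk_nbhs w]).

Definition disk_derive (f : R[i] -> R[i]) (w : R[i]) : R[i] :=
  lim ((f z - f w) / (z - w) @[z --> disk_nbhs w]).

(* The map z |-> a - b (z + 1/z). Its value at 0 is junk (a instead of oo). *)
Definition joukowski (a b : R) (z : R[i]) : R[i] :=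
  a%:C - b%:C * (z + z^-1).

End ComplexPlane.

Section SquareSummable.
Variables (R : realType) (A : choiceType).

Definition normsq (f : A -> R[i]) : \bar R :=
  (\esum_(x in [set: A]) ((complex.Re (f x)) ^+ 2 + (complex.Im (f x)) ^+ 2)%:E)%E.

Definition l2 (f : A -> R[i]) : Prop := (normsq f < +oo)%E.

(* Sum of an absolutely summable family; junk on other families *)
Definition rsum (f : A -> R) : R :=
  fine (\esum_(x in [set: A]) (Num.max (f x) 0)%:E)
  - fine (\esum_(x in [set: A]) (Num.max (- f x) 0)%:E).

Definition csum (f : A -> R[i]) : R[i] :=
  rsum (fun x => complex.Re (f x)) +i* rsum (fun x => complex.Im (f x)).

Definition inner (f g : A -> R[i]) : R[i] := csum (fun x => f x * (g x)^*).

(* Each row of L is finitely supported, so this is a finite sum. *)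
Definition mx_apply (L : A -> A -> R) (f : A -> R[i]) (x : A) : R[i] :=
  \sum_(y \in [set: A]) (L x y)%:C * f y.

(* L > 0 as an operator in l2, with its maximal domain. In R[i] the order
   0 < z says that z is real and positive. *)
Definition positive_operator (L : A -> A -> R) : Prop :=
  forall f, l2 f -> l2 (mx_apply L f) -> (exists x, f x != 0) ->
    0 < inner (mx_apply L f) f.

Definition is_channel (L : A -> A -> R) (s : nat -> A) : Prop :=
  [/\ forall k y, L (s k.+1) y != 0 -> [\/ y = s k, y = s k.+1 | y = s k.+2],
      L (s 0) (s 1) != 0 &
      exists2 y, (forall k, y <> s k) & L (s 0) y != 0].

End SquareSummable.

Record system (R : realType) (A : countType) := System {
  L : A -> A -> R;
  nch : nat;
  chan : 'I_nch -> nat -> A;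
  ncore : nat;
  core : 'I_ncore -> A;            (* enumeration of A_1 *)
  cena : 'I_nch -> R;              (* a_sigma *)
  cenb : 'I_nch -> R;              (* b_sigma *)
  ta : R;
  tb : R;
  theta : 'I_nch -> R[i] -> R[i];
  jost : 'I_nch -> nat -> R[i] -> R[i];
  psol : 'I_nch -> nat -> R[i] -> R[i]  (* p_sigma(k, omega) *)
}.

Section Model.
Variables (R : realType) (A : countType) (S : system R A).
Implicit Types (s v : 'I_(nch S)) (w z : R[i]).

Definition fa s k : R := L S (chan s k) (chan s k).
Definition fb s k : R := - L S (chan s k) (chan s k.+1).

Definition A0 : set A := [set x | exists s k, x = chan s k.+1].
Definition A1 : set A := ~` A0.

Record admissible : Prop := Admissible {
  L_sym : forall x y, L S x y = L S y x;
  L_row : forall x, finite_set [set y | L S x y != 0];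
  L_pos : positive_operator (L S);
  chanP : forall s, is_channel (L S) (chan s);
  attach_inj : forall s v, chan s 0 = chan v 0 -> s = v;
  attach_core : forall s, A1 (chan s 0);
  core_inj : injective (@core _ _ S);
  core_range : range (@core _ _ S) = A1;
  fb_gt0 : forall s k, 0 < fb s k;
  cenb_gt0 : forall s, 0 < cenb s;
  fast_decay : exists2 eps : R, 0 < eps & forall s,
    cvgn (series (fun k => (1 + eps) ^+ k.+1 *
      (`|fa s k.+1 - cena s| + `|fb s k.+1 - cenb s|)));
  bands_connected : connected (\bigcup_(s in [set: 'I_(nch S)])
    `]cena s - 2 * cenb s, cena s + 2 * cenb s[%classic);
  bands_union : \bigcup_(s in [set: 'I_(nch S)])
    `[cena s - 2 * cenb s, cena s + 2 * cenb s]%classic =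
    `[ta S - 2 * tb S, ta S + 2 * tb S]%classic
}.

Definition lam w : R[i] := joukowski (ta S) (tb S) w.

(* theta_s = W_s^-1 o W on the open disk, extended by continuity *)
Record theta_spec : Prop := ThetaSpec {
  theta0 : forall s, theta s 0 = 0;
  thetaP : forall s w, `|w| < 1 -> w != 0 ->
    [/\ `|theta s w| < 1, theta s w != 0 &
        joukowski (cena s) (cenb s) (theta s w) = lam w];
  theta_cont : forall s, {within @closed_disk R, continuous (theta s)}
}.

(* The equation L u = z u at the points chan s k, k >= 1 *)
Definition channel_eq s z (u : nat -> R[i]) : Prop := forall k,
  - (fb s k)%:C * u k + (fa s k.+1)%:C * u k.+1 - (fb s k.+1)%:C * u k.+2
  = z * u k.+1.

Record jost_spec : Prop := JostSpec {
  jost_eq : forall s t, `|t| <= 1 -> t != 0 ->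
    channel_eq s (joukowski (cena s) (cenb s) t) (fun k => jost s k t);
  jost_asymp : forall s t, `|t| <= 1 -> t != 0 ->
    jost s k t / t ^+ k @[k --> \oo] --> (1 : R[i]);
  jost_holo : forall s, exists V : set R[i],
    [/\ open V, @closed_disk R `<=` V &
        forall k t, V t -> derivable (jost s k) t 1]
}.

Definition psol_spec : Prop := forall s w, w != 0 ->
  [/\ psol s 0 w = 1, psol s 1 w = 0 &
      channel_eq s (lam w) (fun k => psol s k w)].

Definition L1 : 'M[R[i]]_(ncore S) :=
  \matrix_(i, j) (L S (core i) (core j))%:C.

(* The entry of (L1 - z)^-1 at particles x, y of A_1; as core is injective,
   each sum has one term for such particles, and is empty otherwise. *)
Definition resolvent (x y : A) z : R[i] :=
  \sum_(i | core i == x) \sum_(j | core j == y) invmx (L1 - z%:M) i j.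

Definition Rmx z : 'M[R[i]]_(nch S) :=
  \matrix_(s, v) resolvent (chan s 0) (chan v 0) z.
Definition Bmx : 'M[R[i]]_(nch S) := diag_mx (\row_s (cenb s)%:C).
Definition B0mx : 'M[R[i]]_(nch S) := diag_mx (\row_s (fb s 0)%:C).
Definition Emx k w : 'M[R[i]]_(nch S) :=
  diag_mx (\row_s jost s k (theta s w)).
Definition Dmx w : 'M[R[i]]_(nch S) :=
  diag_mx (\row_s ((theta s w)^-1 - theta s w)).
Definition Pmx k w : 'M[R[i]]_(nch S) := diag_mx (\row_s psol s k w).
Definition Tmx w : 'M[R[i]]_(nch S) :=
  Emx 0 w - Rmx (lam w) *m B0mx *m Emx 1 w.
Definition tau w : 'M[R[i]]_(nch S) := invmx (Tmx w).

Definition Umx k w : 'M[R[i]]_(nch S) :=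
  (- Pmx k w + Emx k w *m tau w) *m Bmx *m invmx B0mx *m Dmx w
  *m invmx (Emx 1 w).

Definition ResU k w : 'M[R[i]]_(nch S) :=
  \matrix_(s, v) Res w (fun z => Umx k z s v).

(* The nonzero poles, all simple, of the family U(k, .) in the closed disk *)
Definition Omega : set R[i] := [set w |
  [/\ w != 0, `|w| <= 1,
      forall k s v, cvg ((z - w) * Umx k z s v @[z --> disk_nbhs w]) &
      exists k, ResU k w != 0]].

Section AtPole.
Variable w0 : R[i].

Definition hfun s v w : R[i] :=
  - ((cenb v)%:C / (fb v 0)%:C)
  * ((theta v w0 - (theta v w0)^-1) / jost v 1 (theta v w))
  * (w - w0) * tau w s v.

Definition hlim s v : R[i] := lim (hfun s v w @[w --> disk_nbhs w0]).

Definition ev v k : R[i] := jost v k (theta v w0).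
Definition evdot v k : R[i] := disk_derive (fun w => jost v k (theta v w)) w0.

Definition mmx : 'M[R[i]]_(nch S) := \matrix_(s, v)
  if (s != v) || (ev v 1 != 0) then hlim s v
  else (cenb v)%:C / (fb v 0)%:C
       * ((theta v w0 - (theta v w0)^-1)
          / (ev v 0 * evdot v 1 - ev v 1 * evdot v 0))
       + hlim s v.

(* If ev v 1 = 0 then, by a Wronskian identity, the denominator in mmx is a
   nonzero multiple of the derivative of theta_v at w0. As lam has derivative 0
   at w0 = 1 and w0 = -1, this denominator vanishes there as soon as
   theta_v(w0)^2 <> 1, and mmx is then undefined. In all other cases either the
   denominator is a nonzero number, or theta_v(w0)^2 = 1 and the numerator
   is 0. *)
Definition mmx_defined : Prop := forall v,
  w0 ^+ 2 = 1 -> ev v 1 = 0 -> (theta v w0) ^+ 2 = 1.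

Definition Amx w : 'M[R[i]]_(nch S) := diag_mx (\row_v
  ((theta v w0 - (theta v w0)^-1) / (theta v w - (theta v w)^-1) * (w - w0))).

Definition phi_chan v s k w : R[i] := (Umx k w *m Amx w) s v.

Definition phi_core v (x : A) w : R[i] :=
  \sum_(g < nch S) resolvent x (chan g 0) (lam w) * (fb g 0)%:C
                   * phi_chan v g 1 w.

(* phi is the limit, as w -> w0, of the family phi^v(., w) *)
Definition is_phi v (phi : A -> R[i]) : Prop :=
  (forall s k, phi_chan v s k w @[w --> disk_nbhs w0] --> phi (chan s k)) /\
  (forall x, A1 x -> phi_core v x w @[w --> disk_nbhs w0] --> phi x).

End AtPole.

End Model.

(* Main.v *)
Require Import Defs.
From mathcomp Require Import all_boot all_order all_algebra.
From mathcomp Require Import complex ring lra zify.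
From mathcomp Require Import all_classical all_reals all_analysis.
Import Order.TTheory GRing.Theory Num.Theory.
Import numFieldNormedType.Exports.
Local Open Scope classical_set_scope.
Local Open Scope ring_scope.
Local Open Scope complex_scope.
Set Implicit Arguments.
Unset Strict Implicit.
Unset Printing Implicit Defensive.

(** A pole of [U] comes from the vector [psi] obtained from a column [v] of
    [(z - w0) U(., z)] by replacing it, beyond a site [K] of the channel [v], by the
    decaying Jost solution. Beyond [K] the column still contains a growing wave,
    and cutting it off costs a point source at [K], of strength
    [c = O(|z - w0|)]: [(L - lam z) psi = c delta]. As [psi] is square summable and
    [L] symmetric, [|Im lam z| ||psi||^2 <= |c| |psi(v, K)|] ([energy_bound],
    [psi_mass]). Everything rests on this estimate.

    - It shows that [T] is invertible at nonreal energies, a null vector of [T] being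
      a decaying solution without source ([Tmx_unit_nonreal]), that poles have real
      energies ([lam0_real]), and that the residue column [v] vanishes if
      [theta_v(w0)^2 = 1] ([resU_edge]). The sequences [z -> w0] used there have
      [|z - w0| = O(|Im lam z|)], or only [|z - w0|^2 = O(|Im lam z|)] if [w0] is a
      critical point of [lam] ([nontangential_seq]).

    - Otherwise [theta_v(w0)^2 <> 1], and the two terms of [U] have residues that
      can be computed one by one ([residue_formula]). The only division is by
      [e_v(1)], so one needs that its zeros are isolated in the disk and simple
      away from [1] and [-1]. Both follow from a quantitative form of Sturm
      oscillation at real [t]: beyond a site independent of [t] the Jost solutions
      have a fixed sign pattern ([jost_tail_pos], from [positive_tail]). Then
      products of two of them have positive sums, and Green's identity bounds
      [e_v(1, t)] from below by the difference of energies ([jost1_lower]).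

    - The eigenvector. [T] is invertible near the pole ([good_near]), so the core
      values of the column converge at the attachment points, and then everywhere
      on the core, even if [lam w0] is an eigenvalue of [L1] ([core_cvg]). The limit
      solves [L phi = lam(w0) phi].

    - The norm. Pairing [psi] with [phi] gives
      [<psi, phi> = c conj(phi(v, K)) / (lam w0 - lam z)] ([pairing_eigen]). Along a
      nontangential sequence [psi] is bounded and converges pointwise to [phi], so
      the left-hand side tends to [||phi||^2] ([weak_limit_mass]) while the right-hand
      side has an explicit limit ([phi_mass]). *)

(** * Modulus, conjugation and limits of complex functions *)

Local Notation Re := complex.Re.
Local Notation Im := complex.Im.
Local Notation cj := (@conjc _).
Local Notation nrm := ComplexField.Normc.normc.

Section Modulus.
Variable R : realType.
Implicit Types (x y z : R[i]) (r : R).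

Lemma normE z : `|z| = (nrm z)%:C. Proof. by []. Qed.
Lemma nrm_sqr z : nrm z ^+ 2 = Re z ^+ 2 + Im z ^+ 2.
Proof. by case: z => a b /=; rewrite sqr_sqrtr // addr_ge0 ?sqr_ge0. Qed.
Lemma nrm_ge0 z : 0 <= nrm z.
Proof. by case: z => a b /=; exact: sqrtr_ge0. Qed.
Lemma nrm0 : nrm (0 : R[i]) = 0. Proof. exact: ComplexField.Normc.normc0. Qed.
Lemma nrm1 : nrm (1 : R[i]) = 1. Proof. exact: ComplexField.Normc.normc1. Qed.
Lemma nrmM x y : nrm (x * y) = nrm x * nrm y.
Proof. exact: ComplexField.Normc.normcM. Qed.
Lemma nrmV x : nrm x^-1 = (nrm x)^-1.
Proof. exact: ComplexField.Normc.normcV. Qed.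
Lemma nrm_eq0 x : (nrm x == 0) = (x == 0).
Proof.
apply/eqP/eqP => [/ComplexField.Normc.eq0_normc //|->]; exact: nrm0.
Qed.
Lemma nrm_gt0 x : (0 < nrm x) = (x != 0).
Proof. by rewrite lt_def nrm_ge0 andbT nrm_eq0. Qed.
Lemma nrmN x : nrm (- x) = nrm x.
Proof. by case: x => a b /=; rewrite !sqrrN. Qed.
Lemma nrmD x y : nrm (x + y) <= nrm x + nrm y.
Proof. by have := ler_normD x y; rewrite !normE -rmorphD lecR. Qed.
Lemma nrmB x y : nrm (x - y) <= nrm x + nrm y.
Proof. by have := nrmD x (- y); rewrite nrmN. Qed.
Lemma nrmBC x y : nrm (x - y) = nrm (y - x).
Proof. by rewrite -nrmN opprB. Qed.
Lemma nrmX x n : nrm (x ^+ n) = nrm x ^+ n.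
Proof. by elim: n => [|n IH]; rewrite ?expr0 ?nrm1 // !exprS nrmM IH. Qed.
Lemma nrmJ x : nrm (cj x) = nrm x.
Proof. by case: x => a b /=; rewrite sqrrN. Qed.
Lemma nrmR r : nrm r%:C = `|r|.
Proof. by rewrite /= expr0n /= addr0 sqrtr_sqr. Qed.
Lemma Re_nrm x : `|Re x| <= nrm x.
Proof.
rewrite -(@ler_pXn2r _ 2) ?nnegrE ?nrm_ge0 // nrm_sqr real_normK ?num_real //.
by rewrite lerDl sqr_ge0.
Qed.
Lemma Im_nrm x : `|Im x| <= nrm x.
Proof.
rewrite -(@ler_pXn2r _ 2) ?nnegrE ?nrm_ge0 // nrm_sqr real_normK ?num_real //.
by rewrite lerDr sqr_ge0.
Qed.
Lemma nrm_sum I (s : seq I) (P : pred I) (F : I -> R[i]) :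
  nrm (\sum_(i <- s | P i) F i) <= \sum_(i <- s | P i) nrm (F i).
Proof.
elim/big_ind2: _ => [|a b c d h1 h2|//]; first by rewrite nrm0.
by rewrite (le_trans (nrmD _ _)) // lerD.
Qed.

Lemma ReD x y : Re (x + y) = Re x + Re y. Proof. by case: x y => ? ? []. Qed.
Lemma ImD x y : Im (x + y) = Im x + Im y. Proof. by case: x y => ? ? []. Qed.
Lemma ReN x : Re (- x) = - Re x. Proof. by case: x. Qed.
Lemma ImN x : Im (- x) = - Im x. Proof. by case: x. Qed.
Lemma ReB x y : Re (x - y) = Re x - Re y. Proof. by rewrite ReD ReN. Qed.
Lemma ImB x y : Im (x - y) = Im x - Im y. Proof. by rewrite ImD ImN. Qed.
Lemma ReM x y : Re (x * y) = Re x * Re y - Im x * Im y.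
Proof. by case: x y => ? ? []. Qed.
Lemma ImM x y : Im (x * y) = Re x * Im y + Im x * Re y.
Proof. by case: x y => a b [c d] /=; rewrite [b * c]mulrC. Qed.
Lemma ReRM r x : Re (r%:C * x) = r * Re x.
Proof. by rewrite ReM /= mul0r subr0. Qed.
Lemma ImRM r x : Im (r%:C * x) = r * Im x.
Proof. by rewrite ImM /= mul0r addr0. Qed.
Lemma conjM x y : cj (x * y) = cj x * cj y. Proof. exact: rmorphM. Qed.
Lemma conjD x y : cj (x + y) = cj x + cj y. Proof. exact: rmorphD. Qed.
Lemma conjB x y : cj (x - y) = cj x - cj y. Proof. exact: rmorphB. Qed.
Lemma conjN x : cj (- x) = - cj x. Proof. exact: rmorphN. Qed.
Lemma conjX x n : cj (x ^+ n) = cj x ^+ n. Proof. exact: rmorphXn. Qed.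
Lemma conjV x : cj (x^-1) = (cj x)^-1. Proof. exact: fmorphV. Qed.
Lemma conjR r : cj r%:C = r%:C. Proof. by rewrite /= oppr0. Qed.
Lemma conj_sum I (s : seq I) (P : pred I) (F : I -> R[i]) :
  (cj (\sum_(i <- s | P i) F i)) = \sum_(i <- s | P i) cj (F i).
Proof. exact: rmorph_sum. Qed.
Lemma Re_sum I (s : seq I) (P : pred I) (F : I -> R[i]) :
  Re (\sum_(i <- s | P i) F i) = \sum_(i <- s | P i) Re (F i).
Proof.
elim/big_ind2: _ => [//|a b c d <- <-|//]; exact: ReD.
Qed.
Lemma RC_sum I (s : seq I) (P : pred I) (F : I -> R) :
  (\sum_(i <- s | P i) F i)%:C = \sum_(i <- s | P i) (F i)%:C :> R[i].
Proof. exact: rmorph_sum. Qed.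
Lemma RCD (r s : R) : (r + s)%:C = r%:C + s%:C :> R[i]. Proof. exact: rmorphD. Qed.
Lemma realE x : Im x = 0 -> x = (Re x)%:C.
Proof. by case: x => a b /= ->. Qed.
Lemma mul_conj x : x * cj x = (nrm x ^+ 2)%:C.
Proof. by rewrite -sqr_normc normE rmorphXn. Qed.
Lemma sub_conj x : x - cj x = (2 * Im x)%:C * 'i%C.
Proof. by case: x => a b; apply/eqP; rewrite eq_complex /=; apply/andP; split; apply/eqP; ring. Qed.
Lemma RC_eq0 r : ((r%:C : R[i]) == 0) = (r == 0).
Proof. by rewrite eq_complex /= eqxx andbT. Qed.
Lemma RC_neq0 r : r != 0 -> (r%:C : R[i]) != 0. Proof. by rewrite RC_eq0. Qed.
Lemma nrm_lt1 x : (`|x| < 1) = (nrm x < 1).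
Proof. by rewrite normE -(rmorph1 (real_complex R)) ltcR. Qed.
Lemma nrm_le1 x : (`|x| <= 1) = (nrm x <= 1).
Proof. by rewrite normE -(rmorph1 (real_complex R)) lecR. Qed.
Lemma Im_inv x : Im x^-1 = - Im x / nrm x ^+ 2.
Proof.
have [->|x0] := eqVneq x 0; first by rewrite invr0 nrm0 /= oppr0 mul0r.
by rewrite nrm_sqr; case: x x0 => a b _ /=; rewrite mulNr.
Qed.

End Modulus.

Section ComplexLimits.
Variables (R : realType) (T : Type) (F : set_system T).
Context {FF : Filter F}.
Implicit Types (f g : T -> R[i]) (a b : R[i]) (u : T -> R).

Lemma cvgCP f a : f x @[x --> F] --> a <->
  forall e : R, 0 < e -> \forall x \near F, nrm (f x - a) < e.
Proof.
split=> [/cvgrPdist_lt h e e0|h].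
  have := h e%:C; rewrite ltcR => /(_ e0); apply: filterS => x.
  by rewrite normE ltcR nrmBC.
apply/cvgrPdist_lt => e e0.
have [eI eR] : Im e = 0 /\ 0 < Re e by move: e0; rewrite ltcE /= => /andP[/eqP-> ->].
by apply: filterS (h _ eR) => x; rewrite normE (realE eI) ltcR nrmBC.
Qed.

Lemma cvgRP u (r : R) : u x @[x --> F] --> r <->
  forall e : R, 0 < e -> \forall x \near F, `|u x - r| < e.
Proof.
split=> [/cvgrPdist_lt h e e0|h].
  by apply: filterS (h _ e0) => x; rewrite distrC.
by apply/cvgrPdist_lt => e e0; apply: filterS (h _ e0) => x; rewrite distrC.
Qed.

Lemma cvgC_ext f g a : f x @[x --> F] --> a ->
  (\forall x \near F, f x = g x) -> g x @[x --> F] --> a.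
Proof.
move=> /cvgCP h fg; apply/cvgCP => e e0.
by apply: filterS2 fg (h _ e0) => x ->.
Qed.

Lemma cvgC_cst a : (a : R[i]) @[x --> F] --> a.
Proof. exact: cvg_cst. Qed.
Lemma cvgCD f g a b : f x @[x --> F] --> a -> g x @[x --> F] --> b ->
  f x + g x @[x --> F] --> a + b.
Proof. move=> fa gb; exact: (cvgD fa gb). Qed.
Lemma cvgCM f g a b : f x @[x --> F] --> a -> g x @[x --> F] --> b ->
  f x * g x @[x --> F] --> a * b.
Proof. move=> fa gb; exact: (cvgM fa gb). Qed.
Lemma cvgCB f g a b : f x @[x --> F] --> a -> g x @[x --> F] --> b ->
  f x - g x @[x --> F] --> a - b.
Proof. move=> fa gb; exact: (cvgB fa gb). Qed.
Lemma cvgCN f a : f x @[x --> F] --> a -> - f x @[x --> F] --> - a.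
Proof. move=> fa; exact: (cvgN fa). Qed.
Lemma cvgCV f a : a != 0 -> f x @[x --> F] --> a ->
  (f x)^-1 @[x --> F] --> a^-1.
Proof. move=> a0 fa; exact: (cvgV a0 fa). Qed.
Lemma cvgCdiv f g a b : b != 0 -> f x @[x --> F] --> a ->
  g x @[x --> F] --> b -> f x / g x @[x --> F] --> a / b.
Proof. by move=> b0 fa gb; apply: cvgCM fa (cvgCV b0 gb). Qed.
Lemma cvgC_sum I (s : seq I) (P : pred I) (h : I -> T -> R[i]) (l : I -> R[i]) :
  (forall i, P i -> h i x @[x --> F] --> l i) ->
  \sum_(i <- s | P i) h i x @[x --> F] --> \sum_(i <- s | P i) l i.
Proof.
move=> H; elim: s => [|i s IH].
  rewrite big_nil; apply: (cvgC_ext (f := fun=> 0)); first exact: cvgC_cst.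
  by apply: nearW => x; rewrite big_nil.
rewrite big_cons; case: ifP => Pi.
  apply: (cvgC_ext (cvgCD (H _ Pi) IH)).
  by apply: nearW => x; rewrite big_cons Pi.
by apply: (cvgC_ext IH); apply: nearW => x; rewrite big_cons Pi.
Qed.
Lemma cvgCX f a n : f x @[x --> F] --> a -> f x ^+ n @[x --> F] --> a ^+ n.
Proof.
move=> fa; elim: n => [|n IH]; first exact: cvgC_cst.
by rewrite exprS; apply: (cvgC_ext (cvgCM fa IH)); apply: nearW => x; rewrite exprS.
Qed.

Lemma cvgC_real (u : T -> R) (r : R) : u x @[x --> F] --> r ->
  (u x)%:C @[x --> F] --> r%:C.
Proof.
move=> /cvgRP h; apply/cvgCP => e e0; apply: filterS (h _ e0) => x.
by rewrite -rmorphB nrmR.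
Qed.
Lemma cvg_Re f a : f x @[x --> F] --> a -> Re (f x) @[x --> F] --> Re a.
Proof.
move=> /cvgCP h; apply/cvgRP => e e0; apply: filterS (h _ e0) => x.
by rewrite -ReB; apply/le_lt_trans/Re_nrm.
Qed.
Lemma cvg_Im f a : f x @[x --> F] --> a -> Im (f x) @[x --> F] --> Im a.
Proof.
move=> /cvgCP h; apply/cvgRP => e e0; apply: filterS (h _ e0) => x.
by rewrite -ImB; apply/le_lt_trans/Im_nrm.
Qed.
Lemma cvgC_conj f a : f x @[x --> F] --> a -> (cj (f x)) @[x --> F] --> cj a.
Proof.
move=> /cvgCP h; apply/cvgCP => e e0; apply: filterS (h _ e0) => x.
by rewrite -conjB nrmJ.
Qed.
Lemma cvg_nrm f a : f x @[x --> F] --> a -> nrm (f x) @[x --> F] --> nrm a.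
Proof.
move=> /cvgCP h; apply/cvgRP => e e0; apply: filterS (h _ e0) => x.
apply: le_lt_trans; rewrite ler_norml; apply/andP; split.
  by have := nrmD (a - f x) (f x); rewrite subrK nrmBC; lra.
by have := nrmD (f x - a) a; rewrite subrK; lra.
Qed.
Lemma near_neq0 f a : a != 0 -> f x @[x --> F] --> a ->
  \forall x \near F, f x != 0.
Proof.
rewrite -nrm_gt0 => a0 /cvgCP /(_ _ a0); apply: filterS => x.
by case: eqP => // ->; rewrite sub0r nrmN ltxx.
Qed.
Lemma cvgC_dom f u a : (\forall x \near F, nrm (f x - a) <= u x) ->
  u x @[x --> F] --> 0 -> f x @[x --> F] --> a.
Proof.
move=> fu /cvgRP h; apply/cvgCP => e e0; apply: filterS2 fu (h _ e0) => x h1.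
by rewrite subr0; apply: le_lt_trans; apply: le_trans h1 (ler_norm _).
Qed.
Lemma cvgR_dom (u v : T -> R) : (\forall x \near F, `|v x| <= u x) ->
  u x @[x --> F] --> 0 -> v x @[x --> F] --> 0.
Proof.
move=> vu /cvgRP h; apply/cvgRP => e e0; apply: filterS2 vu (h _ e0) => x h1.
by rewrite !subr0; apply: le_lt_trans; apply: le_trans h1 (ler_norm _).
Qed.
Lemma cvgC_bound f a : f x @[x --> F] --> a ->
  exists2 M : R, 0 < M & \forall x \near F, nrm (f x) <= M.
Proof.
move=> /cvgCP /(_ 1 ltr01) h; exists (nrm a + 1).
  by rewrite ltr_wpDl ?nrm_ge0.
apply: filterS h => x h; have := nrmD (f x - a) a; rewrite subrK; lra.
Qed.
Lemma cvgC_null_bound f g M : f x @[x --> F] --> 0 ->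
  (\forall x \near F, nrm (g x) <= M) -> f x * g x @[x --> F] --> 0.
Proof.
move=> /cvgCP h gM; apply/cvgCP => e e0.
have M0 : 0 < `|M| + 1 by rewrite ltr_wpDl.
have := h _ (divr_gt0 e0 M0); apply: filterS2 gM => x; rewrite !subr0 nrmM => h1 h2.
apply: le_lt_trans (_ : nrm (f x) * (`|M| + 1) < e); last by rewrite -ltr_pdivlMr.
apply: ler_wpM2l (nrm_ge0 _) _ _ _; apply: le_trans h1 _.
by rewrite (le_trans (ler_norm _)) // lerDl.
Qed.
End ComplexLimits.
Arguments cvgC_cst {R T F FF} a.

Lemma nbhsC_ball (R : realType) (z : R[i]) (A : set R[i]) : nbhs z A <->
  exists2 d : R, 0 < d & forall x, nrm (x - z) < d -> A x.
Proof.
split=> [|[d d0 h]].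
  case/nbhs_ballP => e /= e0 h.
  have [eI eR] : Im e = 0 /\ 0 < Re e by move: e0; rewrite ltcE /= => /andP[/eqP-> ->].
  by exists (Re e) => // x xz; apply: h; rewrite -ball_normE /= normE (realE eI) ltcR nrmBC.
apply/nbhs_ballP; exists d%:C; first by rewrite /= ltcR.
by move=> x; rewrite -ball_normE /= normE ltcR nrmBC; exact: h.
Qed.

Section ProperLimits.
Variables (R : realType) (T : Type) (F : set_system T).
Context {FF : ProperFilter F}.
Implicit Types (f g : T -> R[i]) (a b : R[i]).
Lemma cvgC_uniq f a b : f x @[x --> F] --> a -> f x @[x --> F] --> b -> a = b.
Proof. move=> fa fb; exact: (cvg_unique _ fa fb). Qed.
Lemma cvgC_lim f a : f x @[x --> F] --> a -> lim (f x @[x --> F]) = a.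
Proof. move=> fa; exact: (cvg_lim _ fa). Qed.
Lemma cvgR_le (f g : T -> R) (a b : R) : (\forall x \near F, f x <= g x) ->
  f x @[x --> F] --> a -> g x @[x --> F] --> b -> a <= b.
Proof.
move=> fg fa gb; rewrite -subr_ge0.
have h : g x - f x @[x --> F] --> b - a by exact: (cvgB gb fa).
by apply: (cvgr_to_ge h); apply: filterS fg => x; rewrite subr_ge0.
Qed.
End ProperLimits.

(** * Positive solutions of perturbed discrete Laplace equations *)

Section PositiveTail.
Variables (R : realType) (be : nat -> R) (b C r : R).
Hypotheses (b_gt0 : 0 < b) (r_gt0 : 0 < r) (r_lt1 : r < 1).
Hypothesis be_gt0 : forall k, 0 < be k.
Hypothesis be_near : forall k, `|be k.+1 - b| <= C * r ^+ k.

Lemma expr_cvg0 : r ^+ k @[k --> \oo] --> 0.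
Proof. by apply: cvg_expr; rewrite ger0_norm // ltW. Qed.

Lemma offdiag_cvg : be k @[k --> \oo] --> b.
Proof.
have h : be k.+1 @[k --> \oo] --> b.
  apply/cvgRP => e e0.
  have C1 : 0 < `|C| + 1 by rewrite ltr_wpDl.
  have /cvgRP/(_ _ (divr_gt0 e0 C1)) := expr_cvg0.
  apply: filterS => k; rewrite subr0 ger0_norm ?exprn_ge0 1?ltW // => rk.
  apply: le_lt_trans (be_near k) _; move: rk; rewrite ltr_pdivlMr // => rk.
  apply: le_lt_trans rk; rewrite mulrC ler_wpM2l ?exprn_ge0 1?ltW //.
  by rewrite (le_lt_trans (ler_norm _)) // ltrDl.
by rewrite -cvg_shiftS.
Qed.

(** The bound [N] serves all equations with [g >= 2 b - C r^k] at once, because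
    they share the supersolution [s k = 1 - M r^k]. If [v > 0] beyond [j], then
    [D i = be i * (v i * s i.+1 - v i.+1 * s i)] is nonincreasing from [j] on and
    tends to [0]; so [D j >= 0], which makes [v j] positive. Thus positivity,
    which holds near infinity, descends to [N]. *)
Lemma positive_tail : exists N, forall (g v : nat -> R) (l : R),
  (forall k, 2 * b - C * r ^+ k <= g k.+1) ->
  (forall k, be k * v k + be k.+1 * v k.+2 = g k.+1 * v k.+1) ->
  v k @[k --> \oo] --> l -> (\forall k \near \oo, 0 < v k) ->
  forall k, (N <= k)%N -> 0 < v k.
Proof.
have r1 : 0 < 1 - r by rewrite subr_gt0.
have C0 : 0 <= C.
  by have := le_trans (normr_ge0 _) (be_near 0); rewrite expr0 mulr1.
(* Minus the second difference of s at k + 1 is then 3 C r^k / b, enough to absorb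
   three errors of size C r^k in the coefficients. *)
pose M := 3 * C / (b * r * (1 - r) ^+ 2).
have M0 : 0 <= M by rewrite divr_ge0 ?mulr_ge0 ?exprn_ge0 // ltW.
have ME : b * M * r * (1 - r) ^+ 2 = 3 * C.
  by rewrite /M; field; rewrite ?gt_eqF.
pose s k : R := 1 - M * r ^+ k.
have s_cvg : s k @[k --> \oo] --> (1 : R).
  have h : M * r ^+ k @[k --> \oo] --> M * 0 by apply: cvgM (cvg_cst _) expr_cvg0.
  rewrite mulr0 in h.
  rewrite -[X in _ --> X]subr0; exact: (cvgB (cvg_cst (1 : R)) h).
have sS : s k.+1 @[k --> \oo] --> (1 : R) by rewrite -(cvg_shiftS s) in s_cvg.
have [N _ sN] : \forall k \near \oo, 0 < s k.
  by move/cvgRP : s_cvg => /(_ _ ltr01); apply: filterS => k; rewrite ltr_norml; lra.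
exists N.+1 => g v l hg hv vl [N' _ vN'] k Nk.
have super j : (0 < j)%N ->
    be j * s j + be j.+1 * s j.+2 <= g j.+1 * s j.+1 \/ s j.+1 < 0 \/ s j < 0.
  case: j => // j _.
  have [s2|s2] := ltP (s j.+2) 0; first by right; left.
  have [s1|s1] := ltP (s j.+1) 0; first by right; right.
  left.
  have rj0 : 0 <= r ^+ j by rewrite exprn_ge0 // ltW.
  have q0 : 0 <= C * r ^+ j by rewrite mulr_ge0.
  have le1 i : s i <= 1.
    by rewrite /s lerBlDr lerDl mulr_ge0 // exprn_ge0 // ltW.
  have s30 : 0 <= s j.+3.
    apply: le_trans s2 _; rewrite /s lerB // ler_wpM2l // [_ ^+ j.+3]exprS.
    by rewrite ler_piMl ?exprn_ge0 ?ltW.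
  have qS : C * r ^+ j.+1 <= C * r ^+ j.
    by rewrite ler_wpM2l // exprS ler_piMl // ltW.
  have h1 := hg j.+1; have h2 := be_near j; have h3 := be_near j.+1.
  have {h1} h1 : (2 * b - C * r ^+ j) * s j.+2 <= g j.+2 * s j.+2.
    by apply: ler_wpM2r => //; apply: le_trans h1; lra.
  apply: le_trans h1.
  have {h2} h2 : be j.+1 * s j.+1 <= (b + C * r ^+ j) * s j.+1.
    by apply: ler_wpM2r => //; move: h2; rewrite ler_norml; lra.
  have {h3} h3 : be j.+2 * s j.+3 <= (b + C * r ^+ j) * s j.+3.
    by apply: ler_wpM2r => //; move: h3; rewrite ler_norml; lra.
  have q1 := ler_wpM2l q0 (le1 j.+1).
  have q2 := ler_wpM2l q0 (le1 j.+2).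
  have q3 := ler_wpM2l q0 (le1 j.+3).
  have key : b * (2 * s j.+2 - s j.+1 - s j.+3) = 3 * (C * r ^+ j).
    rewrite (mulrA 3) -ME /s !exprS; ring.
  lra.
have spos j : (N <= j)%N -> 0 < s j by move=> h; exact: sN.
pose D j := be j * (v j * s j.+1 - v j.+1 * s j).
have D_cvg : D j @[j --> \oo] --> 0.
  have vS : v j.+1 @[j --> \oo] --> l by rewrite -(cvg_shiftS v) in vl.
  have E : b * (l * 1 - l * 1) = 0 by rewrite subrr mulr0.
  rewrite -E; exact: (cvgM offdiag_cvg (cvgB (cvgM vl sS) (cvgM vS s_cvg))).
(* D is nonincreasing as far as v is nonnegative, hence nonnegative there. *)
have step j : (N < j)%N -> (forall i, (j < i)%N -> 0 < v i) -> 0 < v j.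
  move=> Nj vi.
  have Ddec i : (j <= i)%N -> D i.+1 <= D i.
    move=> ji; have vi1 : 0 < v i.+1 by apply: vi; rewrite ltnS.
    have := hv i.
    have [|h|[h|h]] := super i; first by apply: leq_trans ji; case: (j) Nj.
    - move=> E.
      have := ler_wpM2l (ltW vi1) h.
      have -> : D i.+1 = v i.+1 * (be i.+1 * s i.+2) - be i.+1 * v i.+2 * s i.+1.
        by rewrite /D; ring.
      have -> : be i.+1 * v i.+2 = g i.+1 * v i.+1 - be i * v i by rewrite -E; ring.
      rewrite /D; lra.
    - have Ni : (N <= i.+1)%N by rewrite (leq_trans (ltnW Nj)) // (leq_trans ji).
      by move: h; rewrite ltNge (ltW (spos _ Ni)).
    - have Ni : (N <= i)%N by rewrite (leq_trans (ltnW Nj)).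
      by move: h; rewrite ltNge (ltW (spos _ Ni)).
  have Dle i : (j <= i)%N -> D i <= D j.
    elim: i => [|i IH]; first by rewrite leqn0 => /eqP->.
    rewrite leq_eqVlt => /orP[/eqP-> //|]; rewrite ltnS => ji.
    by apply: le_trans (Ddec _ ji) (IH ji).
  have D0 : 0 <= D j.
    apply: (cvgr_to_le D_cvg); exists j => // i /= ji; exact: Dle.
  have v1 : 0 < v j.+1 by exact: vi.
  have sj : 0 < s j by apply: spos; rewrite ltnW.
  have sj1 : 0 < s j.+1 by apply: spos; rewrite ltnW // ltnW.
  move: D0; rewrite /D pmulr_rge0 // subr_ge0 => h.
  have : 0 < v j * s j.+1 by apply: lt_le_trans h; rewrite mulr_gt0.
  by rewrite pmulr_lgt0.
have main n : forall j, (N' <= j + n)%N -> (N < j)%N -> 0 < v j.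
  elim: n => [|n IH] j; first by rewrite addn0 => h _; exact: vN'.
  move=> h Nj; apply: step => // i ji; apply: IH; last exact: ltn_trans ji.
  by apply: leq_trans h _; rewrite addnS -addSn leq_add2r.
by apply: (main N'); rewrite ?leq_addl.
Qed.

End PositiveTail.

(** * Jacobi operators and the Joukowski map *)

Section JacobiOperator.
Variables (R : realType) (be al : nat -> R).
Implicit Types (u w : nat -> R[i]) (z : R[i]).

(** Value at the site [k + 1] of the Jacobi operator with diagonal [al] and
    off-diagonal entries [- be]. *)
Definition jacobi u k : R[i] :=
  - (be k)%:C * u k + (al k.+1)%:C * u k.+1 - (be k.+1)%:C * u k.+2.

Definition wronsk u w k : R[i] := (be k)%:C * (u k * w k.+1 - u k.+1 * w k).

Lemma jacobi_green u w n :
  \sum_(k < n) (jacobi u k * w k.+1 - u k.+1 * jacobi w k)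
  = wronsk u w n - wronsk u w 0.
Proof.
elim: n => [|n IH]; first by rewrite big_ord0 subrr.
by rewrite big_ord_recr /= IH /wronsk /jacobi; ring.
Qed.

Lemma jacobi_green_eq u w z z' n :
  (forall k, jacobi u k = z * u k.+1) -> (forall k, jacobi w k = z' * w k.+1) ->
  (z - z') * (\sum_(k < n) u k.+1 * w k.+1) = wronsk u w n - wronsk u w 0.
Proof.
move=> hu hw; rewrite -jacobi_green mulr_sumr; apply: eq_bigr => k _.
by rewrite hu hw; ring.
Qed.

(** The entries of [U] have this form: [n] tells whether they are diagonal, [p]
    is an entry of [T^-1] and [q] the amplitude of the incoming wave. *)
Lemma jacobi_comb u w f z (n : bool) (p q : R[i]) :
  (forall k, f k = (- (u k *+ n) + w k * p) * q) ->
  (forall k, jacobi u k = z * u k.+1) -> (forall k, jacobi w k = z * w k.+1) ->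
  forall k, jacobi f k = z * f k.+1.
Proof.
move=> hf hu hw k; rewrite hf.
transitivity ((- (jacobi u k *+ n) + jacobi w k * p) * q).
  by rewrite /jacobi !hf; case: n {hf} => /=; rewrite ?mulr1n ?mulr0n; ring.
by rewrite hu hw; case: n {hf} => /=; rewrite ?mulr1n ?mulr0n; ring.
Qed.

Lemma jacobi_conj u z : (forall k, jacobi u k = z * u k.+1) ->
  forall k, jacobi (fun j => (cj (u j))) k = cj z * (cj (u k.+1)).
Proof.
move=> h k; rewrite -conjM -h /jacobi.
by rewrite conjB conjD !conjM conjN !conjR.
Qed.

Lemma jacobi_Re u z : Im z = 0 -> (forall k, jacobi u k = z * u k.+1) ->
  forall k, jacobi (fun j => (Re (u j))%:C) k = z * (Re (u k.+1))%:C.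
Proof.
move=> z0 h k; have := congr1 (@complex.Re R) (h k).
rewrite (realE z0) /jacobi ReRM ReB ReD -rmorphN !ReRM => E.
by rewrite -!rmorphM -rmorphD -rmorphB E.
Qed.

Hypothesis be_gt0 : forall k, 0 < be k.

Lemma jacobi_zero u z k0 : (forall k, jacobi u k = z * u k.+1) ->
  u k0 = 0 -> u k0.+1 = 0 -> forall k, (k0 <= k)%N -> u k = 0.
Proof.
move=> h u0 u1 k; move=> /subnK <-; elim: (k - k0)%N => // n.
suff : forall n, u (n + k0)%N = 0 /\ u (n + k0).+1 = 0 by move=> H _; case: (H n.+1).
elim=> [//|m [m0 m1]]; rewrite addSn; split=> //.
have := h (m + k0)%N; rewrite /jacobi m0 m1 !mulr0 add0r sub0r => /eqP.
rewrite oppr_eq0 mulf_eq0 RC_eq0 => /orP[|/eqP//].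
by rewrite gt_eqF.
Qed.

Lemma wronsk_const u w z : (forall k, jacobi u k = z * u k.+1) ->
  (forall k, jacobi w k = z * w k.+1) -> forall k, wronsk u w k = wronsk u w 0.
Proof.
move=> hu hw k; apply/eqP; rewrite -subr_eq0 -(jacobi_green_eq _ hu hw).
by rewrite subrr mul0r.
Qed.

Variable b : R.
Hypothesis be_cvg : be k @[k --> \oo] --> b.

Lemma wronsk_cvg0 u w M : u k @[k --> \oo] --> (0 : R[i]) ->
  (\forall k \near \oo, nrm (w k) <= M) -> wronsk u w k @[k --> \oo] --> (0 : R[i]).
Proof.
move=> u0 wM.
have uS : u k.+1 @[k --> \oo] --> (0 : R[i]) by rewrite -(cvg_shiftS u) in u0.
have wS : \forall k \near \oo, nrm (w k.+1) <= M.
  by case: wM => N _ wN; exists N => // k /= Nk; apply: wN => /=; exact: leqW.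
pose proof (cvgC_real be_cvg) as beC.
pose proof (cvgC_null_bound u0 wS) as h1.
pose proof (cvgC_null_bound uS wM) as h2.
have -> : 0 = b%:C * (0 - 0) :> R[i] by rewrite subrr mulr0.
exact: (cvgCM beC (cvgCB h1 h2)).
Qed.

End JacobiOperator.

Section Joukowski.
Variable R : realType.
Implicit Types (a b : R) (z t : R[i]).

Lemma joukowskiB a b z t : z != 0 -> t != 0 ->
  joukowski a b z - joukowski a b t = - b%:C * (z - t) * (1 - (z * t)^-1).
Proof. by move=> z0 t0; rewrite /joukowski; field; rewrite z0 t0. Qed.

Lemma Im_joukowski a b z : Im (joukowski a b z) = b * Im z * ((nrm z ^+ 2)^-1 - 1).
Proof.
by rewrite /joukowski ImB ImRM ImD Im_inv /=; ring.
Qed.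

Lemma joukowski_inj a b z t : 0 < b -> z != 0 -> t != 0 ->
  nrm z < 1 -> nrm t <= 1 -> joukowski a b z = joukowski a b t -> z = t.
Proof.
move=> b0 z0 t0 z1 t1 /eqP; rewrite -subr_eq0 joukowskiB // !mulf_eq0 oppr_eq0.
rewrite RC_eq0 gt_eqF //= => /orP[|]; rewrite subr_eq0 => /eqP // E.
have : nrm (z * t) = 1 by rewrite -[z * t]invrK nrmV -E nrm1 invr1.
rewrite nrmM => E'.
have : nrm z * nrm t <= nrm z * 1 by rewrite ler_wpM2l // nrm_ge0.
by rewrite E' mulr1 leNgt z1.
Qed.

Lemma joukowski_real_disk a b z : 0 < b -> z != 0 -> nrm z < 1 ->
  Im (joukowski a b z) = 0 -> Im z = 0.
Proof.
move=> b0 z0 z1; rewrite Im_joukowski => /eqP.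
have n0 : 0 < nrm z by rewrite nrm_gt0.
rewrite !mulf_eq0 gt_eqF //= => /orP[/eqP //|].
rewrite subr_eq0 invr_eq1 sqrf_eq1 (lt_eqF z1) /= => /eqP E.
by move: n0; rewrite E oppr_gt0 ltr10.
Qed.

Lemma joukowski_real a b z : Im z = 0 -> Im (joukowski a b z) = 0.
Proof. by move=> h; rewrite Im_joukowski h mulr0 mul0r. Qed.
Lemma joukowski_circle a b z : nrm z = 1 -> Im (joukowski a b z) = 0.
Proof. by move=> h; rewrite Im_joukowski h expr1n invr1 subrr mulr0. Qed.

Lemma circle_conj z : nrm z = 1 -> cj z = z^-1.
Proof.
move=> h; have z0 : z != 0 by rewrite -nrm_gt0 h.
by apply: (mulfI z0); rewrite mul_conj h expr1n divff.
Qed.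
End Joukowski.

(** * Zeros of a family of Jost solutions *)

Section JostFamily.
Variables (R : realType) (be al : nat -> R) (a b C r : R).
Hypotheses (b_gt0 : 0 < b) (r_gt0 : 0 < r) (r_lt1 : r < 1).
Hypothesis be_gt0 : forall k, 0 < be k.
Hypothesis be_near : forall k, `|be k.+1 - b| <= C * r ^+ k.
Hypothesis al_near : forall k, `|al k.+1 - a| <= C * r ^+ k.
Local Notation W := (joukowski a b).
Local Notation JJ := (jacobi be al).
Local Notation WW := (wronsk be).
Local Notation be_cvg := (offdiag_cvg r_gt0 r_lt1 be_near).

Variable e : nat -> R[i] -> R[i].
Hypothesis e_eq : forall t : R[i], nrm t <= 1 -> t != 0 ->
  forall k, JJ (e^~ t) k = W t * e k.+1 t.
Hypothesis e_asymp : forall t : R[i], nrm t <= 1 -> t != 0 ->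
  e k t / t ^+ k @[k --> \oo] --> (1 : R[i]).
Hypothesis e_cont : forall k (t : R[i]), nrm t <= 1 -> e k z @[z --> t] --> e k t.

Lemma nrm_expr_cvg0 (t : R[i]) : nrm t < 1 -> t ^+ k @[k --> \oo] --> (0 : R[i]).
Proof.
move=> t1; apply: (cvgC_dom (u := fun k => nrm t ^+ k)).
  by apply: nearW => k; rewrite subr0 nrmX.
by apply: cvg_expr; rewrite ger0_norm ?nrm_ge0.
Qed.

Lemma jost_factor (t : R[i]) k : t != 0 -> e k t = (e k t / t ^+ k) * t ^+ k.
Proof. by move=> t0; rewrite mulfVK // expf_neq0. Qed.

Lemma jost_cvg0 (t : R[i]) : nrm t < 1 -> t != 0 -> e k t @[k --> \oo] --> (0 : R[i]).
Proof.
move=> t1 t0; pose proof (cvgCM (e_asymp (ltW t1) t0) (nrm_expr_cvg0 t1)) as h.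
rewrite mulr0 in h; apply: (cvgC_ext h); apply: nearW => k.
by rewrite -jost_factor.
Qed.

Lemma jost_bound (t : R[i]) : nrm t <= 1 -> t != 0 ->
  exists M, \forall k \near \oo, nrm (e k t) <= M.
Proof.
move=> t1 t0; have [M M0 h] := cvgC_bound (e_asymp t1 t0).
exists M; apply: filterS h => k; rewrite nrmM nrmV => h.
rewrite (jost_factor k t0) !nrmM nrmV nrmX.
apply: le_trans (_ : M * 1 <= M); last by rewrite mulr1.
apply: ler_pM; rewrite ?mulr_ge0 ?invr_ge0 ?exprn_ge0 ?nrm_ge0 //.
  by rewrite -nrmX.
by rewrite exprn_ile1 ?nrm_ge0.
Qed.

Lemma jost_circle_cvg (t : R[i]) : nrm t = 1 -> nrm (e k t) @[k --> \oo] --> (1 : R).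
Proof.
move=> t1; have t0 : t != 0 by rewrite -nrm_gt0 t1.
have tl : nrm t <= 1 by rewrite t1.
pose proof (cvg_nrm (e_asymp tl t0)) as h; rewrite nrm1 in h.
by move: h; under eq_fun do rewrite nrmM nrmV nrmX t1 expr1n invr1 mulr1.
Qed.

Lemma jost_near_neq0 (t : R[i]) : nrm t <= 1 -> t != 0 -> \forall k \near \oo, e k t != 0.
Proof.
move=> t1 t0; pose proof (near_neq0 (oner_neq0 _) (e_asymp t1 t0)) as h.
by apply: filterS h => k; rewrite mulf_eq0 negb_or => /andP[].
Qed.

Lemma jost_neq0_pair (t : R[i]) K : nrm t <= 1 -> t != 0 -> e K t = 0 -> e K.+1 t != 0.
Proof.
move=> t1 t0 eK; apply/eqP => eK1.
have h := jacobi_zero be_gt0 (e_eq t1 t0) eK eK1.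
have [N _ hN] := jost_near_neq0 t1 t0.
by have := hN (maxn K N) (leq_maxr _ _); rewrite h ?leq_maxl // eqxx.
Qed.

(** A zero of [e 1] in the open disk makes [W t] an eigenvalue of the half-line
    operator, which is symmetric. *)
Lemma jost1_zero_real_energy (t : R[i]) : nrm t < 1 -> t != 0 -> e 1 t = 0 -> Im (W t) = 0.
Proof.
move=> t1 t0 e10; have he := e_eq (ltW t1) t0.
have hc := jacobi_conj he.
have [M hM] := jost_bound (ltW t1) t0.
have hM' : \forall k \near \oo, nrm (cj (e k t)) <= M.
  by apply: filterS hM => k; rewrite nrmJ.
have w0 := wronsk_cvg0 be_cvg (jost_cvg0 t1 t0) hM'.
have S k : (W t - cj (W t)) * (\sum_(j < k) e j.+1 t * cj (e j.+1 t))
    = WW (e^~ t) (fun j => cj (e j t)) k.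
  by rewrite (jacobi_green_eq k he hc) /wronsk e10 mul0r conjc0 mulr0 subrr mulr0 subr0.
have h k : (2 <= k)%N ->
    2 * `|Im (W t)| * nrm (e 2 t) ^+ 2 <= nrm (WW (e^~ t) (fun j => cj (e j t)) k).
  move=> k2; rewrite -S nrmM sub_conj nrmM nrmR.
  have -> : nrm ('i%C : R[i]) = 1 by rewrite /= expr0n expr1n add0r sqrtr1.
  rewrite normrM (ger0_norm (_ : 0 <= 2)) // mulr1 ler_wpM2l ?mulr_ge0 //.
  under eq_bigr do rewrite mul_conj.
  rewrite -RC_sum nrmR ger0_norm; last by apply: sumr_ge0 => i _; rewrite sqr_ge0.
  case: k k2 => // k k2; rewrite (bigD1 (Ordinal k2)) //= lerDl.
  by apply: sumr_ge0 => i _; rewrite sqr_ge0.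
have : 2 * `|Im (W t)| * nrm (e 2 t) ^+ 2 <= 0.
  pose proof (cvg_nrm w0) as w1; rewrite nrm0 in w1.
  by apply: (cvgr_to_ge w1); exists 2%N.
have e2 : 0 < nrm (e 2 t) ^+ 2 by rewrite exprn_gt0 // nrm_gt0 jost_neq0_pair // ltW.
by rewrite pmulr_lle0 // pmulr_rle0 // normr_le0 => /eqP.
Qed.

Lemma jost1_zero_disk_real (t : R[i]) : nrm t < 1 -> t != 0 -> e 1 t = 0 -> Im t = 0.
Proof. by move=> t1 t0 h; apply: (joukowski_real_disk b_gt0 t0 t1 (jost1_zero_real_energy t1 t0 h)). Qed.

(** On the circle the Jost solution and its conjugate have Wronskian
    [b (t^-1 - t)], by their asymptotics; it vanishes if [e 1] does. *)
Lemma jost1_zero_circle (t : R[i]) : nrm t = 1 -> e 1 t = 0 -> t ^+ 2 = 1.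
Proof.
move=> t1 e10; have t0 : t != 0 by rewrite -nrm_gt0 t1.
have tl : nrm t <= 1 by rewrite t1.
have he := e_eq tl t0; have hc := jacobi_conj he.
have ct : cj (W t) = W t by rewrite [W t]realE ?conjR // joukowski_circle.
rewrite ct in hc.
have tV := circle_conj t1.
have w0 k : WW (e^~ t) (fun j => cj (e j t)) k = 0.
  by rewrite (wronsk_const he hc) /wronsk e10 mul0r conjc0 mulr0 subrr mulr0.
have h1 := e_asymp tl t0.
have h1S : e k.+1 t / t ^+ k.+1 @[k --> \oo] --> (1 : R[i]).
  by rewrite -(cvg_shiftS (fun k => e k t / t ^+ k)) in h1.
have hlim : WW (e^~ t) (fun j => cj (e j t)) k @[k --> \oo]
     --> b%:C * (1 * cj 1 * t^-1 - 1 * cj 1 * t).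
  pose proof (cvgCM (cvgC_real be_cvg) (cvgCB
     (cvgCM (cvgCM h1 (cvgC_conj h1S)) (cvgC_cst t^-1))
     (cvgCM (cvgCM h1S (cvgC_conj h1)) (cvgC_cst t)))) as A.
  apply: (cvgC_ext A); apply: nearW => k; rewrite /wronsk !conjM !conjV !conjX tV.
  by rewrite !exprS !exprVn; field; rewrite expf_neq0.
have : b%:C * (1 * cj 1 * t^-1 - 1 * cj 1 * t) = 0.
  apply: (cvgC_uniq hlim); apply: (cvgC_ext (cvgC_cst 0)).
  by apply: nearW => k; rewrite w0.
move=> /eqP; rewrite conjc1 !mul1r mulf_eq0 RC_eq0 gt_eqF //= subr_eq0 => /eqP E.
by rewrite expr2 -{1}E mulVf.
Qed.

(** At a real energy the conjugate of [e] is a solution with the same asymptotics.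
    The difference decays faster than [e], yet is proportional to [e] since their
    Wronskian vanishes at infinity. *)
Lemma jost_real (t : R[i]) : nrm t < 1 -> t != 0 -> Im t = 0 -> forall k, Im (e k t) = 0.
Proof.
move=> t1 t0 tr k; have he := e_eq (ltW t1) t0.
have Wr := joukowski_real a b tr.
have hc := jacobi_conj he.
have ct : cj (W t) = W t by rewrite [W t]realE ?conjR.
rewrite ct in hc.
have tc : cj t = t by rewrite [t]realE ?conjR.
pose d j := e j t - cj (e j t).
suff : d k = 0.
  rewrite /d sub_conj => /eqP; rewrite mulf_eq0 RC_eq0 mulf_eq0 pnatr_eq0 /=.
  by case/orP => /eqP // /(congr1 (@complex.Im R)) /= /eqP; rewrite oner_eq0.
have hd j : JJ d j = W t * d j.+1.
  by move: (he j) (hc j); rewrite /d mulrBr => <- <-; rewrite /jacobi; ring.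
have dt : d j / t ^+ j @[j --> \oo] --> (0 : R[i]).
  have h := e_asymp (ltW t1) t0.
  pose proof (cvgCB h (cvgC_conj h)) as A; rewrite conjc1 subrr in A.
  apply: (cvgC_ext A); apply: nearW => j.
  by rewrite /d mulrBl conjM conjV conjX tc.
have d0 : d j @[j --> \oo] --> (0 : R[i]).
  pose proof (cvgCB (jost_cvg0 t1 t0) (cvgC_conj (jost_cvg0 t1 t0))) as A.
  by rewrite conjc0 subr0 in A; exact: A.
have [M hM] := jost_bound (ltW t1) t0.
have w0 := wronsk_cvg0 be_cvg d0 hM.
have wz j : WW d (e^~ t) j = 0.
  rewrite (wronsk_const hd he); apply: (cvgC_uniq _ w0).
  apply: (cvgC_ext (cvgC_cst (WW d (e^~ t) 0))); apply: nearW => i.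
  exact/esym/(wronsk_const hd he).
have [K kK eK] : exists2 K, (k <= K)%N & e K t != 0.
  have [N _ hN] := jost_near_neq0 (ltW t1) t0.
  by exists (maxn k N); [exact: leq_maxl|apply: hN; exact: leq_maxr].
(* Two solutions with zero Wronskian are proportional beyond K, and comparing
   their asymptotics shows that the factor is 0. *)
pose c := d K / e K t.
have dc j : (K <= j)%N -> d j = c * e j t.
  move=> Kj; apply/eqP; rewrite -subr_eq0; apply/eqP.
  apply: (jacobi_zero be_gt0 (al := al) (u := fun j => d j - c * e j t) (z := W t) _ _ _ Kj).
  - move=> i; transitivity (JJ d i - c * JJ (e^~ t) i); first by rewrite /jacobi; ring.
    by rewrite hd he; ring.
  - by rewrite /c mulfVK // subrr.
  - have /eqP := wz K; rewrite mulf_eq0 RC_eq0 gt_eqF //= subr_eq0 => /eqP E.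
    by rewrite /c mulrAC E mulrK ?subrr // unitfE.
have c0 : c = 0.
  have h : c * (e j t / t ^+ j) @[j --> \oo] --> (c * 1 : R[i]).
    exact: (cvgCM (cvgC_cst _) (e_asymp (ltW t1) t0)).
  rewrite -[c]mulr1; apply: (cvgC_uniq h); apply: (cvgC_ext dt).
  by exists K => // j /= Kj; rewrite dc // mulrA.
have dz j : (K <= j)%N -> d j = 0 by move=> /dc ->; rewrite c0 mul0r.
have back n j : (K <= j + n)%N -> d j = 0.
  elim: n j => [|n IH] j h; first by apply: dz; rewrite addn0 in h.
  have E1 : d j.+1 = 0 by apply: IH; rewrite addSnnS.
  have E2 : d j.+2 = 0 by apply: IH; rewrite !addSnnS (leq_trans h) // leq_add2l leqnSn.
  have := hd j; rewrite /jacobi E1 E2 !mulr0 addr0 subr0 => /eqP.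
  by rewrite mulf_eq0 oppr_eq0 RC_eq0 gt_eqF //= => /eqP.
by apply: (back K); rewrite leq_addl.
Qed.

(** A form of Sturm oscillation. With the factor [sg t ^ k] the Jost solution obeys
    an equation whose coefficients are at least [2 b - C r^k], as
    [|t| + 1 / |t| >= 2]; and [positive_tail] is uniform in such equations. *)
Lemma jost_tail_pos : exists N, forall t : R, t != 0 -> `|t| <= 1 ->
  forall k, (N <= k)%N -> 0 < Num.sg t ^+ k * Re (e k t%:C).
Proof.
have [N hN] := positive_tail b_gt0 r_gt0 r_lt1 be_gt0 be_near.
exists N => t t0 t1 k Nk.
have tC0 : (t%:C : R[i]) != 0 by rewrite RC_neq0.
have tC1 : nrm (t%:C : R[i]) <= 1 by rewrite nrmR.
pose s := Num.sg t; have ss : s * s = 1 by rewrite -expr2 sqr_sg t0.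
have st : s * t = `|t| by rewrite normrEsg.
pose w := a - b * (t + t^-1); pose g j := s * (al j - w).
pose v j := s ^+ j * Re (e j t%:C).
have vE j : v j = `|t| ^+ j * Re (e j t%:C / t%:C ^+ j).
  rewrite -rmorphXn -fmorphV (mulrC (e _ _)) ReRM -st exprMn /v.
  have : t ^+ j != 0 by rewrite expf_neq0.
  by move=> h; field.
have Wt : W t%:C = w%:C by rewrite /w rmorphB rmorphM rmorphD fmorphV.
have eqv j : be j * v j + be j.+1 * v j.+2 = g j.+1 * v j.+1.
  have := congr1 (@complex.Re R) (e_eq tC1 tC0 j).
  rewrite /jacobi Wt -rmorphN !ReB ReD !ReRM => E.
  have -> : g j.+1 * v j.+1 = s ^+ j * (s * s) * (al j.+1 * Re (e j.+1 t%:C)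
     - w * Re (e j.+1 t%:C)) by rewrite /g /v exprS; ring.
  by rewrite -E ss /v !exprS (mulrA s s) ss; ring.
pose proof (cvg_Re (e_asymp tC1 tC0)) as ReasC.
have vpos : \forall j \near \oo, 0 < v j.
  have /cvgRP/(_ _ ltr01) h := ReasC.
  apply: filterS h => j; rewrite vE ltr_norml /= => /andP[h1 h2].
  by rewrite mulr_gt0 ?exprn_gt0 ?normr_gt0 //; lra.
have gge j : 2 * b - C * r ^+ j <= g j.+1.
  have tp : 0 < `|t| by rewrite normr_gt0.
  have -> : g j.+1 = s * (al j.+1 - a) + b * (`|t| + `|t|^-1).
    rewrite /g /w -st invfM.
    have -> : s^-1 = s by rewrite -[LHS]mul1r -ss mulfK // sgr_eq0.
    by ring.
  have : - (C * r ^+ j) <= s * (al j.+1 - a).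
    have : `|s * (al j.+1 - a)| <= C * r ^+ j by rewrite normrM normr_sg t0 mul1r.
    by rewrite ler_norml => /andP[].
  have : 2 <= `|t| + `|t|^-1.
    rewrite -subr_ge0 (_ : _ - 2 = (`|t| - 1) ^+ 2 / `|t|); last by field; rewrite gt_eqF.
    by rewrite divr_ge0 ?sqr_ge0.
  move=> h1 h2; have := ler_wpM2l (ltW b_gt0) h1; lra.
have [l vl] : exists l : R, v j @[j --> \oo] --> l.
  have [tl|te] := ltP `|t| 1.
    exists (0 * Re (1 : R[i])).
    have A : `|t| ^+ j @[j --> \oo] --> 0 by apply: cvg_expr; rewrite ger0_norm.
    by rewrite (_ : v = (fun j => `|t| ^+ j * Re (e j t%:C / t%:C ^+ j))); [exact: (cvgM A ReasC)|exact/funext].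
  exists (Re (1 : R[i])); have T1 : `|t| = 1 by apply/eqP; rewrite eq_le t1 te.
  have -> : v = (fun j => Re (e j t%:C / t%:C ^+ j)).
    by apply/funext => j; rewrite vE T1 expr1n mul1r.
  exact: ReasC.
exact: (hN g v l gge eqv vl vpos k Nk).
Qed.

(** Distinct real energies give orthogonal Dirichlet solutions, up to the
    Wronskian at the origin; the product of two Jost solutions is positive
    beyond a fixed site, so that [e 1] cannot be small near one of its zeros. *)
Lemma jost1_lower (t0 : R) : t0 != 0 -> `|t0| <= 1 -> e 1 t0%:C = 0 ->
  exists2 c, 0 < c & exists2 d, 0 < d & forall t : R, t != 0 -> `|t| < 1 ->
    `|t - t0| < d -> c * nrm (W t%:C - W t0%:C) <= nrm (e 1 t%:C).
Proof.
move=> t00 t01 e10; have [N hN] := jost_tail_pos.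
have tC0 : (t0%:C : R[i]) != 0 by rewrite RC_neq0.
have tC1 : nrm (t0%:C : R[i]) <= 1 by rewrite nrmR.
pose u0 k := Re (e k t0%:C).
pose S (z : R[i]) := \sum_(k < N.+1) Re (e k.+1 z) * u0 k.+1.
have S0 : 0 < S t0%:C.
  rewrite /S big_ord_recr /= ltr_wpDl //.
    by apply: sumr_ge0 => k _; rewrite -expr2 sqr_ge0.
  have := hN t0 t00 t01 N.+1 (leqnSn N).
  rewrite -/(u0 N.+1) -expr2 exprn_even_gt0 //= => h.
  by apply/eqP => E; move: h; rewrite E mulr0 ltxx.
have SC z : (S z)%:C = \sum_(k < N.+1) (Re (e k.+1 z))%:C * (u0 k.+1)%:C :> R[i].
  by rewrite RC_sum; apply: eq_bigr => k _; rewrite rmorphM.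
have [d1 d1_gt0 hd1] : exists2 d : R, 0 < d & forall z : R[i], nrm (z - t0%:C) < d ->
    S t0%:C / 2 < S z.
  have S2 : 0 < S t0%:C / 2 by rewrite divr_gt0.
  have Sc (z0 : R[i]) : nrm z0 <= 1 ->
      \sum_(k < N.+1) (Re (e k.+1 z))%:C * (u0 k.+1)%:C @[z --> z0]
      --> \sum_(k < N.+1) (Re (e k.+1 z0))%:C * (u0 k.+1)%:C.
    move=> z01; apply: (cvgC_sum (F := nbhs z0)) => k _.
    exact: (cvgCM (cvgC_real (cvg_Re (e_cont z01))) (cvgC_cst _)).
  have /cvgCP/(_ _ S2)/nbhsC_ball[d d0 h] := Sc _ tC1; exists d => // z /h.
  rewrite -!SC.
  by rewrite -rmorphB nrmR ltr_norml; lra.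
pose q := be 0 * `|u0 0%N| + 1.
have q0 : 0 < q by rewrite ltr_wpDl // mulr_ge0 // ltW.
exists (S t0%:C / 2 / q); first by rewrite !divr_gt0.
exists (Num.min d1 `|t0|); first by rewrite lt_min d1_gt0 normr_gt0.
move=> t tn0 t1; rewrite lt_min => /andP[td tt0].
have tzC0 : (t%:C : R[i]) != 0 by rewrite RC_neq0.
have tzC1 : nrm (t%:C : R[i]) < 1 by rewrite nrmR.
have sgE : Num.sg t = Num.sg t0.
  have [t0p|t0m|E] := ltgtP t0 0; last by rewrite E eqxx in t00.
    move: tt0; rewrite (ltr0_norm t0p) ltr_norml => tt0.
    by rewrite !ltr0_sg //; lra.
  move: tt0; rewrite (gtr0_norm t0m) ltr_norml => tt0.
  by rewrite !gtr0_sg //; lra.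
pose u k := Re (e k t%:C).
have St : S t0%:C / 2 < S t%:C by apply: hd1; rewrite -rmorphB nrmR.
have hu := jacobi_Re (joukowski_real a b (erefl : Im t%:C = 0)) (e_eq (ltW tzC1) tzC0).
have hu0 := jacobi_Re (joukowski_real a b (erefl : Im t0%:C = 0)) (e_eq tC1 tC0).
pose w n := WW (fun k => (u k)%:C) (fun k => (u0 k)%:C) n.
have green n : (W t%:C - W t0%:C) * (\sum_(k < n) u k.+1 * u0 k.+1)%:C = w n - w 0%N.
  rewrite RC_sum -(jacobi_green_eq n hu hu0); congr (_ * _).
  by apply: eq_bigr => k _; rewrite rmorphM.
have Sn n : (N < n)%N -> S t0%:C / 2 <= \sum_(k < n) u k.+1 * u0 k.+1.
  elim: n => // n IH; rewrite ltnS leq_eqVlt => /orP[/eqP<-|Nn]; first exact: ltW.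
  rewrite big_ord_recr /=; apply: le_trans (IH Nn) _; rewrite lerDl.
  have Nn1 : (N <= n.+1)%N by rewrite leqW // ltnW.
  have := mulr_gt0 (hN t tn0 (ltW t1) _ Nn1) (hN t0 t00 t01 _ Nn1).
  rewrite sgE mulrACA -expr2 -exprM mulnC exprM sqr_sg t00 expr1n mul1r.
  exact: ltW.
have wn : w n @[n --> \oo] --> (0 : R[i]).
  have [M hM] := jost_bound tC1 tC0.
  apply: (wronsk_cvg0 (M := M) be_cvg).
    exact: (cvgC_real (cvg_Re (jost_cvg0 tzC1 tzC0))).
  by apply: filterS hM => k; rewrite nrmR; apply/le_trans/Re_nrm.
have key : nrm (W t%:C - W t0%:C) * (S t0%:C / 2) <= nrm (w 0%N).
  pose proof (cvg_nrm (cvgCB wn (cvgC_cst (w 0%N)))) as wl; rewrite sub0r nrmN in wl.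
  apply: (cvgr_to_ge wl); exists N.+1 => // n Nn.
  rewrite -[w n - w 0%N]green nrmM nrmR ler_wpM2l ?nrm_ge0 //.
  by apply: le_trans (Sn _ Nn) (ler_norm _).
rewrite mulrAC ler_pdivrMr // mulrC; apply: le_trans key _.
have -> : w 0%N = - (be 0)%:C * (u 1%N)%:C * (u0 0%N)%:C.
  by rewrite /w /wronsk /u0 e10 /=; ring.
rewrite !nrmM nrmN !nrmR (ger0_norm (ltW (be_gt0 0))).
have h1 : `|u 1%N| <= nrm (e 1 t%:C) by exact: Re_nrm.
have h2 := ler_wpM2l (mulr_ge0 (ltW (be_gt0 0)) (normr_ge0 (u0 0%N))) h1.
rewrite /q; have := nrm_ge0 (e 1 t%:C); lra.
Qed.

(** Zeros in the open disk are real, and zeros on the circle are [1] or [-1], so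
    that near a zero [jost1_lower] decides. *)
Lemma jost1_isolated (t0 : R[i]) : nrm t0 <= 1 -> t0 != 0 ->
  exists2 d : R, 0 < d & forall t, nrm t < 1 -> t != 0 -> t != t0 ->
    nrm (t - t0) < d -> e 1 t != 0.
Proof.
move=> t01 t00; have [e10|e10] := eqVneq (e 1 t0) 0; last first.
  pose proof (near_neq0 e10 (e_cont (k := 1) t01)) as H; move/nbhsC_ball : H => [d d0 h].
  by exists d => // t _ _ _; exact: h.
have t0r : Im t0 = 0.
  move: t01; rewrite le_eqVlt => /orP[/eqP t01|t01]; last exact: jost1_zero_disk_real.
  have /eqP := jost1_zero_circle t01 e10.
  by rewrite sqrf_eq1 => /orP[] /eqP ->; rewrite /= ?oppr0.
have [s sE] : exists s : R, t0 = s%:C by exists (Re t0); exact: realE.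
subst t0; rewrite RC_eq0 in t00; rewrite nrmR in t01.
have [c c0 [d d0 h]] := jost1_lower t00 t01 e10.
exists d => // t t1 t0n tt0 td; apply/eqP => et.
have [r' rE] : exists r : R, t = r%:C.
  by exists (Re t); apply: realE; exact: jost1_zero_disk_real.
subst t; have := h r'.
rewrite -(RC_eq0 r') t0n -!nrmR rmorphB t1 td => /(_ isT isT isT).
rewrite et nrm0 pmulr_rle0 // leNgt nrm_gt0 negbK subr_eq0 => /eqP E.
move: tt0; rewrite (joukowski_inj b_gt0 t0n _ t1 _ E) ?eqxx ?RC_eq0 //.
by rewrite nrmR.
Qed.

(** The lower bound of [jost1_lower] is linear in [t - t0], since the derivative of
    [W] vanishes only at [1] and [-1]. *)
Lemma jost1_derivative_neq0 (t0 : R[i]) l : nrm t0 <= 1 -> t0 != 0 -> e 1 t0 = 0 ->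
  t0 ^+ 2 != 1 -> (e 1 t - e 1 t0) / (t - t0) @[t --> t0^'] --> l -> l != 0.
Proof.
move=> t01 t00 e10 t02 hl; apply/eqP => l0; rewrite l0 in hl.
have {}t01 : nrm t0 < 1.
  rewrite lt_def t01 andbT; apply/eqP => E.
  by have := jost1_zero_circle (esym E) e10; apply/eqP.
have [t0' tE] : exists s : R, t0 = s%:C.
  by exists (Re t0); apply: realE; exact: jost1_zero_disk_real.
have t00' : t0' != 0 by rewrite -(RC_eq0 t0') -tE.
have t01' : `|t0'| < 1 by rewrite -nrmR -tE.
have [c c0 [d d0 h]] := jost1_lower t00' (ltW t01') (etrans (congr1 (e 1) (esym tE)) e10).
have p0 : 0 < `|t0'| by rewrite normr_gt0.
pose m := c * (b * (`|t0'|^-1 - 1)).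
have m0 : 0 < m by rewrite !mulr_gt0 // subr_gt0 invf_gt1.
move/cvgCP : hl => /(_ _ m0) /nbhsC_ball[d' d'0 h'].
pose n := Num.min (Num.min d d') (Num.min `|t0'| (1 - `|t0'|)).
have n0 : 0 < n by rewrite !lt_min d0 d'0 p0 subr_gt0.
pose t := t0' + n / 2.
have n2 : 0 < n / 2 by rewrite divr_gt0.
have [nd nd' np n1] : [/\ n / 2 < d, n / 2 < d', n / 2 < `|t0'| & n / 2 < 1 - `|t0'|].
  have hn : n / 2 < n by rewrite ltr_pdivrMr // ltr_pMr // ltr1n.
  by split; apply: lt_le_trans hn _; rewrite /n !ge_min ?lexx ?orbT.
have tt : t - t0' = n / 2 by rewrite /t addrAC subrr add0r.
have tn0 : t != 0.
  by apply/eqP => E; move: np; rewrite -(normrN t0') -sub0r -E tt (gtr0_norm n2) ltxx.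
have t1 : `|t| < 1.
  by rewrite (le_lt_trans (ler_normD _ _)) // (gtr0_norm n2); lra.
have E1 := h t tn0 t1; rewrite tt (gtr0_norm n2) in E1; have {}E1 := E1 nd.
have tC : (t%:C : R[i]) - t0 = (n / 2)%:C by rewrite tE -rmorphB tt.
have := h' t%:C; rewrite tC nrmR (gtr0_norm n2) => /(_ nd').
have -> : (t%:C : R[i]) != t0.
  by rewrite -subr_eq0 tC RC_eq0 gt_eqF.
move=> /(_ isT); rewrite subr0 e10 subr0 nrmM nrmV nrmR (gtr0_norm n2) ltr_pdivrMr //.
rewrite ltNge => /negP; apply; apply: le_trans E1; rewrite -tE.
have tC0 : (t%:C : R[i]) != 0 by rewrite RC_eq0.
rewrite joukowskiB // nrmM nrmM nrmN nrmR (gtr0_norm b_gt0) tC nrmR (gtr0_norm n2).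
set x := nrm (1 - _); suff h2 : `|t0'|^-1 - 1 <= x.
  have q0 : 0 <= c * (b * (n / 2)) by rewrite !mulr_ge0 // ltW.
  have := ler_wpM2l q0 h2; rewrite /m; lra.
rewrite /x {x}.
have : nrm ((t%:C * t0)^-1) <= nrm (1 - (t%:C * t0)^-1) + 1.
  have := nrmD (1 - (t%:C * t0)^-1) (-1).
  by rewrite addrAC subrr sub0r !nrmN nrm1.
suff : `|t0'|^-1 <= nrm ((t%:C * t0)^-1) by lra.
rewrite nrmV nrmM tE !nrmR -/t0' lef_pV2 ?posrE ?mulr_gt0 ?normr_gt0 //.
by rewrite ler_piMl // ltW.
Qed.

End JostFamily.

(** * Approach from within the disk *)

Section DiskNbhs.
Variable R : realType.
Implicit Types (w z : R[i]) (b : R).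

Lemma disk_nbhsP (w : R[i]) (A : set R[i]) : disk_nbhs w A <->
  exists2 d : R, 0 < d & forall z, nrm z < 1 -> z != w -> nrm (z - w) < d -> A z.
Proof.
rewrite /disk_nbhs /within /= /dnbhs /within /=; split.
  move=> /nbhsC_ball[d d0 h]; exists d => // z z1 zw zd; apply: h => //.
  by rewrite /open_disk /= nrm_lt1.
move=> [d d0 h]; apply/nbhsC_ball; exists d => // z zd zw.
by rewrite /open_disk /= nrm_lt1 => z1; exact: h.
Qed.

Global Instance disk_nbhs_filter (w : R[i]) : Filter (disk_nbhs w).
Proof. exact: within_filter. Qed.

Lemma disk_nbhs_seq (w : R[i]) (om : nat -> R[i]) :
  om n @[n --> \oo] --> w -> (forall n, nrm (om n) < 1) ->
  (forall n, om n != w) -> om n @[n --> \oo] --> disk_nbhs w.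
Proof.
move=> /cvgCP ow o1 on A /disk_nbhsP[d d0 h].
by apply: filterS (ow _ d0) => n; exact: h.
Qed.

Lemma disk_nbhs_cvg (w : R[i]) : z @[z --> disk_nbhs w] --> w.
Proof.
apply/cvgCP => e e0; apply/disk_nbhsP; by exists e.
Qed.

Arguments disk_nbhs_cvg : clear implicits.

Lemma Im_joukowski_ge a b z : 0 < b -> z != 0 -> nrm z < 1 ->
  b * `|Im z| * (1 - nrm z ^+ 2) <= `|Im (joukowski a b z)|.
Proof.
move=> b0 z0 z1; rewrite Im_joukowski !normrM (gtr0_norm b0).
have n0 : 0 < nrm z by rewrite nrm_gt0.
have n2 : 0 < nrm z ^+ 2 by rewrite exprn_gt0.
have n1 : nrm z ^+ 2 <= 1 by rewrite exprn_ile1 // ltW.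
apply: ler_wpM2l; first by rewrite mulr_ge0 // ltW.
apply: le_trans (ler_norm _).
rewrite -subr_ge0 (_ : _ - _ = (1 - nrm z ^+ 2) ^+ 2 / nrm z ^+ 2).
  by rewrite divr_ge0 ?sqr_ge0 // ltW.
by field; rewrite gt_eqF.
Qed.

Lemma half_harmonic_cvg : (harmonic n / 2 : R)%R @[n --> \oo] --> (0 : R).
Proof.
have -> : 0 = 0 * 2^-1 :> R by rewrite mul0r.
by apply: cvgM; [exact: cvg_harmonic|exact: cvg_cst].
Qed.

(** A boundary point, or a real point, of the disk is approached by a sequence
    along which [Im lam] controls the distance to the limit: radially at a
    nonreal point of the circle, vertically at an interior point, and obliquely
    at the critical points [1] and [-1] of the Joukowski map. *)
Lemma nontangential_seq a b w : 0 < b -> w != 0 -> nrm w <= 1 ->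
  Im (joukowski a b w) = 0 ->
  exists om : nat -> R[i], exists2 C : R, 0 < C &
    [/\ om n @[n --> \oo] --> w,
        forall n, nrm (om n) < 1 /\ Im (joukowski a b (om n)) != 0,
        forall n, nrm (om n - w) ^+ 2 <= C * `|Im (joukowski a b (om n))| &
        w ^+ 2 != 1 ->
        forall n, nrm (om n - w) <= C * `|Im (joukowski a b (om n))|].
Proof.
move=> b0 w0 w1 Iw.
pose h n : R := harmonic n / 2.
have h0 n : 0 < h n by rewrite divr_gt0 // harmonic_gt0.
have h2 n : h n <= 2^-1.
  by rewrite /h ler_piMl // /harmonic /= invf_le1 // ler1n.
have hC : (h n)%:C @[n --> \oo] --> (0 : R[i]) by apply: cvgC_real half_harmonic_cvg.
have cvgE c : w + (h n)%:C * c @[n --> \oo] --> w.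
  have -> : w + (h n)%:C * c @[n --> \oo] --> w = (w + (h n)%:C * c @[n --> \oo] --> w + 0 * c) by rewrite mul0r addr0.
  exact: (cvgCD (cvgC_cst w) (cvgCM hC (cvgC_cst c))).
suff [c [C C0 H]] : exists c, exists2 C : R, 0 < C & forall t : R, 0 < t -> t <= 2^-1 ->
    [/\ nrm (w + t%:C * c) < 1, 0 < `|Im (joukowski a b (w + t%:C * c))|,
      nrm (t%:C * c) ^+ 2 <= C * `|Im (joukowski a b (w + t%:C * c))| &
      w ^+ 2 != 1 -> nrm (t%:C * c) <= C * `|Im (joukowski a b (w + t%:C * c))|].
  exists (fun n => w + (h n)%:C * c), C; first exact: C0.
  split.
  - exact: cvgE.
  - by move=> n; have [h1 h3 _ _] := H _ (h0 n) (h2 n); split; rewrite // -normr_gt0.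
  - by move=> n; have [_ _ h1 _] := H _ (h0 n) (h2 n); rewrite addrAC subrr add0r.
  - by move=> w2 n; have [_ _ _ h1] := H _ (h0 n) (h2 n); rewrite addrAC subrr add0r h1.
have nz z : nrm z < 1 -> Im z != 0 -> z != 0 /\ 0 < 1 - nrm z ^+ 2.
  move=> z1 Iz; split; first by apply: contra Iz => /eqP ->.
  by rewrite subr_gt0 expr_lt1 // nrm_ge0.
have lowpos z : nrm z < 1 -> Im z != 0 ->
  b * `|Im z| * (1 - nrm z ^+ 2) <= `|Im (joukowski a b z)| /\ 0 < `|Im (joukowski a b z)|.
  move=> z1 Iz; have [z0 zp] := nz _ z1 Iz.
  have h1 := Im_joukowski_ge a b0 z0 z1; split=> //.
  by apply: lt_le_trans h1; rewrite !mulr_gt0 ?normr_gt0.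
have [w21|w21] := eqVneq (w ^+ 2) 1.
- (* Here the Joukowski map is real on the radius and on the circle, which leaves
     an oblique direction. *)
  have wE : w = 1 \/ w = -1 by move/eqP : w21; rewrite sqrf_eq1 => /orP[] /eqP; [left|right].
  exists (w * (-1 +i* 1)), (2 / b); first by rewrite divr_gt0.
  move=> t t0 t2.
  have E1 : nrm (w + t%:C * (w * (-1 +i* 1))) ^+ 2 = 1 - 2 * t + 2 * t ^+ 2.
    rewrite nrm_sqr !ReD !ImD !ReRM !ImRM !ReM !ImM /=.
    by case: wE => -> /=; rewrite ?oppr0; ring.
  have E2 : `|Im (w + t%:C * (w * (-1 +i* 1)))| = t.
    rewrite !ImD !ImRM !ImM /=.
    case: wE => -> /=; rewrite ?oppr0.
      by rewrite (_ : _ + _ = t); [rewrite gtr0_norm|ring].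
    by rewrite (_ : _ + _ = - t); [rewrite normrN gtr0_norm|ring].
  have E3 : nrm (t%:C * (w * (-1 +i* 1))) ^+ 2 = 2 * t ^+ 2.
    rewrite nrm_sqr !ReRM !ImRM !ReM !ImM /=.
    by case: wE => -> /=; rewrite ?oppr0; ring.
  have tt : t * t <= t * 2^-1 by rewrite ler_pM2l.
  have n1 : nrm (w + t%:C * (w * (-1 +i* 1))) < 1.
    rewrite -(@ltr_pXn2r _ 2) ?nnegrE ?nrm_ge0 // E1 expr1n; rewrite expr2; lra.
  have In : Im (w + t%:C * (w * (-1 +i* 1))) != 0 by rewrite -normr_gt0 E2.
  have [h1 h3] := lowpos _ n1 In; split => //.
  rewrite E3 mulrAC ler_pdivlMr //; rewrite E1 E2 in h1.
  apply: le_trans (_ : 2 * (b * t * (1 - (1 - 2 * t + 2 * t ^+ 2))) <= _); last by rewrite ler_pM2l.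
  have : b * t * (t * t) <= b * t * (t * 2^-1) by rewrite ler_pM2l // mulr_gt0.
  rewrite !expr2; lra.
have [Iw0|Iw0] := eqVneq (Im w) 0.
- have wlt : nrm w < 1.
    rewrite lt_def w1 andbT; apply: contra w21 => /eqP E.
    have := nrm_sqr w; rewrite -E Iw0 expr0n addr0 expr1n => E2.
    by rewrite (realE Iw0) -rmorphXn -E2 rmorph1.
  pose q := 1 - nrm w; have q0 : 0 < q by rewrite subr_gt0.
  have q1 : q <= 1 by rewrite /q lerBlDr lerDl nrm_ge0.
  have nI : nrm ('i%C : R[i]) = 1 by rewrite /= expr0n expr1n add0r sqrtr1.
  exists (q%:C * 'i%C), (2 / (b * q)); first by rewrite divr_gt0 // mulr_gt0.
  move=> t t0 t2; pose z := w + t%:C * (q%:C * 'i%C); rewrite -/z.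
  have E3 : nrm (t%:C * (q%:C * 'i%C : R[i])) = t * q.
    by rewrite !nrmM !nrmR nI mulr1 !gtr0_norm.
  have E2 : `|Im z| = t * q.
    by rewrite /z ImD Iw0 !ImRM /= mulr1 add0r gtr0_norm // mulr_gt0.
  have tq : t * q <= 2^-1 * q by rewrite ler_pM2r.
  have zlt : nrm z <= 1 - q / 2.
    by apply: le_trans (nrmD _ _) _; rewrite E3; move: tq; rewrite /q; lra.
  have n1 : nrm z < 1 by apply: le_lt_trans zlt _; lra.
  have In : Im z != 0 by rewrite -normr_gt0 E2 mulr_gt0.
  have [h1 h3] := lowpos _ n1 In.
  have key : t * q <= 2 / (b * q) * `|Im (joukowski a b z)|.
    rewrite mulrAC ler_pdivlMr ?mulr_gt0 //.
    apply: le_trans (_ : 2 * (b * `|Im z| * (1 - nrm z ^+ 2)) <= _); last by rewrite ler_pM2l.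
    rewrite E2; have zz : nrm z ^+ 2 <= nrm z.
      by rewrite expr2 ler_piMl ?nrm_ge0 // ltW.
    have : b * (t * q) * (q / 2) <= b * (t * q) * (1 - nrm z ^+ 2).
      by apply: ler_wpM2l; [rewrite !mulr_ge0 // ltW|lra].
    by lra.
  split => //; last by rewrite E3.
  rewrite E3; apply: le_trans key; rewrite expr2.
  have tq0 : 0 <= t * q by rewrite mulr_ge0 // ltW.
  have tq1 : t * q <= 1 by lra.
  by rewrite ler_piMl.
- have wE : nrm w = 1.
    move: w1; rewrite le_eqVlt => /orP[/eqP //|w1].
    by move: Iw0; rewrite (joukowski_real_disk b0 w0 w1 Iw) eqxx.
  exists (- w), (2 / (b * `|Im w|)); first by rewrite divr_gt0 // mulr_gt0 // normr_gt0.
  move=> t t0 t2; pose z := w + t%:C * (- w); rewrite -/z.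
  have E3 : nrm (t%:C * (- w)) = t by rewrite nrmM nrmN wE mulr1 nrmR gtr0_norm.
  have zE : z = (1 - t)%:C * w by rewrite /z rmorphB rmorph1; ring.
  have t10 : 0 < 1 - t by lra.
  have E1 : nrm z = 1 - t by rewrite zE nrmM wE mulr1 nrmR gtr0_norm.
  have E2 : `|Im z| = (1 - t) * `|Im w| by rewrite zE ImRM normrM gtr0_norm.
  have n1 : nrm z < 1 by rewrite E1; lra.
  have Ip : 0 < `|Im w| by rewrite normr_gt0.
  have In : Im z != 0 by rewrite -normr_gt0 E2 mulr_gt0.
  have [h1 h3] := lowpos _ n1 In.
  have key : t <= 2 / (b * `|Im w|) * `|Im (joukowski a b z)|.
    rewrite mulrAC ler_pdivlMr ?mulr_gt0 //.
    apply: le_trans (_ : 2 * (b * `|Im z| * (1 - nrm z ^+ 2)) <= _); last by rewrite ler_pM2l.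
    rewrite E2 E1; have bI : 0 < b * `|Im w| by rewrite mulr_gt0.
    have h4 : t <= 2 * (1 - t) * (1 - (1 - t) ^+ 2).
      have : t * t <= t * 2^-1 by rewrite ler_pM2l.
      have : t * (t * t) >= 0 by rewrite !mulr_ge0 // ltW.
      rewrite !expr2; lra.
    have := ler_wpM2l (ltW bI) h4; lra.
  split => //; last by rewrite E3.
  rewrite E3; apply: le_trans key; rewrite expr2.
  have t1 : t <= 1 by lra.
  by rewrite ler_piMl // ltW.
Qed.

Lemma disk_nbhs_proper (w : R[i]) : w != 0 -> nrm w <= 1 -> ProperFilter (disk_nbhs w).
Proof.
move=> w0 w1; apply: Build_ProperFilter_ex => A /disk_nbhsP[d d0 h].
pose t := Num.min (d / 2) 2^-1.
have t0 : 0 < t by rewrite lt_min divr_gt0 // invr_gt0 ltr0n.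
have t2 : t <= 2^-1 by rewrite /t ge_min lexx orbT.
have td : t < d.
  apply: le_lt_trans (_ : d / 2 < d); first by rewrite /t ge_min lexx.
  by rewrite ltr_pdivrMr // ltr_pMr // ltr1n.
have n0 : 0 < nrm w by rewrite nrm_gt0.
exists ((1 - t)%:C * w); apply: h.
- rewrite nrmM nrmR gtr0_norm; last by lra.
  have : (1 - t) * nrm w <= (1 - t) * 1 by rewrite ler_wpM2l //; lra.
  by lra.
- rewrite -subr_eq0 -{2}[w]mul1r -mulrBl mulf_eq0 negb_or w0 andbT.
  by rewrite rmorphB rmorph1 addrAC subrr sub0r oppr_eq0 RC_eq0 gt_eqF.
- rewrite -{2}[w]mul1r -mulrBl rmorphB rmorph1 addrAC subrr sub0r nrmM nrmN nrmR gtr0_norm //.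
  apply: le_lt_trans td; rewrite ler_piMr // ltW //.
Qed.

End DiskNbhs.

(** * Green identity and energy estimates for the whole system *)

Section States.
Variables (R : realType) (A : countType) (S : system R A).
Hypothesis hS : admissible S.
Variable iota : 'I_(nch S) -> 'I_(ncore S).
Hypothesis iotaP : forall s, core (iota s) = chan s 0.
Implicit Types (x y : 'I_(ncore S) -> R[i]) (u w : 'I_(nch S) -> nat -> R[i]).

(** A vector on [A] is given by its values [x] on the core and [u] on the channels,
    where [u s 0] repeats the value at the attachment point: this is the condition
    [glued] below. Then [coreop] is [L] at the core sites, while [jacobi] is [L] at
    the sites of a channel. *)
Definition coreop x u i : R[i] :=
  \sum_j (L S (core i) (core j))%:C * x j
  - \sum_(s | iota s == i) (fb s 0)%:C * u s 1%N.

Definition pairing n x u y w : R[i] :=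
  \sum_i x i * y i + \sum_s \sum_(k < n) u s k.+1 * w s k.+1.

Definition mass n x u : R :=
  \sum_i nrm (x i) ^+ 2 + \sum_s \sum_(k < n) nrm (u s k.+1) ^+ 2.

Definition glued x u := forall s, u s 0%N = x (iota s).

Lemma state_green n x u y w : glued x u -> glued y w ->
  \sum_i (coreop x u i * y i - x i * coreop y w i)
  + \sum_s \sum_(k < n) (jacobi (fb s) (fa s) (u s) k * w s k.+1
                         - u s k.+1 * jacobi (fb s) (fa s) (w s) k)
  = \sum_s wronsk (fb s) (u s) (w s) n.
Proof.
move=> hu hw.
have coreE x' u' y' : \sum_i coreop x' u' i * y' i
    = \sum_i \sum_j (L S (core i) (core j))%:C * x' j * y' i
      - \sum_s (fb s 0)%:C * u' s 1%N * y' (iota s).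
  rewrite (eq_bigr (fun i => \sum_j (L S (core i) (core j))%:C * x' j * y' i
      - \sum_(s | iota s == i) (fb s 0)%:C * u' s 1%N * y' (iota s))); last first.
    move=> i _; rewrite /coreop mulrBl !mulr_suml; congr (_ - _).
    by apply: eq_bigr => s /eqP ->.
  rewrite sumrB; congr (_ - _).
  rewrite (exchange_big_dep predT) //=; apply: eq_bigr => s _.
  by rewrite (eq_bigl (pred1 (iota s))) ?big_pred1_eq // => i; rewrite /= eq_sym.
have -> : \sum_i (coreop x u i * y i - x i * coreop y w i)
    = \sum_i coreop x u i * y i - \sum_i coreop y w i * x i.
  by rewrite sumrB; congr (_ - _); apply: eq_bigr => i _; rewrite mulrC.
rewrite !coreE.
have -> : \sum_i \sum_j (L S (core i) (core j))%:C * y j * x i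
    = \sum_i \sum_j (L S (core i) (core j))%:C * x j * y i.
  rewrite exchange_big; apply: eq_bigr => i _; apply: eq_bigr => j _.
  by rewrite (L_sym hS) mulrAC.
under [X in _ + X]eq_bigr => s _ do rewrite jacobi_green.
rewrite sumrB.
have -> : \sum_s wronsk (fb s) (u s) (w s) 0 = \sum_s (fb s 0)%:C * w s 1%N * x (iota s)
    - \sum_s (fb s 0)%:C * u s 1%N * y (iota s).
  rewrite -sumrB; apply: eq_bigr => s _; rewrite -hu -hw /wronsk; ring.
ring.
Qed.

Definition source (v : 'I_(nch S)) (K : nat) (c : R[i]) s k : R[i] :=
  if (s == v) && (k == K) then c else 0.

Definition solves (z : R[i]) v K c x u :=
  [/\ glued x u, forall i, coreop x u i = z * x i &
      forall s k, jacobi (fb s) (fa s) (u s) k = z * u s k.+1 + source v K c s k.+1].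

Lemma sum_source v K c n (f : 'I_(nch S) -> nat -> R[i]) : (0 < K <= n)%N ->
  \sum_s \sum_(k < n) source v K c s k.+1 * f s k.+1 = c * f v K.
Proof.
case: K => // K /= Kn; rewrite (bigD1 v) //= [X in _ + X]big1 ?addr0; last first.
  by move=> s /negbTE sv; rewrite big1 // => k _; rewrite /source sv mul0r.
rewrite (bigD1 (Ordinal Kn)) //= big1 ?addr0; last first.
  move=> k; rewrite -val_eqE /= => /negbTE kK.
  by rewrite /source eqSS kK andbF mul0r.
by rewrite /source !eqxx.
Qed.

Lemma solves_green z z' v K c c' x u y w n : (0 < K <= n)%N ->
  solves z v K c x u -> solves z' v K c' y w ->
  (z - z') * pairing n x u y w + c * w v K - c' * u v K
  = \sum_s wronsk (fb s) (u s) (w s) n.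
Proof.
move=> Kn [gu xu hu] [gw yw hw]; rewrite -(state_green n gu gw).
rewrite /pairing mulrDr !mulr_sumr -addrA -addrA; congr (_ + _).
  by apply: eq_bigr => i _; rewrite xu yw; ring.
rewrite -(sum_source v c w Kn) -(sum_source v c' u Kn) addrA -big_split -sumrB.
apply: eq_bigr => s _; rewrite mulr_sumr -big_split -sumrB.
by apply: eq_bigr => k _; rewrite /= hu hw; ring.
Qed.

Lemma solves_conj z v K c x u : solves z v K c x u ->
  solves (cj z) v K (cj c) (fun i => cj (x i)) (fun s k => cj (u s k)).
Proof.
move=> [gu xu hu]; split=> [s|i|s k]; first by rewrite gu.
- rewrite -conjM -xu /coreop conjB !conj_sum.
  by congr (_ - _); apply: eq_bigr => j _; rewrite conjM conjR.
- have -> : source v K (cj c) s k.+1 = cj (source v K c s k.+1).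
    by rewrite /source; case: ifP; rewrite ?conjc0.
  by rewrite -conjM -conjD -hu /jacobi conjB conjD !conjM conjN !conjR.
Qed.

Lemma pairing_conj n x u :
  pairing n x u (fun i => cj (x i)) (fun s k => cj (u s k)) = (mass n x u)%:C.
Proof.
rewrite /pairing /mass RCD !RC_sum; congr (_ + _).
  by apply: eq_bigr => i _; rewrite mul_conj.
apply: eq_bigr => s _; rewrite RC_sum; apply: eq_bigr => k _.
by rewrite mul_conj.
Qed.

Lemma mass_ge0 n x u : 0 <= mass n x u.
Proof.
rewrite /mass addr_ge0 //; first by apply: sumr_ge0 => i _; rewrite sqr_ge0.
by apply: sumr_ge0 => s _; apply: sumr_ge0 => k _; rewrite sqr_ge0.
Qed.

Lemma mass_mono n m x u : (n <= m)%N -> mass n x u <= mass m x u.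
Proof.
move=> /subnK <-; elim: (m - n)%N => // k IH; apply: le_trans IH _.
rewrite addSn /mass lerD2l; apply: ler_sum => s _.
by rewrite big_ord_recr lerDl sqr_ge0.
Qed.

Lemma core_le_mass n x u i : nrm (x i) ^+ 2 <= mass n x u.
Proof.
rewrite /mass (bigD1 i) //= -addrA lerDl addr_ge0 //.
  by apply: sumr_ge0 => j _; rewrite sqr_ge0.
by apply: sumr_ge0 => s _; apply: sumr_ge0 => k _; rewrite sqr_ge0.
Qed.

Lemma chan_le_mass n x u s k : (k < n)%N -> nrm (u s k.+1) ^+ 2 <= mass n x u.
Proof.
move=> kn; rewrite /mass (bigD1 s) //= (bigD1 (Ordinal kn)) //=.
apply: ler_wpDl; first by apply: sumr_ge0 => j _; rewrite sqr_ge0.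
rewrite -addrA lerDl addr_ge0 //; first by apply: sumr_ge0 => j _; rewrite sqr_ge0.
by apply: sumr_ge0 => j _; apply: sumr_ge0 => m _; rewrite sqr_ge0.
Qed.

Hypothesis fb_cvg : forall s : 'I_(nch S), exists b : R, fb s k @[k --> \oo] --> b.

Lemma sum_wronsk_cvg0 u w : (forall s, u s k @[k --> \oo] --> (0 : R[i])) ->
  (forall s, exists M, \forall k \near \oo, nrm (w s k) <= M) ->
  \sum_s wronsk (fb s) (u s) (w s) n @[n --> \oo] --> (0 : R[i]).
Proof.
move=> u0 wM.
have h : \sum_s wronsk (fb s) (u s) (w s) n @[n --> \oo]
    --> \sum_(s < nch S) (0 : R[i]).
  apply: (cvgC_sum (F := \oo)) => s _; have [b hb] := fb_cvg s.
  by have [M hM] := wM s; exact: (wronsk_cvg0 hb (u0 s) hM).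
by rewrite big1_eq in h.
Qed.

Lemma cvg0_bounded (f : nat -> R[i]) : f k @[k --> \oo] --> (0 : R[i]) ->
  exists M, \forall k \near \oo, nrm (f k) <= M.
Proof. by move=> /cvgC_bound[M _ h]; exists M. Qed.

(** Green's identity for a solution and its conjugate. It is the resolvent estimate
    [||(L - z)^-1 f|| <= ||f|| / |Im z|] in the form that suits a point source. *)
Lemma energy_bound z v K c x u n : (0 < K)%N -> solves z v K c x u ->
  (forall s, u s k @[k --> \oo] --> (0 : R[i])) ->
  mass n x u * `|Im z| <= nrm c * nrm (u v K).
Proof.
move=> K0 hu u0; have hc := solves_conj hu.
have u0c s : exists M, \forall k \near \oo, nrm (cj (u s k)) <= M.
  by have [M hM] := cvg0_bounded (u0 s); exists M; apply: filterS hM => k; rewrite nrmJ.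
pose W m := \sum_s wronsk (fb s) (u s) (fun k => cj (u s k)) m.
have w0 : W m @[m --> \oo] --> (0 : R[i]) := sum_wronsk_cvg0 u0 u0c.
have key m : (maxn n K <= m)%N ->
    2 * (mass n x u * `|Im z|) <= 2 * (nrm c * nrm (u v K)) + nrm (W m).
  rewrite geq_max => /andP[nm Km].
  have := solves_green (n := m) _ hu hc; rewrite K0 Km => /(_ isT).
  rewrite pairing_conj sub_conj -/(W m) => E.
  have {}E : (2 * Im z)%:C * 'i%C * (mass m x u)%:C =
     W m + (cj c * u v K - c * cj (u v K)) by rewrite -E; ring.
  have := congr1 (@ComplexField.Normc.normc R) E.
  rewrite !nrmM !nrmR.
  have -> : nrm ('i%C : R[i]) = 1 by rewrite /= expr0n expr1n add0r sqrtr1.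
  rewrite mulr1 (ger0_norm (mass_ge0 _ _ _)) normrM (ger0_norm (_ : 0 <= 2)) // => E'.
  have h1 := nrmD (W m) (cj c * u v K - c * cj (u v K)).
  have h2 := nrmB (cj c * u v K) (c * cj (u v K)).
  rewrite !nrmM !nrmJ in h2.
  have := ler_wpM2r (normr_ge0 (Im z)) (mass_mono x u nm).
  lra.
pose proof (cvg_nrm w0) as w1; rewrite nrm0 in w1.
have w2 : 2 * (nrm c * nrm (u v K)) + nrm (W m) @[m --> \oo]
    --> 2 * (nrm c * nrm (u v K)) + 0 by apply: cvgD w1; exact: cvg_cst.
rewrite addr0 in w2.
have : 2 * (mass n x u * `|Im z|) <= 2 * (nrm c * nrm (u v K)).
  by apply: (cvgr_to_ge w2); exists (maxn n K).
lra.
Qed.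

(** In Green's identity for a solution and an eigenvector the boundary terms tend
    to [0], and only the source is left. *)
Lemma pairing_eigen z (z0 : R) v K c x u y w : (0 < K)%N -> z != z0%:C ->
  solves z v K c x u -> solves z0%:C v K 0 y w ->
  (forall s, u s k @[k --> \oo] --> (0 : R[i])) ->
  (forall s, exists M, \forall k \near \oo, nrm (w s k) <= M) ->
  pairing n x u (fun i => cj (y i)) (fun s k => cj (w s k)) @[n --> \oo]
    --> c * cj (w v K) / (z0%:C - z).
Proof.
move=> K0 zz hu hw u0 wM; have hc := solves_conj hw; rewrite conjR conjc0 in hc.
have wMc s : exists M, \forall k \near \oo, nrm (cj (w s k)) <= M.
  by have [M hM] := wM s; exists M; apply: filterS hM => k; rewrite nrmJ.
have w0 := sum_wronsk_cvg0 u0 wMc.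
have zz' : z - z0%:C != 0 by rewrite subr_eq0.
pose proof (cvgCM (cvgCB w0 (cvgC_cst (c * cj (w v K)))) (cvgC_cst (z - z0%:C)^-1)) as h.
have -> : c * cj (w v K) / (z0%:C - z) = (0 - c * cj (w v K)) * (z - z0%:C)^-1.
  by rewrite sub0r -(opprB z) invrN mulrN mulNr.
apply: (cvgC_ext h); exists K => // n Kn.
have := solves_green (n := n) _ hu hc; rewrite K0 (Kn : (K <= n)%N) => /(_ isT) <-.
by rewrite mul0r subr0 addrK mulrAC mulfV // mul1r.
Qed.

Lemma massS n x u : mass n.+1 x u = mass n x u + \sum_s nrm (u s n.+1) ^+ 2.
Proof.
rewrite /mass -addrA; congr (_ + _); rewrite -big_split; apply: eq_bigr => s _.
by rewrite big_ord_recr.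
Qed.

Lemma pairingS n x u y w :
  pairing n.+1 x u y w = pairing n x u y w + \sum_s u s n.+1 * w s n.+1.
Proof.
rewrite /pairing -addrA; congr (_ + _); rewrite -big_split; apply: eq_bigr => s _.
by rewrite big_ord_recr.
Qed.

(** Young's inequality with a weight: the tail of the pairing is uniformly small
    over bounded [x, u], because the tail of [y, w] becomes small. *)
Lemma pairing_tail n j (eta : R) x u y w : 0 < eta ->
  nrm (pairing (j + n) x u (fun i => cj (y i)) (fun s k => cj (w s k))
       - pairing n x u (fun i => cj (y i)) (fun s k => cj (w s k)))
  <= eta * (mass (j + n) x u - mass n x u)
     + eta^-1 * (mass (j + n) y w - mass n y w).
Proof.
move=> e0; elim: j => [|j IH]; first by rewrite add0n !subrr !mulr0 addr0 nrm0.
rewrite addSn pairingS !massS addrAC.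
apply: le_trans (nrmD _ _) _.
set P := nrm (_ - _) in IH *; set X := \sum_s nrm (u s _) ^+ 2.
set Y := \sum_s nrm (w s _) ^+ 2.
suff h : nrm (\sum_s u s (j + n).+1 * cj (w s (j + n).+1)) <= eta * X + eta^-1 * Y by lra.
apply: le_trans (nrm_sum _ _ _) _; rewrite /X /Y !mulr_sumr -big_split.
apply: ler_sum => s _; rewrite nrmM nrmJ /=.
move: (nrm (u s _)) (nrm (w s _)) (nrm_ge0 (u s (j + n).+1)) (nrm_ge0 (w s (j + n).+1)) => p q p0 q0.
have sq : 0 <= (eta * p - q) ^+ 2 / eta by rewrite divr_ge0 ?sqr_ge0 // ltW.
have pq : 0 <= p * q by rewrite mulr_ge0.
have E : (eta * p - q) ^+ 2 / eta = eta * p ^+ 2 + eta^-1 * q ^+ 2 - 2 * (p * q).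
  by field; rewrite gt_eqF.
by rewrite E in sq; lra.
Qed.

Lemma mass_cvg (T : Type) (F : set_system T) {FF : ProperFilter F} n
  (xm : T -> 'I_(ncore S) -> R[i]) (um : T -> 'I_(nch S) -> nat -> R[i]) y w :
  (forall i, xm m i @[m --> F] --> y i) ->
  (forall s k, um m s k.+1 @[m --> F] --> w s k.+1) ->
  mass n (xm m) (um m) @[m --> F] --> mass n y w.
Proof.
move=> xy uw.
have sqC (f : T -> R[i]) l : f m @[m --> F] --> l ->
    (nrm (f m) ^+ 2)%:C @[m --> F] --> (nrm l ^+ 2)%:C.
  move=> h; rewrite -mul_conj; apply: (cvgC_ext (cvgCM h (cvgC_conj h))).
  by apply: nearW => m; rewrite mul_conj.
suff h : (mass n (xm m) (um m))%:C @[m --> F] --> (mass n y w)%:C.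
  exact: (cvg_Re h).
rewrite /mass RCD !RC_sum.
apply: (cvgC_ext (f := fun m => \sum_i (nrm (xm m i) ^+ 2)%:C
   + \sum_s \sum_(k < n) (nrm (um m s k.+1) ^+ 2)%:C)); last first.
  apply: nearW => m; rewrite RCD !RC_sum; congr (_ + _).
  by apply: eq_bigr => s _; rewrite RC_sum.
apply: cvgCD; first by apply: cvgC_sum => i _; exact: sqC.
apply: cvgC_sum => s _; rewrite RC_sum; apply: cvgC_sum => k _; exact: sqC.
Qed.

Lemma pairing_cvg (T : Type) (F : set_system T) {FF : ProperFilter F} n
  (xm : T -> 'I_(ncore S) -> R[i]) (um : T -> 'I_(nch S) -> nat -> R[i]) y w y' w' :
  (forall i, xm m i @[m --> F] --> y i) ->
  (forall s k, um m s k.+1 @[m --> F] --> w s k.+1) ->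
  pairing n (xm m) (um m) y' w' @[m --> F] --> pairing n y w y' w'.
Proof.
move=> xy uw; apply: cvgCD.
  by apply: cvgC_sum => i _; apply: cvgCM (xy i) (cvgC_cst _).
by apply: cvgC_sum => s _; apply: cvgC_sum => k _; apply: cvgCM (uw s k) (cvgC_cst _).
Qed.

(** A bounded family that converges pointwise converges weakly; paired with its own
    limit, it gives the squared norm of the limit. *)
Lemma weak_limit_mass (T : Type) (G : set_system T) {PG : ProperFilter G}
  (xm : T -> 'I_(ncore S) -> R[i]) (um : T -> 'I_(nch S) -> nat -> R[i])
  y w M sg (l : R[i]) :
  (\forall m \near G, forall n, mass n (xm m) (um m) <= M) ->
  (forall i, xm m i @[m --> G] --> y i) ->
  (forall s k, um m s k.+1 @[m --> G] --> w s k.+1) ->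
  (\forall m \near G,
     pairing n (xm m) (um m) (fun i => cj (y i)) (fun s k => cj (w s k))
     @[n --> \oo] --> sg m) ->
  sg m @[m --> G] --> l ->
  (mass n y w)%:C @[n --> \oo] --> l.
Proof.
move=> hM xy uw hsg sgl.
pose P m n := pairing n (xm m) (um m) (fun i => cj (y i)) (fun s k => cj (w s k)).
have yM n : mass n y w <= M.
  by apply: (cvgr_to_le (mass_cvg (n := n) xy uw)); apply: filterS hM.
have M0 : 0 <= M by apply: le_trans (yM 0%N); exact: mass_ge0.
have [L hL] : exists L : R, mass n y w @[n --> \oo] --> L.
  have : cvgn (fun n => mass n y w).
    apply: nondecreasing_is_cvgn; first by move=> n m nm; exact: mass_mono.
    by exists M => _ [n _ <-]; exact: yM.
  by move=> h; exists (lim (mass n y w @[n --> \oo])).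
have leL n : mass n y w <= L.
  by apply: (cvgr_to_ge hL); exists n => // m /= nm; exact: mass_mono.
suff E : l = L%:C by rewrite E; exact: cvgC_real.
have bound (eta : R) n : 0 < eta ->
    nrm (l - (mass n y w)%:C) <= eta * M + eta^-1 * (L - mass n y w).
  move=> e0; set B := (X in _ <= X).
  have h1 : \forall m \near G, nrm (sg m - P m n) <= B.
    apply: filterS2 hM hsg => m hMm hsgm.
    pose proof (cvg_nrm (cvgCB hsgm (cvgC_cst (P m n)))) as h.
    apply: (cvgr_to_le h); exists n => // j nj.
    have := pairing_tail n (j - n) (xm m) (um m) y w e0; rewrite subnK //.
    move=> hh; apply: le_trans hh _; rewrite /B lerD //.
      rewrite ler_pM2l // lerBlDr; apply: le_trans (hMm j) _.
      by rewrite lerDl mass_ge0.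
    by rewrite ler_pM2l ?invr_gt0 // lerD2r.
  pose proof (pairing_cvg (n := n) (y' := fun i => cj (y i)) (w' := fun s k => cj (w s k)) xy uw) as pc.
  rewrite pairing_conj in pc.
  pose proof (cvg_nrm (cvgCB sgl pc)) as h2.
  exact: (cvgr_to_le h2 h1).
have bound2 (eta : R) : 0 < eta -> nrm (l - L%:C) <= eta * M.
  move=> e0.
  pose proof (cvg_nrm (cvgCB (cvgC_cst (F := \oo) l) (cvgC_real hL))) as h1.
  have h2 : eta * M + eta^-1 * (L - mass n y w) - nrm (l - (mass n y w)%:C) @[n --> \oo]
      --> eta * M + eta^-1 * (L - L) - nrm (l - L%:C).
    apply: cvgB h1; apply: cvgD; first exact: cvg_cst.
    by apply: cvgM; [exact: cvg_cst|apply: cvgB hL; exact: cvg_cst].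
  have : 0 <= eta * M + eta^-1 * (L - L) - nrm (l - L%:C).
    by apply: (cvgr_to_ge h2); exists 0%N => // n _; rewrite subr_ge0; exact: bound.
  by rewrite subrr mulr0 addr0 subr_ge0.
apply/eqP; rewrite -subr_eq0 -nrm_eq0 eq_le nrm_ge0 andbT.
rewrite leNgt; apply/negP => h0.
pose eta := nrm (l - L%:C) / (2 * (M + 1)).
have M1 : 0 < M + 1 by rewrite ltr_wpDl.
have e0 : 0 < eta by rewrite divr_gt0 // mulr_gt0.
have := bound2 _ e0; rewrite leNgt => /negP; apply.
rewrite /eta mulrAC ltr_pdivrMr ?mulr_gt0 // ltr_pM2l //; lra.
Qed.

End States.

(** * Resolvents of real symmetric matrices *)

Lemma conjmx_subscalar (F : fieldType) n (P D : 'M[F]_n) z : P \in unitmx ->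
  invmx P *m (D - z%:M) *m P = invmx P *m D *m P - z%:M.
Proof.
by move=> Pu; rewrite mulmxBr mulmxBl scalar_mxC -(mulmxA _ (invmx P)) mulVmx // mulmx1.
Qed.

Lemma conjmx_inv (F : fieldType) n (P D D' : 'M[F]_n) : P \in unitmx ->
  D' *m D = 1%:M -> (invmx P *m D' *m P) *m (invmx P *m D *m P) = 1%:M.
Proof.
move=> Pu DD; rewrite -!mulmxA (mulmxA P) mulmxV // mul1mx (mulmxA D') DD mul1mx.
by rewrite mulVmx.
Qed.

Section MatrixFacts.
Variable R : realType.

Lemma nonunit_kernel n (M : 'M[R[i]]_n) : M \notin unitmx ->
  exists2 g : 'cV[R[i]]_n, g != 0 & M *m g = 0.
Proof.
rewrite -unitmx_tr -row_free_unit -kermx_eq0 => /rowV0Pn[v].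
move=> /sub_kermxP vM v0; exists v^T; first by rewrite -(inj_eq trmx_inj) trmxK trmx0.
by apply: trmx_inj; rewrite trmx_mul trmxK vM trmx0.
Qed.

Lemma invmx_diag n (d : 'I_n -> R[i]) : (forall i, d i != 0) ->
  (diag_mx (\row_i d i) \in unitmx) /\
  invmx (diag_mx (\row_i d i)) = diag_mx (\row_i (d i)^-1).
Proof.
move=> d0; have E : diag_mx (\row_i (d i)^-1) *m diag_mx (\row_i d i) = 1%:M.
  apply/matrixP => i j; rewrite mul_diag_mx !mxE.
  by case: eqP => [->|_]; rewrite ?mulr1n ?mulr0n ?mulr0 // mulVf.
have [_ u] := mulmx1_unit E; split=> //.
by rewrite -[RHS]mulmx1 -(mulmxV u) mulmxA E mul1mx.
Qed.

(** The spectral theorem, as a partial fraction expansion of the resolvent of a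
    real symmetric matrix. *)
Lemma resolvent_expansion n (M : 'M[R[i]]_n) :
  (forall i j, M i j = M j i) -> (forall i j, Im (M i j) = 0) ->
  exists (d : 'I_n -> R) (P : 'M[R[i]]_n), forall z, (forall j, z != (d j)%:C) ->
    (M - z%:M \in unitmx) /\
    forall i k, invmx (M - z%:M) i k = \sum_j cj (P j i) * P j k / ((d j)%:C - z).
Proof.
move=> Msym Mreal.
have herm : M \is hermsymmx.
  apply/is_hermitianmxP; rewrite expr0 scale1r; apply/matrixP => i j; rewrite !mxE.
  have h := Mreal j i; rewrite Msym; move: (M j i) h => m h.
  by rewrite (realE h); exact/esym/conjR.
have dreal := hermitian_spectral_diag_real herm.
have /orthomx_spectralP ME := hermitian_normalmx herm.
set P := spectralmx M in ME *; set D := spectral_diag M in ME dreal *.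
have Pu : P \is unitarymx := spectral_unitarymx M.
have Punit : P \in unitmx := unitarymx_unit Pu.
exists (fun j => Re (D 0 j)), P => z hz.
have DE j : D 0 j = (Re (D 0 j))%:C.
  by rewrite RRe_real //; apply: (mxOverP dreal).
have d0 j : D 0 j - z != 0 by rewrite subr_eq0 eq_sym DE.
have [du dV] := invmx_diag d0.
have zE : M - z%:M = invmx P *m diag_mx (\row_j (D 0 j - z)) *m P.
  have -> : diag_mx (\row_j (D 0 j - z)) = diag_mx D - z%:M.
    by apply/matrixP => i j; rewrite !mxE; case: eqP => _; rewrite ?mulr1n ?mulr0n ?subrr // oppr0.
  by rewrite conjmx_subscalar // -ME.
have E : (invmx P *m diag_mx (\row_j (D 0 j - z)^-1) *m P) *m (M - z%:M) = 1%:M.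
  by rewrite zE; apply: conjmx_inv => //; rewrite -dV mulVmx.
have [_ u] := mulmx1_unit E; split=> // i k.
have -> : invmx (M - z%:M) = invmx P *m diag_mx (\row_j (D 0 j - z)^-1) *m P.
  by rewrite -[RHS]mulmx1 -(mulmxV u) mulmxA E mul1mx.
rewrite mxE; apply: eq_bigr => j _; rewrite mul_mx_diag !mxE invmx_unitary // !mxE -DE.
by rewrite mulrAC.
Qed.

(** [Y^* Y v] determines [Y v] linearly, since both matrices have the same
    kernel. *)
Lemma gram_factor m n (Y : 'M[R[i]]_(m, n)) :
  exists D : 'M[R[i]]_(m, n), Y = D *m ((map_mx cj Y)^T *m Y).
Proof.
apply/submxP; rewrite submxE; set B := _ *m Y; set C := cokermx B.
have BC : B *m C = 0 by rewrite /C mulmx_coker.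
apply/eqP/matrixP => i k; rewrite [RHS]mxE; set Z := Y *m C.
have : ((map_mx cj Z)^T *m Z) k k = 0.
  have -> : (map_mx cj Z)^T = (map_mx cj C)^T *m (map_mx cj Y)^T.
    by rewrite -trmx_mul -map_mxM.
  by rewrite -mulmxA (mulmxA _ Y) -/B BC mulmx0 mxE.
rewrite mxE => /eqP.
rewrite (eq_bigr (fun j => (nrm (Z j k) ^+ 2)%:C)); last first.
  by move=> j _; rewrite !mxE mulrC mul_conj.
rewrite -RC_sum RC_eq0 psumr_eq0; last by move=> j _; rewrite sqr_ge0.
by move=> /allP/(_ i); rewrite mem_index_enum sqrf_eq0 nrm_eq0 => /(_ isT) /eqP.
Qed.

End MatrixFacts.

(** * Vectors on the particles from core and channel values *)

Section Glue.
Variables (R : realType) (A : countType) (S : system R A).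
Hypothesis hS : admissible S.
Variable iota : 'I_(nch S) -> 'I_(ncore S).
Hypothesis iotaP : forall s, core (iota s) = chan s 0.
Implicit Types (i : 'I_(ncore S)) (s : 'I_(nch S)) (x : 'I_(ncore S) -> R[i]) (u : 'I_(nch S) -> nat -> R[i]).

Lemma chan_prev_neq0 s k : L S (chan s k.+1) (chan s k) != 0.
Proof. by rewrite (L_sym hS) -oppr_eq0 gt_eqF // fb_gt0. Qed.

Lemma chan_not_core s k : ~ A1 S (chan s k.+1).
Proof. by apply; exists s, k. Qed.

(** The site before [chan s k] interacts with it, so it is a neighbour of
    [chan s' k']. Thus a coincidence yields one with a smaller [k], and finally one
    at an attachment point. *)
Lemma chan_inj s k s' k' : chan s k = chan s' k' :> A -> s = s' /\ k = k'.
Proof.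
elim/ltn_ind: k s s' k' => k IH s s' k'.
have h0 (v v' : 'I_(nch S)) j : chan v 0 = chan v' j :> A -> v = v' /\ 0%N = j.
  case: j => [/(attach_inj hS)->//|j E].
  by case: (@chan_not_core v' j); rewrite -E; exact: attach_core.
case: k IH => [_|k IH]; first exact: h0.
case: k' => [/esym/h0[-> //]|k' E].
have [nb _ _] := chanP hS s'.
have := chan_prev_neq0 s k; rewrite E => /nb[]; move=> /(IH k (ltnSn k)) [ss kk].
- by rewrite kk.
- by subst s' k; have [_ e] := IH k'.+1 (ltnSn _) _ _ _ (esym E); move: e; lia.
- subst s' k; have [_ e] := IH k'.+1 (ltnW (ltnSn _)) _ _ _ (esym E).
  by move: e; lia.
Qed.

Definition glue x u (a : A) : R[i] :=
  if [pick i | core i == a] is Some i then x i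
  else if pselect (exists p : 'I_(nch S) * nat, a = chan p.1 p.2.+1) is left h
  then u (projT1 (cid h)).1 (projT1 (cid h)).2.+1 else 0.

Lemma glue_core x u i : glue x u (core i) = x i.
Proof.
rewrite /glue; case: pickP => [j /eqP/(core_inj hS) ->//|/(_ i)].
by rewrite eqxx.
Qed.

Lemma core_A1 i : A1 S (core i).
Proof. by rewrite -(core_range hS); exists i. Qed.

Lemma glue_chan x u s k : glue x u (chan s k.+1) = u s k.+1.
Proof.
rewrite /glue; case: pickP => [j /eqP E|_].
  by case: (@chan_not_core s k); rewrite -E; exact: core_A1.
case: pselect => [h|[]]; last by exists (s, k).
by case: (cid h) => -[s' k'] /= /chan_inj[-> [->]].
Qed.

Lemma glue_attach x u s k : glued iota x u -> glue x u (chan s k) = u s k.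
Proof.
by case: k => [|k] h; [rewrite -iotaP glue_core h|rewrite glue_chan].
Qed.

Lemma site_cases a : (exists i : 'I_(ncore S), a = core i) \/ exists (s : 'I_(nch S)) k, a = chan s k.+1.
Proof.
have [h|h] := pselect (A0 S a); first by right; have [s [k E]] := h; exists s, k.
left; have : A1 S a by [].
by rewrite -(core_range hS) => -[i _ <-]; exists i.
Qed.

Lemma fsum_seq (r : seq A) (f : A -> R[i]) : uniq r ->
  (forall a, a \notin r -> f a = 0) -> \sum_(a \in [set: A]) f a = \sum_(a <- r) f a.
Proof.
move=> ur fr; rewrite [RHS]fsbig_seq //; apply: esym; refine (fsbig_widen [set` r] [set: A] f _ _) => // a [_ /= /negP ar].
exact: fr.
Qed.

Lemma core_chan_uniq (T : finType) (f : T -> 'I_(nch S) * nat) : injective f ->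
  uniq ([seq core i | i <- enum 'I_(ncore S)] ++
        [seq chan (f t).1 (f t).2.+1 | t <- enum T] : seq A).
Proof.
move=> fi; rewrite cat_uniq (map_inj_uniq (core_inj hS)) enum_uniq /=.
apply/andP; split.
  apply/hasPn => _ /mapP[t _ ->]; apply/mapP => -[i _ E].
  by case: (@chan_not_core (f t).1 (f t).2); rewrite E; exact: core_A1.
rewrite map_inj_uniq ?enum_uniq // => t t' /chan_inj[E1 [E2]]; apply: fi.
by move: E1 E2; case: (f t) => a b; case: (f t') => a' b' /= -> ->.
Qed.

Lemma big_core_chan (V : zmodType) (T : finType) (f : T -> 'I_(nch S) * nat) (F : A -> V) :
  \sum_(a <- [seq core i | i <- enum 'I_(ncore S)] ++
        [seq chan (f t).1 (f t).2.+1 | t <- enum T]) F a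
  = \sum_(i < ncore S) F (core i) + \sum_t F (chan (f t).1 (f t).2.+1).
Proof. by rewrite big_cat; congr (_ + _); rewrite big_map big_enum. Qed.

Lemma mx_apply_core x u i : mx_apply (L S) (glue x u) (core i) = coreop iota x u i.
Proof.
have inj : injective (fun s : 'I_(nch S) => (s, 0%N)) by move=> s s' [].
rewrite /mx_apply (fsum_seq (core_chan_uniq inj)).
  rewrite big_core_chan /coreop /= -sumrN; congr (_ + _).
    by apply: eq_bigr => j _; rewrite glue_core.
  rewrite [RHS]big_mkcond; apply: eq_bigr => s _; rewrite glue_chan.
  case: eqP => [<-|si]; first by rewrite iotaP /fb raddfN mulNr opprK.
  suff /eqP -> : L S (core i) (chan s 1) == 0 by rewrite mul0r.
  have [nb _ _] := chanP hS s; rewrite (L_sym hS); apply: contrapT => /negP/nb[] E.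
  - by apply: si; apply: (core_inj hS); rewrite E iotaP.
  - by case: (@chan_not_core s 0); rewrite -E; exact: core_A1.
  - by case: (@chan_not_core s 1); rewrite -E; exact: core_A1.
move=> a ar; suff /eqP -> : L S (core i) a == 0 by rewrite mul0r.
apply: contrapT => /negP La; move/negP : ar; apply; rewrite mem_cat.
case: (site_cases a) La => [[j ->] _|[s [k ->]]].
  by rewrite map_f // mem_enum.
have [nb _ _] := chanP hS s; rewrite (L_sym hS) => /nb[] E.
- case: k E => [E|k E]; last by case: (@chan_not_core s k); rewrite -E; exact: core_A1.
  by apply/orP; right; apply/mapP; exists s; rewrite ?mem_enum.
- by case: (@chan_not_core s k); rewrite -E; exact: core_A1.
- by case: (@chan_not_core s k.+1); rewrite -E; exact: core_A1.
Qed.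

Lemma mx_apply_chan x u s k : glued iota x u ->
  mx_apply (L S) (glue x u) (chan s k.+1) = jacobi (fb s) (fa s) (u s) k.
Proof.
move=> gl; rewrite /mx_apply.
rewrite (fsum_seq (r := [:: chan s k; chan s k.+1; chan s k.+2])).
- rewrite !big_cons big_nil !(glue_attach _ _ gl) /jacobi (L_sym hS _ (chan s k)).
  by rewrite addr0 addrA /fb /fa !raddfN !opprK mulNr opprK.
- rewrite /= !inE !andbT negb_or -!andbA; apply/and3P.
  by split; apply/eqP => /chan_inj[_]; lia.
- move=> a; rewrite !inE !negb_or => /and3P[/eqP n1 /eqP n2 /eqP n3].
  suff /eqP -> : L S (chan s k.+1) a == 0 by rewrite mul0r.
  by have [nb _ _] := chanP hS s; apply: contrapT => /negP/nb[].
Qed.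

(** Every finite set of particles lies in the core and finitely many channel
    sites, so the squared norm is the supremum of the truncated ones. *)
Lemma normsq_glue x u l : mass n x u @[n --> \oo] --> l ->
  normsq (glue x u) = l%:E.
Proof.
move=> ml.
pose m a : R := Re (glue x u a) ^+ 2 + Im (glue x u a) ^+ 2.
have mE a : m a = nrm (glue x u a) ^+ 2 by rewrite /m; case: (glue x u a) => p q /=; rewrite sqr_sqrtr // addr_ge0 ?sqr_ge0.
have m0 a : 0 <= m a by rewrite mE sqr_ge0.
pose r n : seq A := [seq core i | i <- enum 'I_(ncore S)] ++
   [seq chan t.1 (val t.2).+1 | t <- enum {: 'I_(nch S) * 'I_n}].
have ur n : uniq (r n).
  have inj : injective (fun t : 'I_(nch S) * 'I_n => (t.1, val t.2)).
    by case=> [s k] [s' k'] [-> /val_inj ->].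
  exact: core_chan_uniq inj.
have rm n : \sum_(a <- r n) m a = mass n x u.
  rewrite (big_core_chan (fun t : 'I_(nch S) * 'I_n => (t.1, val t.2))) /mass.
  congr (_ + _).
    by apply: eq_bigr => i _; rewrite mE glue_core.
  rewrite pair_big; apply: eq_bigr => -[s k] _ /=.
  by rewrite mE glue_chan.
have mono n n' : (n <= n')%N -> {subset r n <= r n'}.
  move=> nn a; rewrite !mem_cat => /orP[->//|/mapP[[s k] _ ->]].
  by apply/orP; right; apply/mapP; exists (s, widen_ord nn k); rewrite ?mem_enum.
have cover a : exists n, a \in r n.
  case: (site_cases a) => [[i ->]|[s [k ->]]].
    by exists 0%N; rewrite mem_cat map_f // mem_enum.
  exists k.+1; rewrite mem_cat; apply/orP; right; apply/mapP.
  by exists (s, ord_max); rewrite ?mem_enum.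
have coverX (X : seq A) : exists n, {subset X <= r n}.
  elim: X => [|a X [n hn]]; first by exists 0%N.
  have [n' hn'] := cover a; exists (maxn n n') => b.
  rewrite inE => /orP[/eqP ->|/hn]; first exact: (mono _ _ (leq_maxr _ _)).
  exact: (mono _ _ (leq_maxl _ _)).
have ml_le n : mass n x u <= l.
  by apply: (cvgr_to_ge ml); exists n => // n' /= nn; exact: mass_mono.
have up : (normsq (glue x u) <= l%:E)%E.
  apply: ge_ereal_sup => _ [X [fX _] <-].
  have [n hn] := coverX (finmap.enum_fset (fset_set X)).
  apply: (@le_trans _ _ (mass n x u)%:E); last by rewrite lee_fin.
  rewrite -rm -sumEFin [leRHS]fsbig_seq //.
  apply: lee_fsum_nneg_subset => //.
  - by move=> a; rewrite inE => aX; rewrite inE /=; apply: hn; rewrite in_fset_set // inE.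
  - by move=> a _; rewrite lee_fin; exact: m0.
have low n : ((mass n x u)%:E <= normsq (glue x u))%E.
  rewrite -rm -sumEFin fsbig_seq //; apply: esum_ge; exists [set` r n]; first by split; [exact: finite_seq|exact: subsetT].
  exact: lexx.
have fin : normsq (glue x u) \is a fin_num.
  rewrite ge0_fin_numE; first by apply: le_lt_trans up _; exact: ltry.
  by apply: esum_ge0 => a _; rewrite lee_fin; exact: m0.
apply/eqP; rewrite eq_le up /= -(fineK fin) lee_fin.
apply: (cvgr_to_le ml); apply: nearW => n.
by rewrite -lee_fin fineK.
Qed.

End Glue.

(** * Jost solutions of the system *)

Section Differentiability.
Variable R : realType.

Lemma dnbhsC_ball (z : R[i]) (A : set R[i]) : (z^' A) <->
  exists2 d : R, 0 < d & forall x, x != z -> nrm (x - z) < d -> A x.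
Proof.
rewrite /dnbhs /within /=; split.
  by move=> /nbhsC_ball[d d0 h]; exists d => // x xz xd; exact: h.
by move=> [d d0 h]; apply/nbhsC_ball; exists d => // x xd xz; exact: h.
Qed.

Lemma derivable_quotient (f : R[i] -> R[i]) (t : R[i]) : derivable f t 1 ->
  exists l : R[i], (f z - f t) / (z - t) @[z --> t^'] --> l.
Proof.
move=> fd; exists (lim ((fun h => h^-1 *: ((f \o shift t) (h *: 1) - f t)) @ 0^')).
move/cvgCP : fd => fd; apply/cvgCP => e e0.
have /dnbhsC_ball[d d0 h] := fd _ e0.
apply/dnbhsC_ball; exists d => // z zt zd.
have zt0 : z - t != 0 by rewrite subr_eq0.
have := h (z - t) zt0; rewrite subr0 => /(_ zd) /=.
by rewrite /GRing.scale /= mulr1 subrK mulrC.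
Qed.

Lemma quotient_continuous (f : R[i] -> R[i]) (t l : R[i]) :
  (f z - f t) / (z - t) @[z --> t^'] --> l -> f z @[z --> t] --> f t.
Proof.
move=> fl; have [M M0 /dnbhsC_ball[d d0 h]] := cvgC_bound fl.
apply/(cvgCP (F := nbhs t)) => e e0; apply/nbhsC_ball.
exists (Num.min d (e / M)); first by rewrite lt_min d0 divr_gt0.
move=> z; rewrite lt_min => /andP[zd ze].
have [->|zt] := eqVneq z t; first by rewrite subrr nrm0.
have zt0 : z - t != 0 by rewrite subr_eq0.
have := h z zt zd; rewrite nrmM nrmV => {}h.
rewrite -(mulfVK zt0 (f z - f t)) nrmM nrmM nrmV.
apply: le_lt_trans (_ : M * nrm (z - t) < e); first by rewrite ler_wpM2r ?nrm_ge0.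
by rewrite mulrC -ltr_pdivlMr.
Qed.

End Differentiability.

Section ModelFacts.
Variables (R : realType) (A : countType) (S : system R A).
Hypotheses (hS : admissible S) (htheta : theta_spec S) (hjost : jost_spec S).
Hypothesis hpsol : psol_spec S.
Implicit Types (s v : 'I_(nch S)) (w z t : R[i]) (k : nat).

Lemma decay_data s : exists C r : R, [/\ 0 < r, r < 1,
  forall k, `|fb s k.+1 - cenb s| <= C * r ^+ k &
  forall k, `|fa s k.+1 - cena s| <= C * r ^+ k].
Proof.
have [eps e0 /(_ s) hc] := fast_decay hS.
set f := fun k => _ in hc.
have f0 k : 0 <= f k.
  by rewrite /f mulr_ge0 ?addr_ge0 // exprn_ge0 // addr_ge0 // ltW.
have fM k : f k <= limn (series f).
  apply: le_trans (_ : series f k.+1 <= _).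
    by rewrite seriesSr lerDr; apply: sumr_ge0 => i _; exact: f0.
  apply: nondecreasing_cvgn_le hc _ => n m nm.
  by rewrite -subr_ge0 sub_series_geq //; apply: sumr_ge0 => i _; exact: f0.
have e1 : 0 < 1 + eps by rewrite ltr_wpDl.
pose M := limn (series f); have M0 : 0 <= M := le_trans (f0 0%N) (fM 0%N).
have r1 : (1 + eps)^-1 < 1 by rewrite invf_lt1 // ltrDl.
exists M, (1 + eps)^-1; split=> [||k|k] //; first by rewrite invr_gt0.
  all: have h : `|fa s k.+1 - cena s| + `|fb s k.+1 - cenb s| <= M * (1 + eps)^-1 ^+ k.
  all: try (have : (1 + eps) ^+ k * (`|fa s k.+1 - cena s| + `|fb s k.+1 - cenb s|) <= M;
    [apply: le_trans (fM k); rewrite /f ler_wpM2r ?addr_ge0 // exprS ler_peMl ?exprn_ge0 ?lerDl // ltW //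
    | by rewrite exprVn mulrC -ler_pdivlMr ?exprn_gt0]).
  all: by apply: le_trans h; rewrite ?lerDl ?lerDr.
Qed.

Lemma fb_cvg s : exists b : R, fb s k @[k --> \oo] --> b.
Proof.
have [C [r [r0 r1 hb _]]] := decay_data s.
by exists (cenb s); exact: (offdiag_cvg r0 r1 hb).
Qed.

Local Notation W s := (joukowski (cena s) (cenb s)).

Lemma jost_jacobi s (t : R[i]) : nrm t <= 1 -> t != 0 ->
  forall k, jacobi (fb s) (fa s) (jost s ^~ t) k = W s t * jost s k.+1 t.
Proof. by rewrite -nrm_le1 => t1 t0 k; exact: (jost_eq hjost). Qed.

Lemma jost_asymptotics s (t : R[i]) : nrm t <= 1 -> t != 0 ->
  jost s k t / t ^+ k @[k --> \oo] --> (1 : R[i]).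
Proof. by rewrite -nrm_le1 => t1 t0; exact: (jost_asymp hjost). Qed.

Lemma jost_quotient s k (t : R[i]) : nrm t <= 1 ->
  exists l : R[i], (jost s k z - jost s k t) / (z - t) @[z --> t^'] --> l.
Proof.
rewrite -nrm_le1 => t1; have [V [_ hV hd]] := jost_holo hjost s.
by apply: derivable_quotient; apply: hd; exact: hV.
Qed.

Lemma jost_continuous s k (t : R[i]) : nrm t <= 1 ->
  jost s k z @[z --> t] --> jost s k t.
Proof. by move=> t1; have [l /quotient_continuous] := jost_quotient s k t1. Qed.

Lemma jost_decay s (t : R[i]) : nrm t < 1 -> t != 0 ->
  jost s k t @[k --> \oo] --> (0 : R[i]).
Proof. exact: (jost_cvg0 (@jost_asymptotics s)). Qed.

Lemma jost_bounded s (t : R[i]) : nrm t <= 1 -> t != 0 ->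
  exists M, \forall k \near \oo, nrm (jost s k t) <= M.
Proof. exact: (jost_bound (@jost_asymptotics s)). Qed.

Lemma jost_eventually_neq0 s (t : R[i]) : nrm t <= 1 -> t != 0 ->
  \forall k \near \oo, jost s k t != 0.
Proof. exact: (jost_near_neq0 (@jost_asymptotics s)). Qed.

Lemma jost_neq0_next s (t : R[i]) K : nrm t <= 1 -> t != 0 ->
  jost s K t = 0 -> jost s K.+1 t != 0.
Proof.
exact: (jost_neq0_pair (fb_gt0 hS s) (@jost_jacobi s) (@jost_asymptotics s)).
Qed.

Lemma jost_zero_energy s (t : R[i]) : nrm t < 1 -> t != 0 -> jost s 1 t = 0 ->
  Im (W s t) = 0.
Proof.
have [C [r [r0 r1 hb ha]]] := decay_data s.
exact: (jost1_zero_real_energy r0 r1 (fb_gt0 hS s) hb (@jost_jacobi s) (@jost_asymptotics s)).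
Qed.

Lemma jost_conj_real s (t : R[i]) : nrm t < 1 -> t != 0 -> Im t = 0 ->
  forall k, Im (jost s k t) = 0.
Proof.
have [C [r [r0 r1 hb ha]]] := decay_data s.
exact: (jost_real r0 r1 (fb_gt0 hS s) hb (@jost_jacobi s) (@jost_asymptotics s)).
Qed.

Lemma jost_isolated s (t0 : R[i]) : nrm t0 <= 1 -> t0 != 0 ->
  exists2 d : R, 0 < d & forall t, nrm t < 1 -> t != 0 -> t != t0 ->
    nrm (t - t0) < d -> jost s 1 t != 0.
Proof.
have [C [r [r0 r1 hb ha]]] := decay_data s.
exact: (jost1_isolated (cenb_gt0 hS s) r0 r1 (fb_gt0 hS s) hb ha
  (@jost_jacobi s) (@jost_asymptotics s) (@jost_continuous s)).
Qed.

Lemma jost_simple_zero s (t0 l : R[i]) : nrm t0 <= 1 -> t0 != 0 -> jost s 1 t0 = 0 ->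
  t0 ^+ 2 != 1 -> (jost s 1 t - jost s 1 t0) / (t - t0) @[t --> t0^'] --> l -> l != 0.
Proof.
have [C [r [r0 r1 hb ha]]] := decay_data s.
exact: (jost1_derivative_neq0 (cenb_gt0 hS s) r0 r1 (fb_gt0 hS s) hb ha
  (@jost_jacobi s) (@jost_asymptotics s) (@jost_continuous s)).
Qed.

(** * The matrices T and U away from the poles *)

Lemma theta_disk s w : nrm w < 1 -> w != 0 ->
  [/\ nrm (theta s w) < 1, theta s w != 0 & W s (theta s w) = lam S w].
Proof.
by rewrite -nrm_lt1 => w1 w0; have [h1 h2 h3] := thetaP htheta s w1 w0; rewrite -nrm_lt1.
Qed.

Lemma attach_index : exists iota : 'I_(nch S) -> 'I_(ncore S),
  forall s, core (iota s) = chan s 0.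
Proof.
have h s : exists i : 'I_(ncore S), core i = chan s 0.
  have := @attach_core _ _ _ hS s; rewrite -(core_range hS) => -[i _ iE]; by exists i.
by exists (fun s => projT1 (cid (h s))) => s; exact: projT2 (cid (h s)).
Qed.

Variable iota : 'I_(nch S) -> 'I_(ncore S).
Hypothesis iotaP : forall s, core (iota s) = chan s 0.

Lemma resolvent_core i g z :
  resolvent S (core i) (chan g 0) z = invmx (L1 S - z%:M) i (iota g).
Proof.
rewrite /resolvent (eq_bigl (pred1 i)); last first.
  by move=> j; rewrite /= (inj_eq (core_inj hS)).
rewrite big_pred1_eq (eq_bigl (pred1 (iota g))) ?big_pred1_eq //.
by move=> j; rewrite -iotaP /= (inj_eq (core_inj hS)).
Qed.

Lemma L1_expansion : exists (d : 'I_(ncore S) -> R) (P : 'M[R[i]]_(ncore S)),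
  forall z, (forall j, z != (d j)%:C) -> (L1 S - z%:M \in unitmx) /\
    forall i l, invmx (L1 S - z%:M) i l = \sum_j cj (P j i) * P j l / ((d j)%:C - z).
Proof.
apply: resolvent_expansion => i j; rewrite !mxE //.
by rewrite (L_sym hS).
Qed.

(** The vector [(L1 - z)^-1 (sum_g fb_g(0) f_g delta_g)] on the core. *)
Definition core_vec z (f : 'I_(nch S) -> R[i]) i : R[i] :=
  \sum_g invmx (L1 S - z%:M) i (iota g) * ((fb g 0)%:C * f g).

Lemma core_vecP z (u : 'I_(nch S) -> nat -> R[i]) i : L1 S - z%:M \in unitmx ->
  coreop iota (core_vec z (fun g => u g 1%N)) u i = z * core_vec z (fun g => u g 1%N) i.
Proof.
move=> Mu; set x := core_vec _ _; apply/eqP; rewrite -subr_eq0; apply/eqP.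
have E : \sum_j (L1 S - z%:M) i j * x j = \sum_(s | iota s == i) (fb s 0)%:C * u s 1%N.
  rewrite (eq_bigr (fun j => \sum_g (L1 S - z%:M) i j * invmx (L1 S - z%:M) j (iota g)
     * ((fb g 0)%:C * u g 1%N))); last first.
    move=> j _; rewrite /x /core_vec mulr_sumr; apply: eq_bigr => g _; exact: mulrA.
  rewrite exchange_big /= [RHS]big_mkcond; apply: eq_bigr => g _.
  rewrite -mulr_suml.
  have -> : \sum_j (L1 S - z%:M) i j * invmx (L1 S - z%:M) j (iota g) = (1%:M : 'M[R[i]]_(ncore S)) i (iota g).
    by rewrite -(mulmxV Mu) mxE.
  by rewrite mxE eq_sym; case: eqP => _; rewrite ?mul1r ?mul0r.
rewrite /coreop -E.
have -> : z * x i = \sum_j (z%:M : 'M[R[i]]_(ncore S)) i j * x j.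
  rewrite (bigD1 i) //= !mxE eqxx mulr1n big1 ?addr0 // => j /negbTE ji.
  by rewrite mxE eq_sym ji mulr0n mul0r.
rewrite -!sumrB big1 // => j _; rewrite !mxE; ring.
Qed.

(** The factor [B B(0)^-1 D E(1)^-1] of [U], the amplitude of the incoming wave. *)
Definition incoming v w : R[i] := (cenb v)%:C / (fb v 0)%:C
  * ((theta v w)^-1 - theta v w) / jost v 1 (theta v w).

Definition jost1_nonzero w := forall s, jost s 1 (theta s w) != 0.

(** Locked, so that unification does not unfold the matrix products. *)
Definition Uent := locked (fun k w s v => Umx S k w s v).
Definition tauent := locked (fun w s v => tau S w s v).

Lemma UentP k w s v : Uent k w s v = Umx S k w s v.
Proof. by rewrite /Uent -lock. Qed.

Lemma tauentP w s v : tauent w s v = tau S w s v.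
Proof. by rewrite /tauent -lock. Qed.

Lemma UmxE k w s v : jost1_nonzero w ->
  Uent k w s v = (- (psol s k w *+ (s == v)) + jost s k (theta s w) * tauent w s v)
                 * incoming v w.
Proof.
move=> e0; rewrite UentP tauentP /Umx /Emx (invmx_diag e0).2 /B0mx.
have fb0 v' : (fb v' 0)%:C != 0 :> R[i] by rewrite RC_neq0 // gt_eqF // fb_gt0.
rewrite (invmx_diag fb0).2 /Bmx /Dmx !mul_mx_diag mul_diag_mx !mxE /incoming.
have -> : psol s k w *+ (s == v) = psol v k w *+ (s == v) by case: eqP => [->|].
by rewrite !mulrA.
Qed.

Lemma TmxE w s v : Tmx S w s v = jost s 0 (theta s w) *+ (s == v)
  - invmx (L1 S - (lam S w)%:M) (iota s) (iota v) * ((fb v 0)%:C * jost v 1 (theta v w)).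
Proof.
rewrite /Tmx /Rmx /B0mx /Emx !mul_mx_diag !mxE -iotaP resolvent_core !mulrA.
by congr (_ - _); case: eqP => [->|].
Qed.

Lemma source0 v K s k : source (R := R) v K 0 s k = 0.
Proof. by rewrite /source; case: ifP. Qed.

(** The parameters at which [U] gives solutions of [L u = lam u]. *)
Definition good w := [/\ nrm w < 1, w != 0, L1 S - (lam S w)%:M \in unitmx,
  jost1_nonzero w & Tmx S w \in unitmx].

Lemma L1_unit_nonreal z : Im z != 0 -> L1 S - z%:M \in unitmx.
Proof.
have [d [P h]] := L1_expansion => z0.
by case: (h z) => // j; apply: contra z0 => /eqP ->.
Qed.

Lemma jost1_nonzero_nonreal w : nrm w < 1 -> w != 0 -> Im (lam S w) != 0 ->
  jost1_nonzero w.
Proof.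
move=> w1 w0 Iw s; have [t1 t0 tW] := theta_disk s w1 w0.
by apply: contra Iw => /eqP/(jost_zero_energy t1 t0); rewrite tW => ->.
Qed.

Lemma core_attach_sum z s (f : 'I_(nch S) -> R[i]) :
  core_vec z f (iota s) = \sum_g invmx (L1 S - z%:M) (iota s) (iota g) * ((fb g 0)%:C * f g).
Proof. by []. Qed.

(** A null vector of [T] is the list of channel amplitudes of a decaying solution
    of [L u = lam u]. *)
Lemma Tmx_unit_nonreal w : nrm w < 1 -> w != 0 -> Im (lam S w) != 0 ->
  Tmx S w \in unitmx.
Proof.
move=> w1 w0 Iw; have [//|/nonunit_kernel[g g0 Tg]] := boolP (Tmx S w \in unitmx).
exfalso.
have [v gv] : exists v, g v 0 != 0 by apply/cV0Pn.
pose u s k := jost s k (theta s w) * g s 0.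
pose x := core_vec (lam S w) (fun s => u s 1%N).
have gl : glued iota x u.
  move=> s; have := congr1 (fun m : 'cV[R[i]]_(nch S) => m s 0) Tg; rewrite !mxE.
  under eq_bigr do rewrite TmxE mulrBl.
  rewrite sumrB (bigD1 s) //= eqxx mulr1n big1 ?addr0; last first.
    by move=> j /negbTE js; rewrite eq_sym js mulr0n mul0r.
  move/eqP; rewrite subr_eq0 => /eqP E; rewrite [LHS]E /x core_attach_sum.
  by apply: eq_bigr => j _; rewrite !mulrA.
have sol : solves iota (lam S w) v 1 0 x u.
  split=> // [i|s k]; first by apply: core_vecP; exact: L1_unit_nonreal.
  rewrite source0 addr0; have [t1 t0 tW] := theta_disk s w1 w0.
  rewrite -tW /u mulrA -jost_jacobi 1?ltW // /jacobi; ring.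
have u0 s : u s k @[k --> \oo] --> (0 : R[i]).
  have [t1 t0 _] := theta_disk s w1 w0.
  rewrite -[X in _ --> X](mul0r (g s 0)).
  exact: (cvgCM (jost_decay s t1 t0) (cvgC_cst _)).
have [t1 t0 _] := theta_disk v w1 w0.
have [N _ hN] := jost_eventually_neq0 v (ltW t1) t0.
have := energy_bound hS fb_cvg N.+1 _ sol u0; rewrite nrm0 mul0r => /(_ isT).
rewrite pmulr_lle0 ?normr_gt0 // => m0.
have := le_trans (chan_le_mass x u v (ltnSn N)) m0.
rewrite exprn_even_le0 //= nrm_eq0 mulf_eq0 (negbTE gv) orbF.
by apply/negP; apply: hN; exact: leqnSn.
Qed.

Lemma nonreal_good w : nrm w < 1 -> w != 0 -> Im (lam S w) != 0 -> good w.
Proof.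
by move=> w1 w0 Iw; split=> //; [exact: L1_unit_nonreal|exact: jost1_nonzero_nonreal|
  exact: Tmx_unit_nonreal].
Qed.

Lemma psol_jacobi s w : w != 0 ->
  forall k, jacobi (fb s) (fa s) (psol s ^~ w) k = lam S w * psol s k.+1 w.
Proof. by move=> w0; have [_ _ h] := hpsol s w0. Qed.

Lemma jost_jacobi_lam s w : nrm w < 1 -> w != 0 -> forall k,
  jacobi (fb s) (fa s) (jost s ^~ (theta s w)) k = lam S w * jost s k.+1 (theta s w).
Proof.
move=> w1 w0 k; have [t1 t0 <-] := theta_disk s w1 w0.
by rewrite jost_jacobi // ltW.
Qed.

Lemma Umx_jacobi w s v : nrm w < 1 -> w != 0 -> jost1_nonzero w -> forall k,
  jacobi (fb s) (fa s) (fun j => Uent j w s v) k = lam S w * Uent k.+1 w s v.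
Proof.
move=> w1 w0 e0; apply: (jacobi_comb (fun j => UmxE j s v e0)).
  exact: psol_jacobi.
exact: jost_jacobi_lam.
Qed.

Lemma Umx1E w s v : w != 0 -> jost1_nonzero w ->
  Uent 1 w s v = jost s 1 (theta s w) * tauent w s v * incoming v w.
Proof.
move=> w0 e0; rewrite (UmxE 1 s v e0); have [_ -> _] := hpsol s w0.
by rewrite mul0rn oppr0 add0r.
Qed.

Lemma Umx0E w s v : w != 0 -> jost1_nonzero w ->
  Uent 0 w s v = (- (s == v)%:R + jost s 0 (theta s w) * tauent w s v) * incoming v w.
Proof. by move=> w0 e0; rewrite (UmxE 0 s v e0); have [-> _ _] := hpsol s w0. Qed.

(** [T T^-1 = 1] solved for the term with the resolvent; it says that the core
    vector generated by [U 1] takes the values [U 0] at the attachment points. *)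
Lemma amplitude_identity n (ri T t : 'I_n -> 'I_n -> R[i]) (f e0 e1 : 'I_n -> R[i])
    (s v : 'I_n) (X : R[i]) :
  (forall g, T s g = e0 s *+ (s == g) - ri s g * (f g * e1 g)) ->
  \sum_g T s g * t g v = (s == v)%:R ->
  \sum_g ri s g * (f g * (e1 g * t g v * X)) = (- (s == v)%:R + e0 s * t s v) * X.
Proof.
move=> hT <-.
rewrite (eq_bigr (fun g => (e0 s *+ (s == g) - T s g) * t g v * X)); last first.
  by move=> g _; rewrite hT; ring.
rewrite -mulr_suml; congr (_ * _).
under eq_bigr do rewrite mulrBl.
rewrite sumrB addrC; congr (_ + _).
rewrite (bigD1 s) //= eqxx mulr1n big1 ?addr0 //.
by move=> j /negbTE js; rewrite eq_sym js mulr0n mul0r.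
Qed.

Lemma Umx_core w s v : good w ->
  core_vec (lam S w) (fun g => Uent 1 w g v) (iota s) = Uent 0 w s v.
Proof.
move=> [w1 w0 Lu e0 Tu].
have U1 g := Umx1E g v w0 e0.
have hT : \sum_g Tmx S w s g * tauent w g v = (s == v)%:R.
  have := congr1 (fun m : 'M[R[i]]_(nch S) => m s v) (mulmxV Tu).
  by rewrite !mxE => <-; apply: eq_bigr => g _; rewrite tauentP.
have := amplitude_identity (incoming v w)
  (ri := fun s g => invmx (L1 S - (lam S w)%:M) (iota s) (iota g))
  (e0 := fun s => jost s 0 (theta s w)) (TmxE w s) hT.
by rewrite (Umx0E s v w0 e0) => <-; apply: eq_bigr => g _; rewrite U1.
Qed.

(** The column [v] of [a U], modified on the channel [v] beyond the site [K],
    where the incoming wave is replaced by the decaying solution. *)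
Definition psi_chan K (a : R[i]) w v s k : R[i] :=
  a * (if (s == v) && (K < k)%N
       then jost v k (theta v w) / jost v K (theta v w) * Uent K w v v
       else Uent k w s v).

Definition psi_core K a w v : 'I_(ncore S) -> R[i] :=
  core_vec (lam S w) (fun g => psi_chan K a w v g 1%N).

(** The strength of the point source at the site [K] of the channel [v] which makes
    up for the modification. *)
Definition psi_source K (a : R[i]) w v : R[i] :=
  a * (cenb v)%:C * ((theta v w)^-1 - theta v w) / jost v K (theta v w).

Lemma psi_chan_le K a w v s k : (k <= K)%N -> psi_chan K a w v s k = a * Uent k w s v.
Proof. by move=> kK; rewrite /psi_chan ltnNge kK andbF. Qed.

Lemma psi_chan_neq K a w v s k : s != v -> psi_chan K a w v s k = a * Uent k w s v.
Proof. by move=> /negbTE sv; rewrite /psi_chan sv. Qed.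

Lemma psi_chan_ge K a w v k : (K <= k)%N -> jost v K (theta v w) != 0 ->
  psi_chan K a w v v k = jost v k (theta v w) * (a * Uent K w v v / jost v K (theta v w)).
Proof.
rewrite leq_eqVlt => /orP[/eqP <-|kK] eK.
  by rewrite psi_chan_le // [RHS]mulrC mulfVK.
by rewrite /psi_chan eqxx kK /=; ring.
Qed.

Lemma Umx_jost_wronsk w v k : nrm w < 1 -> w != 0 -> jost1_nonzero w ->
  wronsk (fb v) (fun j => Uent j w v v) (jost v ^~ (theta v w)) k
  = - (cenb v)%:C * ((theta v w)^-1 - theta v w).
Proof.
move=> w1 w0 e0.
rewrite (wronsk_const (Umx_jacobi v v w1 w0 e0) (jost_jacobi_lam v w1 w0)).
rewrite /wronsk (Umx1E v v w0 e0) (Umx0E v v w0 e0).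
rewrite eqxx (_ : true%:R = 1) // /incoming.
set d := _^-1 - _; have := e0 v; set e1 := jost v 1 _; set e00 := jost v 0 _ => e10.
have fb0 : (fb v 0)%:C != 0 :> R[i] by rewrite RC_neq0 // gt_eqF // fb_gt0.
by field; rewrite fb0 e10.
Qed.

(** The jump at [K] is the Wronskian of [U] and the Jost solution, which is constant
    along the channel and known at the attachment point. *)
Lemma psi_solves K a w v : good w -> (0 < K)%N -> jost v K (theta v w) != 0 ->
  solves iota (lam S w) v K (psi_source K a w v) (psi_core K a w v) (psi_chan K a w v).
Proof.
move=> gw K0 eK; have [w1 w0 Lu e0 Tu] := gw; split.
- move=> s; rewrite psi_chan_le // -(Umx_core s v gw) !core_attach_sum mulr_sumr.
  by apply: eq_bigr => g _; rewrite psi_chan_le //; ring.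
- by move=> i; exact: core_vecP.
- move=> s k; have Uj j := Umx_jacobi j v w1 w0 e0 k.
  have [sv|sv] := eqVneq s v; last first.
    rewrite /source (negbTE sv) addr0 psi_chan_neq // mulrCA -Uj /jacobi.
    by rewrite !psi_chan_neq //; ring.
  subst s; case: (ltngtP k.+1 K) => kK.
  + rewrite /source eqxx (ltn_eqF kK) addr0 psi_chan_le 1?ltnW // mulrCA -Uj /jacobi.
    by rewrite !psi_chan_le //; [ring|exact: ltnW|exact/ltnW/ltnW].
  + have Ka : (K <= k)%N := kK; have Kb := leqW Ka; have Kc := leqW Kb.
    rewrite /source eqxx (gtn_eqF kK) addr0 [in RHS]psi_chan_ge //.
    rewrite mulrA -jost_jacobi_lam // /jacobi !psi_chan_ge //; ring.
  + subst K; rewrite /source !eqxx /jacobi (psi_chan_le a w v v (leqnSn k)).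
    rewrite (psi_chan_le a w v v (leqnn k.+1)) (psi_chan_ge a (leqnSn k.+1) eK).
    have Uw := Umx_jost_wronsk v k.+1 w1 w0 e0.
    have -> : lam S w * (a * Uent k.+1 w v v) = a * (lam S w * Uent k.+1 w v v) by ring.
    rewrite -(Uj v) /psi_source.
    have -> : a * (cenb v)%:C * ((theta v w)^-1 - theta v w)
       = - a * wronsk (fb v) (fun j => Uent j w v v) (jost v ^~ (theta v w)) k.+1.
      by rewrite Uw; ring.
    by rewrite andbT /wronsk /jacobi; field.
Qed.

Lemma psi_decay K a w v s : nrm w < 1 -> w != 0 -> jost1_nonzero w ->
  jost v K (theta v w) != 0 -> psi_chan K a w v s k @[k --> \oo] --> (0 : R[i]).
Proof.
move=> w1 w0 e0 eK; have [t1 t0 _] := theta_disk s w1 w0.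
have h c : jost s k (theta s w) * c @[k --> \oo] --> (0 : R[i]).
  rewrite -[X in _ --> X](mul0r c).
  exact: (cvgCM (jost_decay s t1 t0) (cvgC_cst _)).
have [sv|sv] := eqVneq s v.
  subst s; apply: (cvgC_ext (h _)); exists K => // k Kk.
  by rewrite psi_chan_ge.
apply: (cvgC_ext (h (a * tauent w s v * incoming v w))); apply: nearW => k.
by rewrite psi_chan_neq // (UmxE k s v e0) (negbTE sv) mulr0n oppr0 add0r; ring.
Qed.

Lemma psi_mass K a w v n : good w -> (0 < K)%N -> jost v K (theta v w) != 0 ->
  mass n (psi_core K a w v) (psi_chan K a w v) * `|Im (lam S w)|
  <= nrm (psi_source K a w v) * nrm (a * Uent K w v v).
Proof.
move=> gw K0 eK; have [w1 w0 _ e0 _] := gw.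
rewrite -(psi_chan_le a w v v (leqnn K)).
apply: (energy_bound hS fb_cvg n K0 (psi_solves a gw K0 eK)) => s.
exact: psi_decay.
Qed.

(** * Residues of U at a pole *)

Lemma square_sum_cvg0 (f : nat -> R) (C : R) : (forall k, 0 <= f k) ->
  (forall n, \sum_(k < n) f k <= C) -> f k @[k --> \oo] --> (0 : R).
Proof.
move=> f0 fC; apply: cvg_series_cvg_0; apply: nondecreasing_is_cvgn.
  by move=> n m nm; rewrite -subr_ge0 sub_series_geq //; apply: sumr_ge0 => i _.
by exists C => _ [n _ <-]; rewrite /series /= big_mkord.
Qed.

Lemma theta_disk_cvg s w : nrm w <= 1 ->
  theta s z @[z --> disk_nbhs w] --> theta s w.
Proof.
move=> w1; have /subspace_continuousP := @theta_cont _ _ _ htheta s.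
move=> /(_ w); rewrite /closed_disk /= nrm_le1 => /(_ w1) h B hB.
have /nbhsC_ball[d d0 hd] := h B hB.
apply/disk_nbhsP; exists d => // z z1 _ zd; apply: hd => //=.
by rewrite nrm_le1 ltW.
Qed.
Arguments theta_disk_cvg : clear implicits.

Section AtPoint.
Variable w0 : R[i].
Hypothesis hw0 : Omega S w0.
Local Notation F := (disk_nbhs w0).
Local Notation th s := (theta s w0).

Definition resU k s v := ResU S k w0 s v.

Lemma w0_neq0 : w0 != 0. Proof. by case: hw0. Qed.
Lemma w0_le1 : nrm w0 <= 1. Proof. by rewrite -nrm_le1; case: hw0. Qed.

Global Instance w0_proper : ProperFilter F.
Proof. exact: disk_nbhs_proper w0_neq0 w0_le1. Qed.

Lemma resU_cvg k s v : (z - w0) * Uent k z s v @[z --> F] --> resU k s v.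
Proof.
have [_ _ h _] := hw0; have := h k s v; rewrite /resU /ResU mxE /Res => hc.
rewrite (_ : (fun z => (z - w0) * Uent k z s v) = (fun z => (z - w0) * Umx S k z s v)) //.
by apply/funext => z; rewrite UentP.
Qed.
Arguments resU_cvg : clear implicits.

Lemma tb_gt0 : 0 < tb S.
Proof.
have [_ _ _ [k /eqP hk]] := hw0.
have [s _] : exists s : 'I_(nch S), True.
  apply: contrapT => h; apply: hk; apply/matrixP => s; by exfalso; apply: h; exists s.
have b0 := cenb_gt0 hS s.
have h x : x \in `[cena s - 2 * cenb s, cena s + 2 * cenb s] ->
    ta S - 2 * tb S <= x <= ta S + 2 * tb S.
  move=> hx; have : (\bigcup_(s in [set: 'I_(nch S)])
    `[cena s - 2 * cenb s, cena s + 2 * cenb s]%classic) x by exists s.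
  by rewrite (bands_union hS) /= in_itv.
have := h (cena s - 2 * cenb s); have := h (cena s + 2 * cenb s).
rewrite !in_itv /=.
move=> /(_ _)/andP[|_ h1]; first by apply/andP; split; lra.
move=> /(_ _)/andP[|h2 _]; first by apply/andP; split; lra.
lra.
Qed.

Lemma w0_near_neq0 : \forall z \near F, z != 0.
Proof. exact: (near_neq0 (F := F) (f := fun z => z) w0_neq0 (@disk_nbhs_cvg R w0)). Qed.

Lemma near_disk : \forall z \near F, nrm z < 1 /\ z != w0.
Proof. by apply/disk_nbhsP; exists 1 => // z. Qed.

Lemma lam_cvg : lam S z @[z --> F] --> lam S w0.
Proof.
have zc := @disk_nbhs_cvg R w0.
exact: (cvgCB (cvgC_cst _) (cvgCM (cvgC_cst _) (cvgCD zc (cvgCV w0_neq0 zc)))).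
Qed.

Lemma theta_cvg s : theta s z @[z --> F] --> th s.
Proof.
exact: (theta_disk_cvg s w0 w0_le1).
Qed.
Arguments theta_cvg : clear implicits.

Lemma theta_le1 s : nrm (th s) <= 1.
Proof.
pose proof (cvg_nrm (theta_cvg s)) as h; apply: (cvgr_to_le h).
near=> z; have [z1 _] : nrm z < 1 /\ z != w0 by near: z; exact: near_disk.
have z0 : z != 0 by near: z; exact: w0_near_neq0.
by have [/ltW] := theta_disk s z1 z0.
Unshelve. all: by end_near. Qed.

Lemma theta_neq0 s : th s != 0.
Proof.
apply/eqP => th0.
pose l := (cenb s)%:C * (th s ^+ 2 + 1) - ((cena s)%:C - lam S w0) * th s.
have h : (cenb s)%:C * (theta s z ^+ 2 + 1) - ((cena s)%:C - lam S z) * theta s z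
    @[z --> F] --> l.
  have tc := theta_cvg s.
  exact: (cvgCB (cvgCM (cvgC_cst _) (cvgCD (cvgCX (n := 2) tc) (cvgC_cst 1)))
    (cvgCM (cvgCB (cvgC_cst _) lam_cvg) tc)).
have : l = 0.
  apply: (cvgC_uniq h); apply: (cvgC_ext (cvgC_cst 0)).
  near=> z; have [z1 _] : nrm z < 1 /\ z != w0 by near: z; exact: near_disk.
  have z0 : z != 0 by near: z; exact: w0_near_neq0.
  have [t1 t0 <-] := theta_disk s z1 z0.
  by rewrite /joukowski; field.
rewrite /l th0 expr0n add0r !mulr0 mulr1 subr0 => /eqP.
by rewrite RC_eq0 gt_eqF // cenb_gt0.
Unshelve. all: by end_near. Qed.

Lemma theta_eq s : W s (th s) = lam S w0.
Proof.
have tc := theta_cvg s.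
have h : W s (theta s z) @[z --> F] --> W s (th s).
  exact: (cvgCB (cvgC_cst _) (cvgCM (cvgC_cst _) (cvgCD tc (cvgCV (theta_neq0 s) tc)))).
apply: (cvgC_uniq h); apply: (cvgC_ext lam_cvg).
near=> z; have [z1 _] : nrm z < 1 /\ z != w0 by near: z; exact: near_disk.
have z0 : z != 0 by near: z; exact: w0_near_neq0.
by have [_ _ ->] := theta_disk s z1 z0.
Unshelve. all: by end_near. Qed.

Lemma theta_near_neq s : \forall z \near F, theta s z != th s.
Proof.
near=> z; have [z1 zw] : nrm z < 1 /\ z != w0 by near: z; exact: near_disk.
have z0 : z != 0 by near: z; exact: w0_near_neq0.
have [t1 t0 E] := theta_disk s z1 z0.
apply/eqP => tE; move: E zw; rewrite tE theta_eq => E.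
by rewrite (joukowski_inj (a := ta S) tb_gt0 z0 w0_neq0 z1 w0_le1 (esym E)) eqxx.
Unshelve. all: by end_near. Qed.

Lemma jost_cvg s k : jost s k (theta s z) @[z --> F] --> jost s k (th s).
Proof.
exact: (cvg_comp (fun z => theta s z) (jost s k) (theta_cvg s)
  (@jost_continuous s k _ (theta_le1 s))).
Qed.
Arguments jost_cvg : clear implicits.

Lemma jost1_near : \forall z \near F, jost1_nonzero z.
Proof.
apply: filter_forall => s.
have [d d0 hd] := jost_isolated s (theta_le1 s) (theta_neq0 s).
have /cvgCP/(_ _ d0) hc := theta_cvg s.
near=> z; have [z1 zw] : nrm z < 1 /\ z != w0 by near: z; exact: near_disk.
have z0 : z != 0 by near: z; exact: w0_near_neq0.
have [t1 t0 _] := theta_disk s z1 z0.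
by apply: hd => //; near: z; [exact: theta_near_neq|exact: hc].
Unshelve. all: by end_near. Qed.

Lemma psol_cvg s k : psol s k z @[z --> F] --> psol s k w0.
Proof.
suff : psol s k z @[z --> F] --> psol s k w0 /\
    psol s k.+1 z @[z --> F] --> psol s k.+1 w0 by case.
elim: k => [|k [h0 h1]].
  have [E0 E1 _] := hpsol s w0_neq0; rewrite E0 E1; split.
    apply: (cvgC_ext (cvgC_cst 1)); apply: filterS w0_near_neq0 => z z0.
    by have [-> _ _] := hpsol s z0.
  apply: (cvgC_ext (cvgC_cst 0)); apply: filterS w0_near_neq0 => z z0.
  by have [_ -> _] := hpsol s z0.
split; first exact: h1.
have fbk : (fb s k.+1)%:C != 0 :> R[i] by rewrite RC_neq0 // gt_eqF // fb_gt0.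
have E w : w != 0 -> psol s k.+2 w = (fb s k.+1)%:C^-1 *
   (- (fb s k)%:C * psol s k w + (fa s k.+1)%:C * psol s k.+1 w - lam S w * psol s k.+1 w).
  move=> wn; have [_ _ /(_ k) h] := hpsol s wn; rewrite -h; by field.
rewrite (E _ w0_neq0).
apply: (cvgC_ext (cvgCM (cvgC_cst _) (cvgCB (cvgCD (cvgCM (cvgC_cst _) h0)
   (cvgCM (cvgC_cst _) h1)) (cvgCM lam_cvg h1)))).
by apply: filterS w0_near_neq0 => z z0; rewrite E.
Qed.
Arguments psol_cvg : clear implicits.

Lemma good_site v : exists2 K, (0 < K)%N & jost v K (th v) != 0.
Proof.
have [e1|e1] := eqVneq (jost v 1 (th v)) 0; last by exists 1%N.
by exists 2%N => //; exact: jost_neq0_next (theta_le1 v) (theta_neq0 v) e1.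
Qed.

Lemma resU_jacobi s v k :
  jacobi (fb s) (fa s) (fun j => resU j s v) k = lam S w0 * resU k.+1 s v.
Proof.
have h : jacobi (fb s) (fa s) (fun j => (z - w0) * Uent j z s v) k @[z --> F]
    --> jacobi (fb s) (fa s) (fun j => resU j s v) k.
  exact: (cvgCB (cvgCD (cvgCM (cvgC_cst _) (resU_cvg k s v))
    (cvgCM (cvgC_cst _) (resU_cvg k.+1 s v))) (cvgCM (cvgC_cst _) (resU_cvg k.+2 s v))).
apply: (cvgC_uniq h); apply: (cvgC_ext (cvgCM lam_cvg (resU_cvg k.+1 s v))).
near=> z; have [z1 zw] : nrm z < 1 /\ z != w0 by near: z; exact: near_disk.
have z0 : z != 0 by near: z; exact: w0_near_neq0.
have e0 : jost1_nonzero z by near: z; exact: jost1_near.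
by rewrite mulrCA -Umx_jacobi // /jacobi; ring.
Unshelve. all: by end_near. Qed.

Section Approach.
Variables (T : Type) (G : set_system T).
Context {PG : ProperFilter G}.
Variable om : T -> R[i].
Hypothesis om_cvg : om p @[p --> G] --> F.
Hypothesis om_nonreal : \forall p \near G, Im (lam S (om p)) != 0.

Lemma om_comp (f : R[i] -> R[i]) (l : R[i]) : f z @[z --> F] --> l ->
  f (om p) @[p --> G] --> l.
Proof. by move=> h; exact: (cvg_comp om f om_cvg h). Qed.

Lemma om_near (P : R[i] -> Prop) : (\forall z \near F, P z) -> \forall p \near G, P (om p).
Proof. exact: om_cvg. Qed.

Lemma om_good : \forall p \near G, good (om p).
Proof.
near=> p; have [t1 _] : nrm (om p) < 1 /\ om p != w0.
  by near: p; exact: (om_near near_disk).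
apply: nonreal_good => //; last by near: p.
by near: p; exact: (om_near w0_near_neq0).
Unshelve. all: by end_near. Qed.

Lemma om_jost_neq0 v K : jost v K (th v) != 0 ->
  \forall p \near G, jost v K (theta v (om p)) != 0.
Proof. by move=> eK; exact: (om_near (near_neq0 eK (jost_cvg v K))). Qed.

(** [psi] is bounded along [om], by the energy estimate; a residue that survived
    at a band edge would have a tail of constant modulus. *)
Lemma resU_edge_amplitude v K M : (0 < K)%N -> jost v K (th v) != 0 -> nrm (th v) = 1 ->
  (\forall p \near G, nrm (psi_source K (om p - w0) (om p) v)
      <= M * `|Im (lam S (om p))|) -> resU K v v = 0.
Proof.
move=> K0 eK th1 hM; have uc := om_comp (resU_cvg K v v).
have [B B0 hB] := cvgC_bound uc.
pose rho := resU K v v / jost v K (th v).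
pose f k : R := if (K <= k.+1)%N then nrm (jost v k.+1 (th v) * rho) ^+ 2 else 0.
have fle n : \sum_(k < n) f k <= `|M| * B.
  pose g p := \sum_(k < n) (if (K <= k.+1)%N then
     (nrm (psi_chan K (om p - w0) (om p) v v k.+1) ^+ 2)%:C else 0).
  have gl : g p @[p --> G] --> (\sum_(k < n) f k)%:C.
    rewrite RC_sum; apply: cvgC_sum => k _; rewrite /f; case: ifP => Kk; last exact: cvgC_cst.
    have h : psi_chan K (om p - w0) (om p) v v k.+1 @[p --> G] --> jost v k.+1 (th v) * rho.
      apply: (cvgC_ext (cvgCM (om_comp (jost_cvg v k.+1))
        (cvgCdiv eK uc (om_comp (jost_cvg v K))))).
      by apply: filterS (om_jost_neq0 eK) => p et; rewrite psi_chan_ge.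
    rewrite -mul_conj; apply: (cvgC_ext (cvgCM h (cvgC_conj h))).
    by apply: nearW => p; rewrite mul_conj.
  pose proof (cvg_Re gl) as h; apply: (cvgr_to_le h).
  near=> p; have gt : good (om p) by near: p; exact: om_good.
  have et : jost v K (theta v (om p)) != 0 by near: p; exact: om_jost_neq0.
  have It : Im (lam S (om p)) != 0 by near: p.
  have h1 := psi_mass (om p - w0) n gt K0 et.
  have h2 : nrm (psi_source K (om p - w0) (om p) v) <= M * `|Im (lam S (om p))| by near: p.
  have h3 : nrm ((om p - w0) * Uent K (om p) v v) <= B by near: p.
  have Ip : 0 < `|Im (lam S (om p))| by rewrite normr_gt0.
  apply: le_trans (_ : mass n (psi_core K (om p - w0) (om p) v)
      (psi_chan K (om p - w0) (om p) v) <= _).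
    rewrite /g Re_sum /mass ler_wpDl //; first by apply: sumr_ge0 => i _; rewrite sqr_ge0.
    rewrite (bigD1 v) //= ler_wpDr //.
      by apply: sumr_ge0 => s _; apply: sumr_ge0 => k _; rewrite sqr_ge0.
    by apply: ler_sum => k _; case: ifP => _ //=; rewrite sqr_ge0.
  rewrite -(ler_pM2r Ip); apply: le_trans h1 _.
  apply: le_trans (ler_pM (nrm_ge0 _) (nrm_ge0 _) h2 h3) _.
  rewrite mulrAC ler_wpM2r ?mulr_ge0 ?normr_ge0 //.
  by rewrite ler_wpM2r ?ler_norm // ltW.
have f0 k : 0 <= f k by rewrite /f; case: ifP => _ //; rewrite sqr_ge0.
have fc := square_sum_cvg0 f0 fle.
have jc := jost_circle_cvg (@jost_asymptotics v) th1.
have jcS : nrm (jost v k.+1 (th v)) @[k --> \oo] --> (1 : R).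
  by rewrite -(cvg_shiftS (fun k => nrm (jost v k (th v)))) in jc.
have fl : f k @[k --> \oo] --> (1 * nrm rho) * (1 * nrm rho).
  have h : (nrm (jost v k.+1 (th v)) * nrm rho) * (nrm (jost v k.+1 (th v)) * nrm rho)
     @[k --> \oo] --> (1 * nrm rho) * (1 * nrm rho).
    have h1 : nrm (jost v k.+1 (th v)) * nrm rho @[k --> \oo] --> 1 * nrm rho.
      by apply: cvgM jcS _; exact: cvg_cst.
    exact: (cvgM h1 h1).
  apply/cvgRP => e e0; have /cvgRP/(_ _ e0) := h.
  move=> [N _ hN]; exists (maxn N K) => // k /=.
  rewrite geq_max => /andP[Nk Kk]; have := hN k Nk.
  by rewrite /f (leqW Kk) nrmM expr2.
have : (1 * nrm rho) * (1 * nrm rho) = 0 by exact: (cvg_unique _ fl fc).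
rewrite mul1r => /eqP; rewrite mulf_eq0 orbb nrm_eq0 mulf_eq0 invr_eq0 (negbTE eK) orbF.
by move/eqP.
Unshelve. all: by end_near. Qed.

(** The energy estimate forces [psi] to [0]. Beyond [K] on the channel [v], where
    the residue is not a limit of [psi], it vanishes by the Jacobi equation, having
    two consecutive zeros. *)
Lemma resU_vanish v K : (0 < K)%N -> jost v K (th v) != 0 ->
  nrm (psi_source K (om p - w0) (om p) v) * nrm ((om p - w0) * Uent K (om p) v v)
    / `|Im (lam S (om p))| @[p --> G] --> (0 : R) -> forall k s, resU k s v = 0.
Proof.
move=> K0 eK q0'.
pose q p : R := nrm (psi_source K (om p - w0) (om p) v)
  * nrm ((om p - w0) * Uent K (om p) v v) / `|Im (lam S (om p))|.
have q0 : q p @[p --> G] --> (0 : R) := q0'.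
have mq n : \forall p \near G, mass n (psi_core K (om p - w0) (om p) v)
    (psi_chan K (om p - w0) (om p) v) <= q p.
  near=> p; have gt : good (om p) by near: p; exact: om_good.
  have et : jost v K (theta v (om p)) != 0 by near: p; exact: om_jost_neq0.
  have It : Im (lam S (om p)) != 0 by near: p.
  rewrite /q ler_pdivlMr ?normr_gt0 //; exact: psi_mass.
have sq0 (x : T -> R[i]) (l : R[i]) : (\forall p \near G, nrm (x p) ^+ 2 <= q p) ->
    x p @[p --> G] --> l -> l = 0.
  move=> xq xl; have h : nrm (x p) ^+ 2 @[p --> G] --> nrm l ^+ 2.
    by rewrite expr2; apply: cvgM; exact: cvg_nrm.
  have hl : nrm l ^+ 2 <= 0 by exact: (cvgR_le xq h q0).
  by apply/eqP; rewrite -nrm_eq0; move: hl; rewrite exprn_even_le0.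
have vS k s : (s != v) || (k < K)%N -> resU k.+1 s v = 0.
  move=> hs; apply: (sq0 (fun p => psi_chan K (om p - w0) (om p) v s k.+1)).
    by apply: filterS (mq k.+1) => p; apply: le_trans; apply: chan_le_mass.
  apply: (cvgC_ext (om_comp (resU_cvg k.+1 s v))); apply: nearW => p.
  by case/orP: hs => h; [rewrite psi_chan_neq|rewrite psi_chan_le].
have v0 s : resU 0 s v = 0.
  apply: (sq0 (fun p => psi_chan K (om p - w0) (om p) v s 0)).
    near=> p; have gt : good (om p) by near: p; exact: om_good.
    have et : jost v K (theta v (om p)) != 0 by near: p; exact: om_jost_neq0.
    have [-> _ _] := psi_solves (om p - w0) gt K0 et.
    have h : mass 0 (psi_core K (om p - w0) (om p) v) (psi_chan K (om p - w0) (om p) v) <= q p.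
      by near: p; exact: mq.
    by apply: le_trans h; exact: core_le_mass.
  apply: (cvgC_ext (om_comp (resU_cvg 0 s v))); apply: nearW => p.
  by rewrite psi_chan_le.
move=> [|k] s; first exact: v0.
have [<-|sv] := eqVneq v s; last by apply: vS; rewrite eq_sym sv.
apply: (jacobi_zero (fb_gt0 hS v) (resU_jacobi v v) (v0 v)) => //.
by apply: vS; rewrite K0 orbT.
Unshelve. all: by end_near. Qed.

End Approach.

Lemma psi_source_cvg K v : jost v K (th v) != 0 ->
  psi_source K (z - w0) z v @[z --> F] --> (0 : R[i]).
Proof.
move=> eK; have tc := theta_cvg v.
have -> : (0 : R[i]) = (w0 - w0) * (cenb v)%:C * ((th v)^-1 - th v) / jost v K (th v).
  by rewrite subrr !mul0r.
exact: (cvgCdiv eK (cvgCM (cvgCM (cvgCB (@disk_nbhs_cvg R w0) (cvgC_cst _)) (cvgC_cst _))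
  (cvgCB (cvgCV (theta_neq0 v) tc) tc)) (jost_cvg v K)).
Qed.

(** Poles only occur at real energies: elsewhere [|Im lam|] stays away from [0],
    while the source of [psi] tends to [0]. *)
Lemma lam0_real : Im (lam S w0) = 0.
Proof.
apply/eqP; apply: contrapT => /negP I0.
have Ip : 0 < `|Im (lam S w0)| by rewrite normr_gt0.
have nI : \forall z \near F, Im (lam S z) != 0.
  move/cvgCP : lam_cvg => /(_ _ Ip); apply: filterS => z h; apply/eqP => E.
  move: h; rewrite ltNge => /negP; apply.
  by rewrite -normrN -[- _]add0r -E -ImB; exact: Im_nrm.
have [_ _ _ [k /eqP hk]] := hw0; apply: hk; apply/matrixP => s v.
rewrite [RHS]mxE; have [K K0 eK] := good_site v.
apply: (resU_vanish (G := F) (om := fun z => z) _ nI K0 eK); first exact: cvg_id.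
pose proof (cvg_nrm (psi_source_cvg eK)) as h1; rewrite nrm0 in h1.
pose proof (cvg_nrm (resU_cvg K v v)) as h2.
have h3 : `|Im (lam S z)| @[z --> F] --> `|Im (lam S w0)|.
  by apply: cvg_norm; exact: (cvg_Im lam_cvg).
have -> : (0 : R) = 0 * nrm (resU K v v) / `|Im (lam S w0)| by rewrite !mul0r.
apply: cvgM; first exact: (cvgM h1 h2).
by apply: cvgV => //; rewrite gt_eqF.
Qed.

Lemma joukowski_diff s z : nrm z < 1 -> z != 0 ->
  (cenb s)%:C * (theta s z - th s) * (1 - (theta s z * th s)^-1)
  = (tb S)%:C * (z - w0) * (1 - (z * w0)^-1).
Proof.
move=> z1 z0; have [t1 t0 E] := theta_disk s z1 z0.
have := joukowskiB (ta S) (tb S) z0 w0_neq0.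
have := joukowskiB (cena s) (cenb s) t0 (theta_neq0 s).
rewrite -[joukowski (ta S) (tb S) z]E -[joukowski (ta S) (tb S) w0](theta_eq s) => -> h.
by apply: oppr_inj; rewrite -!mulNr.
Qed.

(** Both [lam] and [W v] have a nondegenerate critical point here, so that
    [theta v z - th v] is of the order of [z - w0], and so is its multiple on the
    left. *)
Lemma edge_ratio_bound v : th v ^+ 2 = 1 -> w0 ^+ 2 = 1 -> exists M : R,
  \forall z \near F, nrm ((theta v z)^-1 - theta v z) <= M * nrm (z - w0).
Proof.
move=> t2 w2; have tc := theta_cvg v.
have bv0 : (cenb v)%:C != 0 :> R[i] by rewrite RC_neq0 // gt_eqF // cenb_gt0.
pose r z := (th v + theta v z) ^+ 2 * (theta v z)^-1 * ((tb S)%:C / (cenb v)%:C / z).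
have [B B0 hB] := cvgC_bound (cvgCM (cvgCM (cvgCX (n := 2) (cvgCD (cvgC_cst (th v)) tc))
   (cvgCV (theta_neq0 v) tc))
   (cvgCM (cvgC_cst ((tb S)%:C / (cenb v)%:C)) (cvgCV w0_neq0 (@disk_nbhs_cvg R w0)))).
exists (B + 1); near=> z.
have [z1 zw] : nrm z < 1 /\ z != w0 by near: z; exact: near_disk.
have z0 : z != 0 by near: z; exact: w0_near_neq0.
have [tt1 tt0 _] := theta_disk v z1 z0.
have zw0 : z - w0 != 0 by rewrite subr_eq0.
have tV : (th v)^-1 = th v by apply: (mulfI (theta_neq0 v)); rewrite divff ?theta_neq0 // -expr2 t2.
have wV : w0^-1 = w0 by apply: (mulfI w0_neq0); rewrite divff ?w0_neq0 // -expr2 w2.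
have E := joukowski_diff v z1 z0; rewrite !invfM tV wV in E.
have key : (((theta v z)^-1 - theta v z) / (z - w0)) ^+ 2 = r z.
  have E2 : (cenb v)%:C * (theta v z - th v) ^+ 2 / theta v z = (tb S)%:C * (z - w0) ^+ 2 / z.
    have -> : (cenb v)%:C * (theta v z - th v) ^+ 2 / theta v z
      = (cenb v)%:C * (theta v z - th v) * (1 - (theta v z)^-1 * th v) by field.
    by rewrite E; field.
  have -> : (theta v z)^-1 - theta v z = - (theta v z - th v) * (th v + theta v z) / theta v z.
    have -> : - (theta v z - th v) * (th v + theta v z) = th v ^+ 2 - theta v z ^+ 2 by ring.
    by rewrite t2; field.
  apply: (mulfI (_ : (cenb v)%:C * (z - w0) ^+ 2 * z != 0)).
    by rewrite !mulf_neq0 // expf_neq0.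
  have -> : (cenb v)%:C * (z - w0) ^+ 2 * z * r z =
     (th v + theta v z) ^+ 2 * (theta v z)^-1 * (z * ((tb S)%:C * (z - w0) ^+ 2 / z)).
    by rewrite /r; field; rewrite z0 bv0 tt0.
  by rewrite -E2; field; rewrite zw0 tt0.
have h : nrm (((theta v z)^-1 - theta v z) / (z - w0)) ^+ 2 <= B.
  by rewrite -nrmX key; near: z.
rewrite -ler_pdivrMr ?nrm_gt0 // -nrmV -nrmM.
set x := nrm _ in h *; have : 0 <= (x - 1) ^+ 2 by rewrite sqr_ge0.
have : 0 <= x by exact: nrm_ge0.
by rewrite !expr2 in h *; lra.
Unshelve. all: by end_near. Qed.

(** At a band edge the source of [psi] is [O(|Im lam|)] along a nontangential
    sequence. Hence [psi] is bounded and the amplitude of the residue on the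
    channel [v] vanishes; then the energy estimate gives [psi -> 0]. *)
Lemma resU_edge v : th v ^+ 2 = 1 -> forall k s, resU k s v = 0.
Proof.
move=> t2; have [K K0 eK] := good_site v.
have th1 : nrm (th v) = 1.
  by move/eqP : t2; rewrite sqrf_eq1 => /orP[] /eqP ->; rewrite ?nrmN nrm1.
have [om [C C0 [ow o1 oC2 oC1]]] := nontangential_seq (a := ta S) tb_gt0 w0_neq0 w0_le1 lam0_real.
have oI n : Im (lam S (om n)) != 0 by case: (o1 n).
have oF : om n @[n --> \oo] --> F.
  apply: disk_nbhs_seq => // n; first by case: (o1 n).
  by apply: contra (oI n) => /eqP ->; rewrite lam0_real.
have oI' : \forall n \near \oo, Im (lam S (om n)) != 0 by apply: nearW.
have on : forall P, (\forall z \near F, P z) -> \forall n \near \oo, P (om n).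
  by move=> P; exact: (om_near oF).
have tc := theta_cvg v.
have [M hM] : exists M : R, \forall n \near \oo,
    nrm (psi_source K (om n - w0) (om n) v) <= M * `|Im (lam S (om n))|.
  have [B B0 hB] := cvgC_bound (cvgCdiv eK (cvgC_cst (cenb v)%:C) (jost_cvg v K)).
  have E n : nrm (psi_source K (om n - w0) (om n) v) = nrm (om n - w0) *
     nrm ((theta v (om n))^-1 - theta v (om n)) *
     nrm ((cenb v)%:C / jost v K (theta v (om n))).
    by rewrite -!nrmM /psi_source; congr nrm; ring.
  have [w2|w2] := eqVneq (w0 ^+ 2) 1.
    have [D hD] := edge_ratio_bound t2 w2.
    exists (C * (`|D| * B)); near=> n; rewrite E.
    have h1 : nrm ((cenb v)%:C / jost v K (theta v (om n))) <= B by near: n; exact: on hB.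
    have h2 : nrm ((theta v (om n))^-1 - theta v (om n)) <= D * nrm (om n - w0).
      by near: n; exact: on hD.
    have h3 : nrm ((theta v (om n))^-1 - theta v (om n)) <= `|D| * nrm (om n - w0).
      by apply: le_trans h2 _; rewrite ler_wpM2r ?nrm_ge0 // ler_norm.
    have h4 := ler_pM (nrm_ge0 _) (nrm_ge0 _) h3 h1.
    have h5 := ler_wpM2l (nrm_ge0 (om n - w0)) h4.
    rewrite -mulrA; apply: le_trans h5 _.
    have h6 := ler_wpM2r (mulr_ge0 (normr_ge0 D) (ltW B0)) (oC2 n).
    rewrite expr2 in h6; lra.
  have [D D0 hD] := cvgC_bound (cvgCB (cvgCV (theta_neq0 v) tc) tc).
  exists (C * (D * B)); near=> n; rewrite E.
  have h1 : nrm ((cenb v)%:C / jost v K (theta v (om n))) <= B by near: n; exact: on hB.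
  have h2 : nrm ((theta v (om n))^-1 - theta v (om n)) <= D by near: n; exact: on hD.
  have h4 := ler_pM (nrm_ge0 _) (nrm_ge0 _) h2 h1.
  have h5 := ler_pM (nrm_ge0 _) (mulr_ge0 (nrm_ge0 _) (nrm_ge0 _)) (oC1 w2 n) h4.
  by rewrite -mulrA; apply: le_trans h5 _; lra.
have u0 := resU_edge_amplitude oF oI' K0 eK th1 hM.
apply: (resU_vanish oF oI' K0 eK).
have uc := om_comp oF (resU_cvg K v v); rewrite u0 in uc.
apply: (cvgR_dom (u := fun n => `|M| * nrm ((om n - w0) * Uent K (om n) v v))).
  near=> n; have Ip : 0 < `|Im (lam S (om n))| by rewrite normr_gt0.
  rewrite ger0_norm ?divr_ge0 ?mulr_ge0 ?nrm_ge0 // ler_pdivrMr //.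
  have h : nrm (psi_source K (om n - w0) (om n) v) <= M * `|Im (lam S (om n))| by near: n.
  have h' := le_trans h (ler_wpM2r (ltW Ip) (ler_norm M)).
  have := ler_wpM2r (nrm_ge0 ((om n - w0) * Uent K (om n) v v)) h'; lra.
pose proof (cvg_nrm uc) as un; rewrite nrm0 in un.
have -> : (0 : R) = `|M| * 0 by rewrite mulr0.
by apply: cvgM un; exact: cvg_cst.
Unshelve. all: by end_near. Qed.

(** * The residue formula *)

Lemma theta_sub_inv_neq0 v : th v ^+ 2 != 1 -> (th v)^-1 - th v != 0.
Proof.
move=> t2; apply: contra t2; rewrite subr_eq0 => /eqP E.
by rewrite expr2 -{1}E mulVf // theta_neq0.
Qed.

Lemma theta_derivative v : th v ^+ 2 != 1 ->
  (theta v z - th v) / (z - w0) @[z --> F]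
    --> (tb S)%:C * (1 - (w0 * w0)^-1) / ((cenb v)%:C * (1 - (th v * th v)^-1)).
Proof.
move=> t2; have tc := theta_cvg v; have zc := @disk_nbhs_cvg R w0.
have bv0 : (cenb v)%:C != 0 :> R[i] by rewrite RC_neq0 // gt_eqF // cenb_gt0.
have tt0 : th v * th v != 0 by rewrite mulf_neq0 // theta_neq0.
have ww0 : w0 * w0 != 0 by rewrite mulf_neq0 // w0_neq0.
have d0 : (cenb v)%:C * (1 - (th v * th v)^-1) != 0.
  rewrite mulf_neq0 // subr_eq0; apply: contra t2 => /eqP E.
  by rewrite expr2 -[_ * _]invrK -E invr1.
have dc : (cenb v)%:C * (1 - (theta v z * th v)^-1) @[z --> F]
    --> (cenb v)%:C * (1 - (th v * th v)^-1).
  exact: (cvgCM (cvgC_cst _) (cvgCB (cvgC_cst 1) (cvgCV tt0 (cvgCM tc (cvgC_cst _))))).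
have nc : (tb S)%:C * (1 - (z * w0)^-1) @[z --> F] --> (tb S)%:C * (1 - (w0 * w0)^-1).
  exact: (cvgCM (cvgC_cst _) (cvgCB (cvgC_cst 1) (cvgCV ww0 (cvgCM zc (cvgC_cst _))))).
apply: (cvgC_ext (cvgCdiv d0 nc dc)); near=> z.
have [z1 zw] : nrm z < 1 /\ z != w0 by near: z; exact: near_disk.
have z0 : z != 0 by near: z; exact: w0_near_neq0.
have dz : (cenb v)%:C * (1 - (theta v z * th v)^-1) != 0.
  by near: z; exact: (near_neq0 d0 dc).
have zw0 : z - w0 != 0 by rewrite subr_eq0.
apply: (mulIf dz); apply: (mulIf zw0); rewrite mulfVK // [RHS]mulrAC mulfVK //.
have E := joukowski_diff v z1 z0.
rewrite [RHS](_ : _ = (cenb v)%:C * (theta v z - th v) * (1 - (theta v z * th v)^-1)); last by ring.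
by rewrite E; ring.
Unshelve. all: by end_near. Qed.

Lemma jost1_derivative v : th v ^+ 2 != 1 -> jost v 1 (th v) = 0 -> w0 ^+ 2 != 1 ->
  exists2 d : R[i], d != 0 &
    (jost v 1 (theta v z) - jost v 1 (th v)) / (z - w0) @[z --> F] --> d.
Proof.
move=> t2 e1 w2; have [l hl] := jost_quotient v 1 (theta_le1 v).
have l0 := jost_simple_zero (theta_le1 v) (theta_neq0 v) e1 t2 hl.
have td := theta_derivative t2.
have tF : theta v z @[z --> F] --> (th v)^'.
  move=> B /dnbhsC_ball[d d0 hd].
  have /cvgCP/(_ _ d0) hc := theta_cvg v.
  by apply: filterS2 hc (theta_near_neq v) => z zd zt; exact: hd.
have lc : (jost v 1 (theta v z) - jost v 1 (th v)) / (theta v z - th v) @[z --> F] --> l.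
  exact: (cvg_comp (theta v) (fun t => (jost v 1 t - jost v 1 (th v)) / (t - th v)) tF hl).
exists (l * ((tb S)%:C * (1 - (w0 * w0)^-1) / ((cenb v)%:C * (1 - (th v * th v)^-1)))).
  have nz x : x != 0 -> x ^+ 2 != 1 -> 1 - (x * x)^-1 != 0 :> R[i].
    move=> x0; apply: contra; rewrite subr_eq0 => /eqP E.
    by rewrite expr2 -[_ * _]invrK -E invr1.
  rewrite !mulf_neq0 ?invr_eq0 ?mulf_neq0 ?nz ?RC_eq0 ?theta_neq0 ?w0_neq0 //.
    by rewrite gt_eqF // tb_gt0.
  by rewrite gt_eqF // cenb_gt0.
apply: (cvgC_ext (cvgCM lc td)); near=> z.
have tz : theta v z - th v != 0 by rewrite subr_eq0; near: z; exact: theta_near_neq.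
by rewrite mulrA mulfVK.
Unshelve. all: by end_near. Qed.

(** The limit of the incoming amplitude, times [z - w0]. It is nonzero only if
    [e_v(1)] vanishes at the pole. *)
Definition incoming_residue v : R[i] :=
  if jost v 1 (th v) == 0
  then (cenb v)%:C / (fb v 0)%:C * (((th v)^-1 - th v) / evdot w0 v 1) else 0.

Lemma evdot_cvg v : th v ^+ 2 != 1 -> jost v 1 (th v) = 0 -> w0 ^+ 2 != 1 ->
  evdot w0 v 1 != 0 /\ (z - w0) / jost v 1 (theta v z) @[z --> F] --> (evdot w0 v 1)^-1.
Proof.
move=> t2 e1 w2; have [d d0 hd] := jost1_derivative t2 e1 w2.
have -> : evdot w0 v 1 = d by rewrite /evdot /disk_derive; exact: cvgC_lim.
split; first exact: d0.
apply: (cvgC_ext (cvgCV d0 hd)); apply: nearW => z.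
by rewrite e1 subr0 invfM invrK mulrC.
Qed.

Lemma incoming_cvg v : th v ^+ 2 != 1 -> (jost v 1 (th v) = 0 -> w0 ^+ 2 != 1) ->
  (z - w0) * incoming v z @[z --> F] --> incoming_residue v.
Proof.
move=> t2 hw; have tc := theta_cvg v.
have dc : (theta v z)^-1 - theta v z @[z --> F] --> (th v)^-1 - th v.
  exact: (cvgCB (cvgCV (theta_neq0 v) tc) tc).
rewrite /incoming_residue; case: eqP => e1.
  have [_ hc] := evdot_cvg t2 e1 (hw e1).
  apply: (cvgC_ext (cvgCM (cvgC_cst ((cenb v)%:C / (fb v 0)%:C)) (cvgCM dc hc))).
  by apply: nearW => z; rewrite /incoming; ring.
have {}e1 : jost v 1 (th v) != 0 by apply/eqP.
have -> : 0 = (w0 - w0) * ((cenb v)%:C / (fb v 0)%:C * ((th v)^-1 - th v) / jost v 1 (th v)).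
  by rewrite subrr mul0r.
exact: (cvgCM (cvgCB (@disk_nbhs_cvg R w0) (cvgC_cst _))
  (cvgCdiv e1 (cvgCM (cvgC_cst _) dc) (jost_cvg v 1))).
Qed.

(** [U k] is [- p(k)] times the incoming amplitude plus [e(k)] times the outgoing
    one. Each amplitude has a residue: the outgoing one is found from a site where
    [e_s] does not vanish. *)
Lemma residue_split s v c : (z - w0) * incoming v z @[z --> F] --> c ->
  exists2 g : R[i], (z - w0) * tauent z s v * incoming v z @[z --> F] --> g &
    forall k, resU k s v = - (psol s k w0 *+ (s == v)) * c + jost s k (th s) * g.
Proof.
move=> hc.
have pc k : psol s k z *+ (s == v) @[z --> F] --> psol s k w0 *+ (s == v).
  case: (s == v); last exact: cvgC_cst.
  by apply: (cvgC_ext (psol_cvg s k)); apply: nearW => z; rewrite mulr1n.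
have UE : \forall z \near F, forall k, (z - w0) * Uent k z s v =
    - (psol s k z *+ (s == v)) * ((z - w0) * incoming v z)
    + jost s k (theta s z) * ((z - w0) * tauent z s v * incoming v z).
  by apply: filterS jost1_near => z e0 k; rewrite UmxE //; ring.
have [K K0 eK] := good_site s.
pose g := (resU K s v + (psol s K w0 *+ (s == v)) * c) / jost s K (th s).
have gc : (z - w0) * tauent z s v * incoming v z @[z --> F] --> g.
  apply: (cvgC_ext (cvgCdiv eK (cvgCD (resU_cvg K s v) (cvgCM (pc K) hc)) (jost_cvg s K))).
  near=> z; have eKz : jost s K (theta s z) != 0.
    by near: z; exact: (near_neq0 eK (jost_cvg s K)).
  have -> : (z - w0) * Uent K z s v =
    - (psol s K z *+ (s == v)) * ((z - w0) * incoming v z)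
    + jost s K (theta s z) * ((z - w0) * tauent z s v * incoming v z).
    by move: (K); near: z; exact: UE.
  by field.
exists g; first exact: gc.
move=> k.
apply: (cvgC_uniq (resU_cvg k s v)).
apply: (cvgC_ext (cvgCD (cvgCM (cvgCN (pc k)) hc) (cvgCM (jost_cvg s k) gc))).
by apply: filterS UE => z ->.
Unshelve. all: by end_near. Qed.

Lemma hlim_amplitude s v g : th v ^+ 2 != 1 ->
  (z - w0) * tauent z s v * incoming v z @[z --> F] --> g -> hlim w0 s v = g.
Proof.
move=> t2 gc; apply: cvgC_lim; have tc := theta_cvg v.
have d0 := theta_sub_inv_neq0 t2.
have dc : (theta v z)^-1 - theta v z @[z --> F] --> (th v)^-1 - th v.
  exact: (cvgCB (cvgCV (theta_neq0 v) tc) tc).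
have rc : ((th v)^-1 - th v) / ((theta v z)^-1 - theta v z) * ((z - w0) * tauent z s v * incoming v z)
    @[z --> F] --> g.
  rewrite -[X in _ --> X]mul1r -(divff d0).
  exact: (cvgCM (cvgCdiv d0 (cvgC_cst _) dc) gc).
apply: (cvgC_ext rc); near=> z.
have dz : (theta v z)^-1 - theta v z != 0 by near: z; exact: (near_neq0 d0 dc).
rewrite /hfun tauentP /incoming; move: (tau S z s v) => tt.
move: ((th v)^-1) ((theta v z)^-1) dz => a b dz.
have fb0 : (fb v 0)%:C != 0 :> R[i] by rewrite RC_neq0 // gt_eqF // fb_gt0.
have e1 : jost v 1 (theta v z) != 0 by move: (v); near: z; exact: jost1_near.
by field; rewrite dz fb0 e1.
Unshelve. all: by end_near. Qed.

Lemma mmx_edge s v : th v ^+ 2 = 1 -> mmx S w0 s v = 0.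
Proof.
move=> t2; have d0 : th v - (th v)^-1 = 0.
  apply/eqP; rewrite subr_eq0; apply/eqP; apply: (mulfI (theta_neq0 v)).
  by rewrite divff ?theta_neq0 // -expr2.
have h0 : hlim w0 s v = 0.
  apply: cvgC_lim; apply: (cvgC_ext (cvgC_cst 0)); apply: nearW => z.
  by rewrite /hfun d0 mul0r mulr0 !mul0r.
by rewrite mxE h0 d0 mul0r mulr0 addr0; case: ifP.
Qed.

(** The incoming part only contributes if [e_v(1)] vanishes at the pole; in that case
    [p_v] is a multiple of [e_v], so that both parts are multiples of [e_s]. *)
Lemma residue_formula k s v :
  (w0 ^+ 2 = 1 -> jost v 1 (th v) = 0 -> th v ^+ 2 = 1) ->
  resU k s v = jost s k (th s) * mmx S w0 s v.
Proof.
move=> hdef; have [t2|t2] := eqVneq (th v ^+ 2) 1.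
  by rewrite (resU_edge t2) mmx_edge // mulr0.
have hw : jost v 1 (th v) = 0 -> w0 ^+ 2 != 1.
  by move=> e1; apply: contra t2 => /eqP w2; rewrite hdef.
have [g gc ->] := residue_split s (incoming_cvg t2 hw).
rewrite mxE (hlim_amplitude t2 gc) /ev /incoming_residue.
have [sv|sv] /= := eqVneq s v; last by rewrite mulr0n oppr0 mul0r add0r.
subst s; rewrite mulr1n.
have [e1|e1] /= := eqVneq (jost v 1 (th v)) 0; last by rewrite mulr0 add0r.
have [d0 _] := evdot_cvg t2 e1 (hw e1).
have e0 : jost v 0 (th v) != 0.
  apply/eqP => e0; have := jost_neq0_next (theta_le1 v) (theta_neq0 v) e0.
  by rewrite e1 eqxx.
(* The solution p with p(0) = 1, p(1) = 0 is e / e(0) here. *)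
have pE : jost v k (th v) = jost v 0 (th v) * psol v k w0.
  have [p0 p1 _] := hpsol v w0_neq0.
  apply/eqP; rewrite -subr_eq0; apply/eqP.
  apply: (jacobi_zero (fb_gt0 hS v) (al := fa v) (k0 := 0%N) (z := lam S w0)
    (u := fun k => jost v k (th v) - jost v 0 (th v) * psol v k w0)) => // [j||].
  - have h1 := jost_jacobi v (theta_le1 v) (theta_neq0 v) j; rewrite theta_eq in h1.
    have h2 := psol_jacobi v w0_neq0 j.
    transitivity (jacobi (fb v) (fa v) (jost v ^~ (th v)) j
      - jost v 0 (th v) * jacobi (fb v) (fa v) (psol v ^~ w0) j); first by rewrite /jacobi; ring.
    by rewrite h1 h2; ring.
  - by rewrite p0 mulr1 subrr.
  - by rewrite p1 e1 mulr0 subrr.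
rewrite mulrDr [in RHS]pE e1 mul0r subr0.
have fb0 : (fb v 0)%:C != 0 :> R[i] by rewrite RC_neq0 // gt_eqF // fb_gt0.
have t0 := theta_neq0 v.
by rewrite pE; field; rewrite d0 e0 fb0 t0.
Qed.

(** * Convergence on the core *)

Lemma lam_near_neq : \forall z \near F, lam S z != lam S w0.
Proof.
near=> z; have [z1 zw] : nrm z < 1 /\ z != w0 by near: z; exact: near_disk.
have z0 : z != 0 by near: z; exact: w0_near_neq0.
by apply: contra zw => /eqP/(joukowski_inj tb_gt0 z0 w0_neq0 z1 w0_le1) ->.
Unshelve. all: by end_near. Qed.

Lemma near_nonspectral (d : 'I_(ncore S) -> R) : \forall z \near F, forall j, lam S z != (d j)%:C.
Proof.
apply: filter_forall => j; have [<-|dj] := eqVneq (lam S w0) (d j)%:C.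
  exact: lam_near_neq.
have dj0 : lam S w0 - (d j)%:C != 0 by rewrite subr_eq0.
pose proof (near_neq0 dj0 (cvgCB lam_cvg (cvgC_cst (d j)%:C))) as h.
by apply: filterS h => z; rewrite subr_eq0.
Qed.

Lemma invmx_cvg (T : Type) (G : set_system T) {FG : Filter G} (x : T -> R[i]) (z : R[i])
    (d : 'I_(ncore S) -> R) (P : 'M[R[i]]_(ncore S)) i l :
  (forall z, (forall j, z != (d j)%:C) -> (L1 S - z%:M \in unitmx) /\
    forall i l, invmx (L1 S - z%:M) i l = \sum_j cj (P j i) * P j l / ((d j)%:C - z)) ->
  x p @[p --> G] --> z -> (forall j, z != (d j)%:C) ->
  invmx (L1 S - (x p)%:M) i l @[p --> G] --> invmx (L1 S - z%:M) i l.
Proof.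
move=> hd xz zd; have [_ ->] := hd z zd.
have zd' j : (d j)%:C - z != 0 by rewrite subr_eq0 eq_sym zd.
have h : \sum_j cj (P j i) * P j l / ((d j)%:C - x p) @[p --> G]
    --> \sum_j cj (P j i) * P j l / ((d j)%:C - z).
  by apply: cvgC_sum => j _; exact: (cvgCdiv (zd' j) (cvgC_cst _) (cvgCB (cvgC_cst _) xz)).
apply: (cvgC_ext h).
have nd : \forall p \near G, forall j, x p != (d j)%:C.
  apply: filter_forall => j.
  pose proof (near_neq0 (zd' j) (cvgCB (cvgC_cst (d j)%:C) xz)) as h'.
  by apply: filterS h' => p; rewrite subr_eq0 eq_sym.
by apply: filterS nd => p /hd[_ ->].
Qed.

Arguments invmx_cvg {T G FG x z d P} i l.

(** As [U(1)] has only a simple pole at [w0], [T^-1] is bounded near every other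
    point, so that [T] is invertible there. *)
Lemma good_near : \forall z \near F, good z.
Proof.
have [d [P hP]] := L1_expansion.
have UM s v : {M : R | \forall z \near F, nrm ((z - w0) * Uent 1 z s v) <= M}.
  by apply: cid; have [M _ h] := cvgC_bound (resU_cvg 1 s v); exists M.
pose M s v := projT1 (UM s v).
have hM : \forall z \near F, forall s v, nrm ((z - w0) * Uent 1 z s v) <= M s v.
  by do 2![apply: filter_forall => ?]; exact: projT2 (UM _ _).
pose proof (filterI (filterI w0_near_neq0 jost1_near) (filterI (near_nonspectral d) hM)) as H.
move/disk_nbhsP : H => [del del0 H].
apply/disk_nbhsP; exists del => // z z1 zw zd.
have [[z0 e0] [zn zM]] := H z z1 zw zd.
have [Lu _] := hP _ zn.
split => //; have [//|/nonunit_kernel[g g0 Tg]] := boolP (Tmx S z \in unitmx); exfalso.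
have [Iz|Iz] := eqVneq (Im (lam S z)) 0; last first.
  have := Tmx_unit_nonreal z1 z0 Iz => Tu.
  by move/eqP : g0; apply; rewrite -[g]mul1mx -(mulVmx Tu) -mulmxA Tg mulmx0.
have [om [C C0 [ow o1 _ _]]] := nontangential_seq (a := ta S) tb_gt0 z0 (ltW z1) Iz.
have oI n : Im (lam S (om n)) != 0 by case: (o1 n).
have o_lt n : nrm (om n) < 1 by case: (o1 n).
have oz n : om n != z by apply: contra (oI n) => /eqP ->; rewrite Iz.
have oF : om n @[n --> \oo] --> disk_nbhs z by exact: disk_nbhs_seq.
have tc s : theta s (om n) @[n --> \oo] --> theta s z.
  exact: (cvg_comp om (theta s) oF (theta_disk_cvg s z (ltW z1))).
have tl s : nrm (theta s z) <= 1 by have [/ltW] := theta_disk s z1 z0.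
have jc s k : jost s k (theta s (om n)) @[n --> \oo] --> jost s k (theta s z).
  exact: (cvg_comp _ (jost s k) (tc s) (@jost_continuous s k _ (tl s))).
have lc : lam S (om n) @[n --> \oo] --> lam S z.
  exact: (cvgCB (cvgC_cst _) (cvgCM (cvgC_cst _) (cvgCD ow (cvgCV z0 ow)))).
have Tc s v : Tmx S (om n) s v @[n --> \oo] --> Tmx S z s v.
  rewrite TmxE.
  have h : jost s 0 (theta s (om n)) *+ (s == v) - invmx (L1 S - (lam S (om n))%:M) (iota s) (iota v)
      * ((fb v 0)%:C * jost v 1 (theta v (om n))) @[n --> \oo]
      --> jost s 0 (theta s z) *+ (s == v) - invmx (L1 S - (lam S z)%:M) (iota s) (iota v)
      * ((fb v 0)%:C * jost v 1 (theta v z)).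
    apply: cvgCB; last exact: (cvgCM (invmx_cvg (iota s) (iota v) hP lc zn) (cvgCM (cvgC_cst _) (jc v 1%N))).
    by case: (s == v); [exact: jc|exact: cvgC_cst].
  by apply: (cvgC_ext h); apply: nearW => n; rewrite TmxE.
have gz s : g s 0 = 0.
  pose Y n j := \sum_k Tmx S (om n) j k * g k 0.
  have Yc j : Y n j @[n --> \oo] --> (0 : R[i]).
    have h : Y n j @[n --> \oo] --> \sum_k Tmx S z j k * g k 0.
      by apply: cvgC_sum => k _; exact: (cvgCM (Tc j k) (cvgC_cst _)).
    have E : \sum_k Tmx S z j k * g k 0 = 0.
      by have := congr1 (fun m : 'cV[R[i]]_(nch S) => m j 0) Tg; rewrite !mxE.
    by rewrite E in h.
  pose q j n := (om n - w0) * (jost s 1 (theta s (om n)) * incoming j (om n)).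
  have qc j : q j n @[n --> \oo] --> (z - w0) * (jost s 1 (theta s z) * incoming j z).
    have [t1 t0 _] := theta_disk j z1 z0.
    exact: (cvgCM (cvgCB ow (cvgC_cst _)) (cvgCM (jc s 1%N) (cvgCdiv (e0 j)
      (cvgCM (cvgC_cst _) (cvgCB (cvgCV t0 (tc j)) (tc j))) (jc j 1%N)))).
  have q0 j : (z - w0) * (jost s 1 (theta s z) * incoming j z) != 0.
    have [t1 t0 _] := theta_disk j z1 z0.
    have d0 : (theta j z)^-1 - theta j z != 0.
      rewrite subr_eq0; apply/eqP => E.
      have : nrm (theta j z * theta j z) = 1 by rewrite -{1}E mulVf // nrm1.
      rewrite nrmM -expr2 => /eqP; rewrite sqrf_eq1 => /orP[/eqP h|/eqP h].
        by rewrite h ltxx in t1.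
      by have := nrm_ge0 (theta j z); rewrite h ler0N1.
    have zw' : z - w0 != 0 by rewrite subr_eq0.
    have ib : (cenb j)%:C / (fb j 0)%:C != 0 :> R[i].
      by rewrite mulf_neq0 // ?invr_eq0 RC_eq0 gt_eqF // ?cenb_gt0 // fb_gt0.
    exact: (mulf_neq0 zw' (mulf_neq0 (e0 s) (mulf_neq0 (mulf_neq0 ib d0) (invr_neq0 (e0 j))))).
  have term j : tauent (om n) s j * Y n j @[n --> \oo] --> (0 : R[i]).
    have h1 : Y n j / q j n @[n --> \oo] --> (0 : R[i]).
      have -> : (0 : R[i]) = 0 / ((z - w0) * (jost s 1 (theta s z) * incoming j z)).
        by rewrite mul0r.
      exact: (cvgCdiv (q0 j) (Yc j) (qc j)).
    have near_om : \forall n \near \oo, nrm (om n - w0) < del /\ om n != w0.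
      have zw' : z - w0 != 0 by rewrite subr_eq0.
      pose proof (near_neq0 zw' (cvgCB ow (cvgC_cst w0))) as h2.
      have e0' : 0 < del - nrm (z - w0) by rewrite subr_gt0.
      have /cvgCP/(_ _ e0') h3 := ow.
      apply: filterS2 h2 h3 => n; rewrite subr_eq0 => h4 h5; split=> //.
      by have := nrmD (om n - z) (z - w0); rewrite addrA subrK; lra.
    have h2 : \forall n \near \oo, nrm ((om n - w0) * Uent 1 (om n) s j) <= M s j.
      apply: filterS near_om => n [h3 h4].
      by have [_ [_ hh]] := H _ (o_lt n) h4 h3; exact: hh.
    apply: (cvgC_ext (cvgC_null_bound h1 h2)).
    near=> n; have [h3 h4] : nrm (om n - w0) < del /\ om n != w0 by near: n.
    have [[n0 oe] _] := H _ (o_lt n) h4 h3.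
    have qn : q j n != 0 by near: n; exact: (near_neq0 (q0 j) (qc j)).
    rewrite (Umx1E s j n0 oe); move: qn; rewrite /q; move: (tauent _ _ _) (Y n j) => tt yy.
    by move=> qn; rewrite -[RHS]mulr1 -(divff qn); ring.
  have h : \sum_j tauent (om n) s j * Y n j @[n --> \oo] --> \sum_(j < nch S) (0 : R[i]).
    by apply: cvgC_sum => j _; exact: term.
  rewrite big1_eq in h; apply: (cvgC_uniq _ h); apply: (cvgC_ext (cvgC_cst (g s 0))).
  near=> n; have o0 : om n != 0 by near: n; exact: (near_neq0 z0 ow).
  have Tu := Tmx_unit_nonreal (o_lt n) o0 (oI n).
  have := congr1 (fun m : 'cV[R[i]]_(nch S) => m s 0) (mulKmx Tu g).
  rewrite mxE => <-; apply: eq_bigr => j _.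
  by rewrite tauentP /Y mxE.
by move/eqP : g0; apply; apply/matrixP => s j; rewrite ord1 gz mxE.
Unshelve. all: by end_near. Qed.

(** On the core, a solution of [L u = lam u] with convergent boundary data
    converges, although [lam] may tend to an eigenvalue of [L1]: the singular
    part is seen at the attachment points. *)
Lemma core_cvg (f : R[i] -> 'I_(nch S) -> R[i]) (f0 c : 'I_(nch S) -> R[i]) :
  (forall g, f z g @[z --> F] --> f0 g) ->
  (forall s, core_vec (lam S z) (f z) (iota s) @[z --> F] --> c s) ->
  forall i, exists l : R[i], core_vec (lam S z) (f z) i @[z --> F] --> l.
Proof.
move=> fc cc i; have [d [P hP]] := L1_expansion.
pose Y : 'M[R[i]]_(ncore S, nch S) :=
  \matrix_(j, g) if (d j)%:C == lam S w0 then P j (iota g) else 0.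
have [D hD] := gram_factor Y.
pose X j z := \sum_g P j (iota g) * ((fb g 0)%:C * f z g) / ((d j)%:C - lam S z).
have xE : \forall z \near F, forall i, core_vec (lam S z) (f z) i = \sum_j cj (P j i) * X j z.
  apply: filterS (near_nonspectral d) => z zn i'.
  rewrite /core_vec (eq_bigr (fun g => \sum_j cj (P j i') * P j (iota g) / ((d j)%:C - lam S z)
    * ((fb g 0)%:C * f z g))); last by move=> g _; rewrite (hP _ zn).2 mulr_suml.
  rewrite exchange_big; apply: eq_bigr => j _; rewrite /X mulr_sumr.
  by apply: eq_bigr => g _; ring.
have reg j : (d j)%:C != lam S w0 -> exists l : R[i], X j z @[z --> F] --> l.
  rewrite -subr_eq0 => dj; exists (\sum_g P j (iota g) * ((fb g 0)%:C * f0 g) / ((d j)%:C - lam S w0)).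
  apply: cvgC_sum => g _.
  exact: (cvgCdiv dj (cvgCM (cvgC_cst _) (cvgCM (cvgC_cst _) (fc g))) (cvgCB (cvgC_cst _) lam_cvg)).
have sing h : exists l : R[i], \sum_(j | (d j)%:C == lam S w0) cj (P j (iota h)) * X j z @[z --> F] --> l.
  have [l hl] : exists l : R[i],
      \sum_(j | (d j)%:C != lam S w0) cj (P j (iota h)) * X j z @[z --> F] --> l.
    have ex j : {l : R[i] | (d j)%:C != lam S w0 -> X j z @[z --> F] --> l}.
      apply: cid; have [E|/reg[l hl]] := eqVneq ((d j)%:C : R[i]) (lam S w0).
        by exists 0.
      by exists l.
    exists (\sum_(j | (d j)%:C != lam S w0) cj (P j (iota h)) * projT1 (ex j)).
    apply: cvgC_sum => j dj; exact: (cvgCM (cvgC_cst _) (projT2 (ex j) dj)).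
  exists (c h - l); apply: (cvgC_ext (cvgCB (cc h) hl)).
  apply: filterS xE => z ->; rewrite [X in X - _](bigID (fun j => (d j)%:C == lam S w0)) /=.
  by rewrite addrK.
have all_cvg j : exists l : R[i], X j z @[z --> F] --> l.
  have [E|/reg//] := eqVneq ((d j)%:C : R[i]) (lam S w0).
  have ex h : {l : R[i] | \sum_(j | (d j)%:C == lam S w0) cj (P j (iota h)) * X j z @[z --> F] --> l}.
    exact: cid (sing h).
  exists (\sum_h D j h * projT1 (ex h)).
  have hc : \sum_h D j h * (\sum_(j | (d j)%:C == lam S w0) cj (P j (iota h)) * X j z)
      @[z --> F] --> \sum_h D j h * projT1 (ex h).
    by apply: cvgC_sum => h _; exact: (cvgCM (cvgC_cst _) (projT2 (ex h))).
  apply: (cvgC_ext hc); apply: nearW => z.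
  pose V : 'cV[R[i]]_(nch S) := \col_g (((fb g 0)%:C * f z g) / (lam S w0 - lam S z)).
  have YV (k : 'I_(ncore S)) : (Y *m V) k 0 = if (d k)%:C == lam S w0 then X k z else 0.
    rewrite mxE; case: ifP => dk.
      by apply: eq_bigr => g _; rewrite !mxE dk mulrA (eqP dk).
    by rewrite big1 // => g _; rewrite !mxE dk mul0r.
  have <- : (Y *m V) j 0 = X j z by rewrite YV E eqxx.
  rewrite [in RHS]hD -!mulmxA mxE; apply: eq_bigr => h _; congr (_ * _).
  rewrite mxE big_mkcond; apply: eq_bigr => k _; rewrite YV !mxE.
  by case: ifP => dk; rewrite ?conjc0 ?mul0r ?mulr0.
have ex j : {l : R[i] | X j z @[z --> F] --> l} by exact: cid (all_cvg j).
exists (\sum_j cj (P j i) * projT1 (ex j)).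
have hc : \sum_j cj (P j i) * X j z @[z --> F] --> \sum_j cj (P j i) * projT1 (ex j).
  by apply: cvgC_sum => j _; exact: (cvgCM (cvgC_cst _) (projT2 (ex j))).
by apply: (cvgC_ext hc); apply: filterS xE => z ->.
Qed.

(** * The eigenvector and its norm *)

Section Eigenvector.
Variable v : 'I_(nch S).

(** The [v]-th entry of the diagonal matrix [A]. *)
Definition amp z : R[i] :=
  (th v - (th v)^-1) / (theta v z - (theta v z)^-1) * (z - w0).

Lemma phi_chanE s k z : phi_chan w0 v s k z = amp z * Uent k z s v.
Proof. by rewrite UentP /phi_chan /Amx mul_mx_diag mxE [X in _ * X]mxE mulrC. Qed.

Lemma phi_coreE i z :
  phi_core w0 v (core i) z = core_vec (lam S z) (fun g => amp z * Uent 1 z g v) i.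
Proof.
rewrite /phi_core /core_vec; apply: eq_bigr => g _.
by rewrite resolvent_core phi_chanE !mulrA.
Qed.

Lemma amp_edge z : th v ^+ 2 = 1 -> amp z = 0.
Proof.
move=> t2; rewrite /amp; suff -> : th v - (th v)^-1 = 0 by rewrite !mul0r.
apply/eqP; rewrite subr_eq0; apply/eqP; apply: (mulfI (theta_neq0 v)).
by rewrite divff ?theta_neq0 // -expr2.
Qed.

Lemma theta_sub_inv_near : th v ^+ 2 != 1 -> \forall z \near F, theta v z - (theta v z)^-1 != 0.
Proof.
move=> t2; have tc := theta_cvg v.
have d0 : th v - (th v)^-1 != 0 by rewrite -oppr_eq0 opprB theta_sub_inv_neq0.
exact: (near_neq0 d0 (cvgCB tc (cvgCV (theta_neq0 v) tc))).
Qed.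

Lemma amp_cvg k s : amp z * Uent k z s v @[z --> F] --> resU k s v.
Proof.
have [t2|t2] := eqVneq (th v ^+ 2) 1.
  rewrite (resU_edge t2); apply: (cvgC_ext (cvgC_cst 0)); apply: nearW => z.
  by rewrite amp_edge // mul0r.
have tc := theta_cvg v.
have d0 : th v - (th v)^-1 != 0 by rewrite -oppr_eq0 opprB theta_sub_inv_neq0.
have dc : theta v z - (theta v z)^-1 @[z --> F] --> th v - (th v)^-1.
  exact: (cvgCB tc (cvgCV (theta_neq0 v) tc)).
have rc : (th v - (th v)^-1) / (theta v z - (theta v z)^-1) * ((z - w0) * Uent k z s v)
    @[z --> F] --> resU k s v.
  rewrite -[X in _ --> X]mul1r -(divff d0).
  exact: (cvgCM (cvgCdiv d0 (cvgC_cst _) dc) (resU_cvg k s v)).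
by apply: (cvgC_ext rc); apply: nearW => z; rewrite /amp mulrA.
Qed.

Arguments amp_cvg : clear implicits.

Lemma amp_core_attach s :
  core_vec (lam S z) (fun g => amp z * Uent 1 z g v) (iota s) @[z --> F] --> resU 0 s v.
Proof.
apply: (cvgC_ext (amp_cvg 0 s)); apply: filterS good_near => z gz.
rewrite -(Umx_core s v gz) !core_attach_sum mulr_sumr.
by apply: eq_bigr => g _; ring.
Qed.

Arguments amp_core_attach : clear implicits.

Lemma core_limit_ex i : {l : R[i] |
  core_vec (lam S z) (fun g => amp z * Uent 1 z g v) i @[z --> F] --> l}.
Proof. exact: cid (core_cvg (amp_cvg 1) amp_core_attach i). Qed.

Definition phi_limit i : R[i] := projT1 (core_limit_ex i).
Definition res_chan s k : R[i] := resU k s v.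

Lemma phi_limit_cvg i :
  core_vec (lam S z) (fun g => amp z * Uent 1 z g v) i @[z --> F] --> phi_limit i.
Proof. exact: projT2 (core_limit_ex i). Qed.

Arguments phi_limit_cvg : clear implicits.

Lemma phi_glued : glued iota phi_limit res_chan.
Proof. by move=> s; exact: (cvgC_uniq (amp_core_attach s) (phi_limit_cvg (iota s))). Qed.

Lemma phi_solves : solves iota (lam S w0) v 1 0 phi_limit res_chan.
Proof.
split; first exact: phi_glued.
- move=> i; pose u z g k := amp z * Uent k z g v.
  have h : coreop iota (core_vec (lam S z) (fun g => u z g 1%N)) (u z) i @[z --> F]
      --> coreop iota phi_limit res_chan i.
    apply: cvgCB; first by apply: cvgC_sum => j _; exact: (cvgCM (cvgC_cst _) (phi_limit_cvg j)).
    by apply: cvgC_sum => s _; exact: (cvgCM (cvgC_cst _) (amp_cvg 1 s)).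
  apply: (cvgC_uniq h); apply: (cvgC_ext (cvgCM lam_cvg (phi_limit_cvg i))).
  by apply: filterS good_near => z [_ _ Lu _ _]; rewrite core_vecP.
- by move=> s k; rewrite source0 addr0; exact: resU_jacobi.
Qed.

Definition phi : A -> R[i] := glue phi_limit res_chan.

Lemma phi_attach s k : phi (chan s k) = resU k s v.
Proof. exact: (glue_attach hS iotaP _ _ phi_glued). Qed.

Lemma phi_is_limit : is_phi w0 v phi.
Proof.
split=> [s k|x].
  rewrite phi_attach; apply: (cvgC_ext (amp_cvg k s)); apply: nearW => z.
  exact: esym (phi_chanE s k z).
rewrite -(core_range hS) => -[i _ <-]; rewrite /phi glue_core //.
apply: (cvgC_ext (phi_limit_cvg i)); apply: nearW => z.
exact: esym (phi_coreE i z).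
Qed.

Lemma phi_eigen x : mx_apply (L S) phi x = lam S w0 * phi x.
Proof.
have [_ xE uE] := phi_solves.
have [[i ->]|[s [k ->]]] := site_cases hS x.
  by rewrite /phi (mx_apply_core hS iotaP) xE glue_core.
rewrite phi_attach /phi (mx_apply_chan hS iotaP s k phi_glued) uE source0.
exact: addr0.
Qed.

Lemma lam_diff z : z != 0 -> lam S w0 - lam S z = (tb S)%:C * (z - w0) * (1 - (z * w0)^-1).
Proof. by move=> z0; rewrite /lam joukowskiB ?w0_neq0 // (mulrC w0); ring. Qed.

(** The pairing of [phi] with [psi] tends to the squared norm of [phi], since
    [psi] tends to [phi] weakly. *)
Lemma phi_mass K : w0 ^+ 2 != 1 -> th v ^+ 2 != 1 -> (0 < K)%N -> jost v K (th v) != 0 ->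
  (mass n phi_limit res_chan)%:C @[n --> \oo] -->
  - (th v - (th v)^-1) * (cenb v)%:C / jost v K (th v) * cj (resU K v v)
    / ((tb S)%:C * (1 - (w0 * w0)^-1)).
Proof.
move=> w2 t2 K0 eK.
have hdef : w0 ^+ 2 = 1 -> jost v 1 (th v) = 0 -> th v ^+ 2 = 1 by move/eqP; rewrite (negbTE w2).
have [om [C C0 [ow o1 _ oC]]] := nontangential_seq (a := ta S) tb_gt0 w0_neq0 w0_le1 lam0_real.
have {}oC := oC w2.
have oI n : Im (lam S (om n)) != 0 by case: (o1 n).
have oF : om n @[n --> \oo] --> F.
  apply: disk_nbhs_seq => // n; first by case: (o1 n).
  by apply: contra (oI n) => /eqP ->; rewrite lam0_real.
have oI' : \forall n \near \oo, Im (lam S (om n)) != 0 by apply: nearW.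
have og := om_good oF oI'.
have oe := om_jost_neq0 oF eK.
pose sg z := psi_source K (amp z) z v.
have sgE : \forall z \near F,
    sg z = - (th v - (th v)^-1) * (cenb v)%:C / jost v K (theta v z) * (z - w0).
  apply: filterS2 (theta_sub_inv_near t2) (near_neq0 eK (jost_cvg v K)) => z dz ez.
  rewrite /sg /psi_source /amp -(opprB (theta v z)); move: (theta v z - _) dz => d dz.
  by field; rewrite ez dz theta_neq0.
have [B B0 hB] := cvgC_bound (cvgCdiv eK (cvgC_cst (- (th v - (th v)^-1) * (cenb v)%:C)) (jost_cvg v K)).
have [B' B'0 hB'] := cvgC_bound (amp_cvg K v).
pose xm n := psi_core K (amp (om n)) (om n) v.
pose um n := psi_chan K (amp (om n)) (om n) v.
apply: (weak_limit_mass (G := \oo) (xm := xm) (um := um) (M := B * C * B')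
  (sg := fun n => sg (om n) * cj (resU K v v) / (lam S w0 - lam S (om n)))).
- near=> p => n.
  have gp : good (om p) by near: p; exact: og.
  have ep : jost v K (theta v (om p)) != 0 by near: p; exact: oe.
  have Ip : 0 < `|Im (lam S (om p))| by rewrite normr_gt0.
  rewrite -(ler_pM2r Ip); apply: le_trans (psi_mass (amp (om p)) n gp K0 ep) _.
  have h1 : sg (om p) = - (th v - (th v)^-1) * (cenb v)%:C / jost v K (theta v (om p)) * (om p - w0).
    by near: p; exact: (om_near oF sgE).
  have h2 : nrm (- (th v - (th v)^-1) * (cenb v)%:C / jost v K (theta v (om p))) <= B.
    by near: p; exact: (om_near oF hB).
  have h3 : nrm (amp (om p) * Uent K (om p) v v) <= B' by near: p; exact: (om_near oF hB').
  have h4 := ler_pM (nrm_ge0 _) (nrm_ge0 _) h2 (oC p).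
  rewrite -nrmM -h1 in h4.
  have := ler_pM (nrm_ge0 _) (nrm_ge0 _) h4 h3; rewrite /sg; lra.
- move=> i; apply: (cvgC_ext (om_comp oF (phi_limit_cvg i))); apply: nearW => n.
  rewrite /xm /psi_core /core_vec; apply: eq_bigr => g _.
  by rewrite psi_chan_le.
- move=> s k; rewrite /um /res_chan.
  have [sv|sv] := eqVneq s v; last first.
    apply: (cvgC_ext (om_comp oF (amp_cvg k.+1 s))); apply: nearW => n.
    by rewrite psi_chan_neq.
  subst s; have [kK|Kk] := leqP k.+1 K.
    apply: (cvgC_ext (om_comp oF (amp_cvg k.+1 v))); apply: nearW => n.
    by rewrite psi_chan_le.
  have -> : resU k.+1 v v = jost v k.+1 (th v) * (resU K v v / jost v K (th v)).
    by rewrite !(residue_formula _ _ hdef) [jost v K _ * _]mulrC mulfK.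
  apply: (cvgC_ext (cvgCM (om_comp oF (jost_cvg v k.+1))
    (cvgCdiv eK (om_comp oF (amp_cvg K v)) (om_comp oF (jost_cvg v K))))).
  by apply: filterS oe => p ep; rewrite psi_chan_ge // ltnW.
- near=> p; have gp : good (om p) by near: p; exact: og.
  have ep : jost v K (theta v (om p)) != 0 by near: p; exact: oe.
  have [p1 p0 _ e0 _] := gp.
  have lE := realE lam0_real.
  have := phi_solves; rewrite lE => hphi.
  have hphi' : solves iota (Re (lam S w0))%:C v K 0 phi_limit res_chan.
    by have [g1 g2 g3] := hphi; split=> // s k; rewrite g3 !source0.
  apply: (pairing_eigen hS fb_cvg K0 _ (psi_solves (amp (om p)) gp K0 ep) hphi').
  + by apply: contra (oI p) => /eqP ->.
  + by move=> s; exact: psi_decay.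
  + move=> s; have [M hM] := jost_bounded s (theta_le1 s) (theta_neq0 s).
    exists (M * nrm (mmx S w0 s v)); apply: filterS hM => k hk.
    by rewrite /res_chan (residue_formula _ _ hdef) nrmM ler_wpM2r ?nrm_ge0.
- have dd : (tb S)%:C * (1 - (w0 * w0)^-1) != 0.
    apply: mulf_neq0; first by rewrite RC_eq0 gt_eqF // tb_gt0.
    rewrite subr_eq0.
    by apply: contra w2 => /eqP E; rewrite expr2 -[_ * _]invrK -E invr1.
  have zc := @disk_nbhs_cvg R w0.
  have ww0 : w0 * w0 != 0 by rewrite mulf_neq0 // w0_neq0.
  have dc : (tb S)%:C * (1 - (z * w0)^-1) @[z --> F] --> (tb S)%:C * (1 - (w0 * w0)^-1).
    exact: (cvgCM (cvgC_cst _) (cvgCB (cvgC_cst 1) (cvgCV ww0 (cvgCM zc (cvgC_cst w0))))).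
  pose proof (cvgCdiv dd (cvgCM (cvgCdiv eK (cvgC_cst (- (th v - (th v)^-1) * (cenb v)%:C))
     (jost_cvg v K)) (cvgC_cst (cj (resU K v v)))) dc) as h.
  apply: (om_comp oF (f := fun z => sg z * cj (resU K v v) / (lam S w0 - lam S z))).
  apply: (cvgC_ext h); near=> z.
  have [z1 zw] : nrm z < 1 /\ z != w0 by near: z; exact: near_disk.
  have z0 : z != 0 by near: z; exact: w0_near_neq0.
  have -> : sg z = - (th v - (th v)^-1) * (cenb v)%:C / jost v K (theta v z) * (z - w0).
    by near: z; exact: sgE.
  have dz : (tb S)%:C * (1 - (z * w0)^-1) != 0 by near: z; exact: (near_neq0 dd dc).
  have zw' : z - w0 != 0 by rewrite subr_eq0.
  rewrite lam_diff // mulrAC [in RHS]mulrAC.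
  move: (_ / jost v K _) (cj _) dz => x y; move: (1 - _) => d dz.
  have -> : (tb S)%:C * (z - w0) * d = (tb S)%:C * d * (z - w0) by ring.
  by move: dz zw'; move: (_ * d) (z - w0) => p q p0 q0; field; rewrite p0 q0.
Unshelve. all: by end_near. Qed.

(** If [|theta_v| = 1] at the pole, then [e_v] has constant modulus at infinity and
    square summability forces [m_vv = 0]. Otherwise [theta_v] and [e_v] are real,
    and the conjugations in [phi_mass] pass to [w0], as the norm is real. *)
Lemma phi_normsq : w0 ^+ 2 != 1 -> exists2 N : R, normsq phi = N%:E &
  N%:C = - ((cenb v)%:C * (1 - (th v)^-1 ^+ 2) / ((tb S)%:C * (1 - (cj w0)^-1 ^+ 2)))
         * th v * mmx S w0 v v.
Proof.
move=> w2; have [t2|t2] := eqVneq (th v ^+ 2) 1.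
  exists 0; last by rewrite mmx_edge // mulr0.
  apply: (normsq_glue hS); apply: cvg_near_cst; apply: nearW => n.
  rewrite /mass !big1 ?addr0 // => [s _|i _].
    by rewrite big1 // => k _; rewrite /res_chan resU_edge // nrm0 expr0n.
  suff -> : phi_limit i = 0 by rewrite nrm0 expr0n.
  apply: (cvgC_uniq (phi_limit_cvg i)); apply: (cvgC_ext (cvgC_cst 0)); apply: nearW => z.
  rewrite /core_vec big1 // => g _.
  by rewrite amp_edge // mul0r !mulr0.
have hdef : w0 ^+ 2 = 1 -> jost v 1 (th v) = 0 -> th v ^+ 2 = 1 by move/eqP; rewrite (negbTE w2).
have [K K0 eK] := good_site v.
have := phi_mass w2 t2 K0 eK; set l := (_ / _) => hl.
pose proof (cvg_Re hl) as hN.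
have lE : l = (Re l)%:C by exact: (cvgC_uniq hl (cvgC_real hN)).
exists (Re l); first exact: (normsq_glue hS hN).
rewrite -lE; have := theta_le1 v; rewrite le_eqVlt => /orP[/eqP t1|t1].
  suff m0 : mmx S w0 v v = 0.
    by rewrite /l (residue_formula _ _ hdef) m0 !mulr0 conjc0 mulr0 mul0r.
  have fle n : \sum_(k < n) nrm (resU k.+1 v v) ^+ 2 <= Re l.
    apply: le_trans (_ : mass n phi_limit res_chan <= _).
      rewrite /mass ler_wpDl //; first by apply: sumr_ge0 => i _; rewrite sqr_ge0.
      rewrite (bigD1 v) //= ler_wpDr //.
      by apply: sumr_ge0 => s _; apply: sumr_ge0 => k _; rewrite sqr_ge0.
    apply: (cvgr_to_ge hN); exists n => // n' /= nn; exact: mass_mono.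
  have f0 := square_sum_cvg0 (fun k => sqr_ge0 (nrm (resU k.+1 v v))) fle.
  have jc := jost_circle_cvg (@jost_asymptotics v) t1.
  have jcS : nrm (jost v k.+1 (th v)) @[k --> \oo] --> (1 : R).
    by rewrite -(cvg_shiftS (fun k => nrm (jost v k (th v)))) in jc.
  have f1 : nrm (resU k.+1 v v) ^+ 2 @[k --> \oo] --> (1 * nrm (mmx S w0 v v)) ^+ 2.
    rewrite (_ : (fun k => nrm (resU k.+1 v v) ^+ 2) =
      (fun k => (nrm (jost v k.+1 (th v)) * nrm (mmx S w0 v v)) ^+ 2)); last first.
      by apply/funext => k; rewrite (residue_formula _ _ hdef) nrmM.
    have h1 : nrm (jost v k.+1 (th v)) * nrm (mmx S w0 v v) @[k --> \oo]
        --> 1 * nrm (mmx S w0 v v) by apply: cvgM jcS _; exact: cvg_cst.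
    exact: (cvgM h1 h1).
  have : (1 * nrm (mmx S w0 v v)) ^+ 2 = 0 by exact: (cvg_unique _ f1 f0).
  by rewrite mul1r => /eqP; rewrite sqrf_eq0 nrm_eq0 => /eqP.
have It : Im (th v) = 0.
  apply: (joukowski_real_disk (a := cena v) (cenb_gt0 hS v) (theta_neq0 v) t1).
  by rewrite theta_eq lam0_real.
have tE : cj (th v) = th v by rewrite (realE It) conjR.
have eE : cj (jost v K (th v)) = jost v K (th v).
  by rewrite (realE (jost_conj_real v t1 (theta_neq0 v) It K)) conjR.
have -> : l = cj l by rewrite lE conjR.
rewrite /l (residue_formula _ _ hdef) !(conjM, conjV, conjB, conjN, conjR) !conjcK eE tE.
have -> : (1%:C : R[i]) = 1 by [].
rewrite !exprVn !expr2.
move: ((tb S)%:C * _) (mmx S w0 v v) (cenb v)%:C (th v) (theta_neq0 v) (jost v K _) eK => d m b t t0 e e0.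
by move: (d^-1) => d'; field; rewrite e0 t0.
Qed.

End Eigenvector.

End AtPoint.
End ModelFacts.

Theorem lemma8p2 (R : realType) (A : countType) (S : system R A)
  (hS : admissible S) (htheta : theta_spec S) (hjost : jost_spec S)
  (hpsol : psol_spec S) (w0 : R[i]) (hw0 : Omega S w0) :
  (mmx_defined S w0 -> forall k, ResU S k w0 = Emx S k w0 *m mmx S w0) /\
  (w0 ^+ 2 != 1 -> forall v : 'I_(nch S), exists phi : A -> R[i],
    [/\ is_phi w0 v phi,
        forall x, mx_apply (L S) phi x = lam S w0 * phi x,
        forall (s : 'I_(nch S)) k,
          phi (chan s k) = jost s k (theta s w0) * mmx S w0 s v,
        l2 phi &
        (fine (normsq phi))%:C =
          - ((cenb v)%:C * (1 - (theta v w0)^-1 ^+ 2)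
             / ((tb S)%:C * (1 - (w0^*)^-1 ^+ 2)))
          * theta v w0 * mmx S w0 v v]).
Proof.
have [iota iotaP] := attach_index hS.
split=> [hdef k|w2 v].
  apply/matrixP => s v; rewrite /Emx mul_diag_mx [RHS]mxE [X in X * _]mxE.
  exact: (residue_formula hS htheta hjost hpsol iotaP hw0 k s (hdef v)).
have hv : w0 ^+ 2 = 1 -> jost v 1 (theta v w0) = 0 -> theta v w0 ^+ 2 = 1.
  by move/eqP; rewrite (negbTE w2).
exists (phi hS htheta hjost hpsol iotaP hw0 v).
have [N nN NE] := phi_normsq hS htheta hjost hpsol iotaP hw0 v w2.
split.
- exact: phi_is_limit.
- exact: phi_eigen.
- by move=> s k; rewrite phi_attach; exact: residue_formula.
- by rewrite /l2 nN; exact: ltry.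
- by rewrite nN; exact: NE.
Qed.
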